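(* Let $(M,g)$ be a connected, oriented, $4$-dimensional Riemannian manifold admitting a non-parallel $*$-Killing $2$-form $\psi$, with induced ambikähler structure $(g_+,J_+,\omega_+)$, $(g_-,J_-,\omega_-)$, and on $M_1$ let $x=\frac12(f_++f_-)$, $y=\frac12(f_+-f_-)$. On $M_1$, the vector fields $$K_1:=J_+\mathrm{grad}_g(x+y)=J_-\mathrm{grad}_g(x-y)=J_+\mathrm{grad}_{g_+}\Big(\frac{-1}{x+y}\Big)=J_-\mathrm{grad}_{g_-}\Big(\frac{-1}{x-y}\Big)$$ (which is equal to the vector field $-\frac12\alpha^\sharp$) and $$K_2:=y^2J_+\mathrm{grad}_gx+x^2J_+\mathrm{grad}_gy=y^2J_-\mathrm{grad}_gx-x^2J_-\mathrm{grad}_gy=J_+\mathrm{grad}_{g_+}\Big(\frac{xy}{x+y}\Big)=J_-\mathrm{grad}_{g_-}\Big(\frac{-xy}{x-y}\Big)$$ are Killing with respect to $g,g_+,g_-$ and Hamiltonian with respect to $\omega_+$ and $\omega_-$. The momenta $\mu_1^+,\mu_2^+$ of $K_1,K_2$ with respect to $\omega_+$, and the momenta $\mu_1^-,\mu_2^-$ of $K_1,K_2$ with respect to $\omega_-$, are given by $$\mu_1^+=\frac{-1}{x+y},\quad \mu_2^+=\frac{xy}{x+y},\quad \mu_1^-=\frac{-1}{x-y},\quad \mu_2^-=\frac{-xy}{x-y},$$ and Poisson commute with respect to $\omega_+$ and $\omega_-$, meaning that $\omega_\pm(K_1,K_2)=0$, so that $[K_1,K_2]=0$ as well. In particular, on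 the open set $M_1$, the ambikähler structure $(g_+,J_+,\omega_+)$, $(g_-,J_-,\omega_-)$ is ambitoric.
   Context: On an oriented Riemannian $4$-manifold $(M,g)$ with Levi-Civita connection $\nabla$, a $2$-form $\psi$ is $*$-Killing if there is a real $1$-form $\alpha$ with $\nabla_X\psi=\alpha\wedge X^\flat$ for every vector field $X$; it is non-parallel if $\nabla\psi$ is not identically zero. Here $\alpha^\sharp$ is the vector field dual to $\alpha$ with respect to $g$. Let $\psi_\pm=\frac12(\psi\pm*\psi)$, and let $\Psi_\pm$ be the skew-symmetric endomorphism of $TM$ with $g(\Psi_\pm X,Y)=\psi_\pm(X,Y)$. Set $f_\pm=|\Psi_\pm|/\sqrt2$, where the norm of a skew-symmetric endomorphism $C$ is given by $|C|^2=-\frac12\mathrm{tr}(C^2)$. Let $M_0=\{f_+>0,\ f_->0\}$ (open and dense in $M$), $M_S=\{f_+\neq f_-\}$ and $M_1=M_0\cap M_S$. On $M_0$ set $J_\pm=\Psi_\pm/f_\pm$, $g_\pm=f_\pm^{-2}g$, $\omega_\pm=g_\pm(J_\pm\cdot,\cdot)$: these form the induced ambikähler structure, i.e. $(g_\pm,J_\pm,\omega_\pm)$ are Kähler, the metrics are conformal, $J_+$ induces the chosen orientation and $J_-$ the opposite one (hence $J_+,J_-$ commute). A vector field $K$ is Hamiltonian with momentum $\mu$ with respect to $\omega_\pm$ if $K=J_\pm\mathrm{grad}_{g_\pm}\mu$, equivalently $K\lrcorner\,\omega_\pm=-d\mu$. An ambikähler structure is ambitoric (in the sense of Apostolov, Calderbank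 and Gauduchon) if it is equipped with a $2$-dimensional space of vector fields, spanned by two vector fields linearly independent on a dense open set, which are Killing for $g_+$ and $g_-$, Hamiltonian with respect to $\omega_+$ and $\omega_-$, and Poisson-commute with respect to both; here the space is the one spanned by $K_1,K_2$.
   Formalization: Ambitoricity is asserted on M_1, or any open subset, only if K_1,K_2 are linearly independent on a dense open subset of it; this can fail: on round S^4 with ψ the restriction of e1∧e2+e3∧e4, x=1/2 is constant and K_2=K_1/4. *)

(* Defs.v *)
From HB Require Import structures.
From mathcomp Require Import all_boot all_order all_algebra.
From mathcomp Require Import all_classical all_reals all_analysis.

Set Implicit Arguments.
Unset Strict Implicit.
Unset Printing Implicit Defensive.

Import Order.TTheory GRing.Theory Num.Theory.
Import numFieldNormedType.Exports.
Local Open Scope classical_set_scope.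
Local Open Scope ring_scope.

(* C^k and C^oo functions on an open subset U of R^4: all iterated partial
   derivatives exist and are continuous at every point of U. *)
Definition partial {R : realType} (a : 'I_4) (f : 'rV[R]_4 -> R) :
    'rV[R]_4 -> R :=
  fun u => 'D_(delta_mx 0 a) f u.

Fixpoint Ck {R : realType} (k : nat) (U : set 'rV[R]_4) (f : 'rV[R]_4 -> R) :
    Prop :=
  (forall u, U u -> {for u, continuous f}) /\
  if k is k'.+1 then
    forall a : 'I_4,
      (forall u, U u -> derivable f u (delta_mx 0 a)) /\ Ck k' U (partial a f)
  else True.

Definition smooth {R : realType} (U : set 'rV[R]_4) (f : 'rV[R]_4 -> R) : Prop :=
  forall k, Ck k U f.

(* An oriented smooth atlas on M, modelled on R^4: coord i is a homeomorphism
   from the open set dom i onto an open set, with inverse param i, and the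
   transition maps are smooth with positive Jacobian determinant.  Values of
   coord i and param i outside these sets are irrelevant. *)
Record oriented_atlas (R : realType) (M : topologicalType) := OrientedAtlas {
  chart : Type;
  dom : chart -> set M;
  coord : chart -> M -> 'rV[R]_4;
  param : chart -> 'rV[R]_4 -> M;
  chart_at : M -> chart;
  dom_chart_at : forall p, dom (chart_at p) p;
  dom_open : forall i, open (dom i);
  img_open : forall i, open (coord i @` dom i);
  coordK : forall i p, dom i p -> param i (coord i p) = p;
  coord_continuous : forall i p, dom i p -> {for p, continuous (coord i)};
  param_continuous : forall i u, (coord i @` dom i) u ->
    {for u, continuous (param i)};
  transition_smooth : forall i j b,
    smooth (coord i @` (dom i `&` dom j)) (fun u => coord j (param i u) 0 b);
  transition_oriented : forall i j p, dom i p -> dom j p ->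
    0 < \det (\matrix_(a, b)
                partial a (fun u => coord j (param i u) 0 b) (coord i p))
}.

Arguments chart {R M}.
Arguments dom {R M o}.
Arguments coord {R M o}.
Arguments param {R M o}.
Arguments chart_at {R M}.

(* A tensor field is given by its components in every chart, subject to the
   transformation law under change of chart; only the values of T i on dom i
   are meaningful.  Tangent vectors and 1-forms are row vectors, a bilinear form
   B stands for (X, Y) |-> X *m B *m Y^T and an endomorphism C for
   X |-> X *m C. *)
Definition field {R : realType} {M : topologicalType} (A : oriented_atlas R M)
  (V : Type) := chart A -> M -> V.

Section Tensors.
Context {R : realType} {M : topologicalType} {A : oriented_atlas R M}.
Implicit Types (Om : set M) (f : M -> R) (i : chart A) (p : M).

(* partial derivative at p, with respect to the a-th coordinate of chart i *)
Definition pd i (a : 'I_4) f p : R := partial a (f \o param i) (coord i p).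

Definition jac (i j : chart A) p : 'M[R]_4 :=
  \matrix_(a, b) pd i a (fun q => coord j q 0 b) p.

Definition smooth_in i Om f := smooth (coord i @` (dom i `&` Om)) (f \o param i).

Definition smooth_fun Om f := forall i, smooth_in i Om f.

Definition smooth_field m n Om (T : field A 'M[R]_(m, n)) :=
  forall i a b, smooth_in i Om (fun q => T i q a b).

Definition tensor_law (V : Type) Om (T : field A V)
    (law : 'M[R]_4 -> V -> V -> Prop) :=
  forall i j p, Om p -> dom i p -> dom j p -> law (jac i j p) (T i p) (T j p).

Definition vector_field Om (X : field A 'rV[R]_4) :=
  smooth_field Om X /\ tensor_law Om X (fun P Xi Xj => Xj = Xi *m P).

Definition one_form Om (al : field A 'rV[R]_4) :=
  smooth_field Om al /\ tensor_law Om al (fun P ali alj => ali = alj *m P^T).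

Definition bilinear_field Om (B : field A 'M[R]_4) :=
  smooth_field Om B /\ tensor_law Om B (fun P Bi Bj => Bi = P *m Bj *m P^T).

Definition endo_field Om (C : field A 'M[R]_4) :=
  smooth_field Om C /\ tensor_law Om C (fun P Ci Cj => P *m Cj = Ci *m P).

Definition two_form Om (B : field A 'M[R]_4) :=
  bilinear_field Om B /\ forall i p, Om p -> dom i p -> (B i p)^T = - B i p.

Definition riemannian_metric Om (g : field A 'M[R]_4) :=
  [/\ bilinear_field Om g,
      forall i p, Om p -> dom i p -> (g i p)^T = g i p &
      forall i p, Om p -> dom i p -> forall v : 'rV[R]_4, v != 0 ->
        0 < (v *m g i p *m v^T) 0 0].

Definition eq_field (V : Type) Om (T T' : field A V) :=
  forall i p, Om p -> dom i p -> T i p = T' i p.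

Definition scale_field (V : lmodType R) f (T : field A V) : field A V :=
  fun i p => f p *: T i p.

Definition add_field (V : zmodType) (T T' : field A V) : field A V :=
  fun i p => T i p + T' i p.

Definition differential f : field A 'rV[R]_4 := fun i p => \row_a pd i a f p.

Definition flat (g : field A 'M[R]_4) (X : field A 'rV[R]_4) :
  field A 'rV[R]_4 := fun i p => X i p *m g i p.

Definition sharp (g : field A 'M[R]_4) (al : field A 'rV[R]_4) :
  field A 'rV[R]_4 := fun i p => al i p *m invmx (g i p).

Definition grad g f : field A 'rV[R]_4 := sharp g (differential f).

Definition act (C : field A 'M[R]_4) (X : field A 'rV[R]_4) :
  field A 'rV[R]_4 := fun i p => X i p *m C i p.

Definition bracket (X Y : field A 'rV[R]_4) : field A 'rV[R]_4 :=
  fun i p => \row_c \sum_l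
    (X i p 0 l * pd i l (fun q => Y i q 0 c) p
     - Y i p 0 l * pd i l (fun q => X i q 0 c) p).

(* Levi-Civita connection: nabla_{e_k} e_a = \sum_l (christoffel g i p l k a) e_l *)
Definition christoffel (g : field A 'M[R]_4) i p (l k a : 'I_4) : R :=
  2^-1 * \sum_m invmx (g i p) l m *
    (pd i k (fun q => g i q m a) p + pd i a (fun q => g i q m k) p
     - pd i m (fun q => g i q k a) p).

(* nabla_v B for a bilinear form B and a tangent vector v at p *)
Definition cov_deriv (g B : field A 'M[R]_4) i p (v : 'rV[R]_4) : 'M[R]_4 :=
  \sum_k v 0 k *: \matrix_(a, b)
    (pd i k (fun q => B i q a b) p
     - \sum_l christoffel g i p l k a * B i p l b
     - \sum_l christoffel g i p l k b * B i p a l).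

(* (al /\ be)(Y, Z) = al(Y) be(Z) - al(Z) be(Y) *)
Definition wedge (al be : 'rV[R]_4) : 'M[R]_4 := al^T *m be - be^T *m al.

(* nabla_X psi = al /\ X^flat; this is tensorial in X, hence required for the
   tangent vectors X at every point *)
Definition star_killing (g psi : field A 'M[R]_4) (al : field A 'rV[R]_4) :=
  forall i p, dom i p -> forall v : 'rV[R]_4,
    cov_deriv g psi i p v = wedge (al i p) (v *m g i p).

Definition parallel (g psi : field A 'M[R]_4) :=
  forall i p, dom i p -> forall v : 'rV[R]_4, cov_deriv g psi i p v = 0.

Definition levi_civita (c d a b : 'I_4) : R :=
  \det (\matrix_(i < 4, j < 4) (tnth [tuple c; d; a; b] i == j)%:R).

(* ( *psi)_ab = 1/2 sqrt(det g) \sum_(c,d) eps_cdab psi^cd, the charts being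
   positively oriented *)
Definition hodge (g psi : field A 'M[R]_4) : field A 'M[R]_4 := fun i p =>
  \matrix_(a, b) (2^-1 * Num.sqrt (\det (g i p)) * \sum_c \sum_d
    levi_civita c d a b * (invmx (g i p) *m psi i p *m invmx (g i p)) c d).

Definition sd_part (g psi : field A 'M[R]_4) : field A 'M[R]_4 :=
  fun i p => 2^-1 *: (psi i p + hodge g psi i p).

Definition asd_part (g psi : field A 'M[R]_4) : field A 'M[R]_4 :=
  fun i p => 2^-1 *: (psi i p - hodge g psi i p).

(* the endomorphism C with g(C X, Y) = phi(X, Y) *)
Definition endo_of (g phi : field A 'M[R]_4) : field A 'M[R]_4 :=
  fun i p => phi i p *m invmx (g i p).

(* |C|, |C|^2 = - 1/2 tr(C^2), computed in a chart around p; the value does not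
   depend on the chart when C is an endomorphism field *)
Definition endo_norm (C : field A 'M[R]_4) p : R :=
  let Cp := C (chart_at A p) p in Num.sqrt (- 2^-1 * \tr (Cp *m Cp)).

(* Structure induced by phi = psi_+ or psi_-:
   f = |Phi| / sqrt 2, J = Phi / f, f^-2 g, and omega = (f^-2 g)(J _, _) *)
Definition ff g phi p : R := endo_norm (endo_of g phi) p / Num.sqrt 2.

Definition ak_J g phi : field A 'M[R]_4 :=
  scale_field (fun p => (ff g phi p)^-1) (endo_of g phi).

Definition ak_g g phi : field A 'M[R]_4 :=
  scale_field (fun p => (ff g phi p) ^- 2) g.

Definition ak_omega g phi : field A 'M[R]_4 :=
  fun i p => ak_J g phi i p *m ak_g g phi i p.

(* L_K g = 0 *)
Definition killing Om (g : field A 'M[R]_4) (K : field A 'rV[R]_4) :=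
  vector_field Om K /\
  forall i p, Om p -> dom i p -> forall a b,
    \sum_l (K i p 0 l * pd i l (fun q => g i q a b) p
            + pd i a (fun q => K i q 0 l) p * g i p l b
            + pd i b (fun q => K i q 0 l) p * g i p a l) = 0.

(* K = J grad_g mu *)
Definition momentum Om g J (K : field A 'rV[R]_4) mu :=
  smooth_fun Om mu /\ eq_field Om K (act J (grad g mu)).

Definition hamiltonian Om g J K := exists mu, momentum Om g J K mu.

Definition poisson_commute Om (omega : field A 'M[R]_4)
    (K1 K2 : field A 'rV[R]_4) :=
  forall i p, Om p -> dom i p -> (K1 i p *m omega i p *m (K2 i p)^T) 0 0 = 0.

Definition coord_field (a : 'I_4) : field A 'rV[R]_4 := fun _ _ => delta_mx 0 a.

(* Nijenhuis tensor [JX,JY] - J[JX,Y] - J[X,JY] - [X,Y] *)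
Definition nijenhuis (J : field A 'M[R]_4) (X Y : field A 'rV[R]_4) :
    field A 'rV[R]_4 := fun i p =>
  bracket (act J X) (act J Y) i p - act J (bracket (act J X) Y) i p
  - act J (bracket X (act J Y)) i p - bracket X Y i p.

Definition closed_two_form Om (omega : field A 'M[R]_4) :=
  two_form Om omega /\
  forall i p, Om p -> dom i p -> forall a b c,
    pd i a (fun q => omega i q b c) p + pd i b (fun q => omega i q c a) p
    + pd i c (fun q => omega i q a b) p = 0.

Definition kahler Om (g J omega : field A 'M[R]_4) :=
  [/\ riemannian_metric Om g,
      endo_field Om J,
      (forall i p, Om p -> dom i p ->
        J i p *m J i p = - 1%:M /\ J i p *m g i p *m (J i p)^T = g i p),
      (forall i p, Om p -> dom i p -> forall a b,
        nijenhuis J (coord_field a) (coord_field b) i p = 0) &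
      eq_field Om omega (fun i p => J i p *m g i p) /\ closed_two_form Om omega].

(* determinant of the frame (X, JX, Y, JY) *)
Definition complex_frame (C : 'M[R]_4) (X Y : 'rV[R]_4) : 'M[R]_4 :=
  col_mx (col_mx X (X *m C)) (col_mx Y (Y *m C)).

Definition induces_orientation Om (J : field A 'M[R]_4) :=
  forall i p, Om p -> dom i p -> forall X Y,
    \det (complex_frame (J i p) X Y) != 0 ->
    0 < \det (complex_frame (J i p) X Y).

Definition induces_opposite_orientation Om (J : field A 'M[R]_4) :=
  forall i p, Om p -> dom i p -> forall X Y,
    \det (complex_frame (J i p) X Y) != 0 ->
    \det (complex_frame (J i p) X Y) < 0.

Definition ambikahler Om gp Jp omp gm Jm omm :=
  [/\ kahler Om gp Jp omp,
      kahler Om gm Jm omm,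
      (exists u, [/\ smooth_fun Om u, forall p, Om p -> 0 < u p &
                     eq_field Om gm (scale_field u gp)]),
      induces_orientation Om Jp &
      induces_opposite_orientation Om Jm].

Definition indep_on_dense_open Om (K1 K2 : field A 'rV[R]_4) :=
  exists D : set M, [/\ open D, D `<=` Om, Om `<=` closure D &
    forall i p, D p -> dom i p -> row_free (col_mx (K1 i p) (K2 i p))].

Definition lin_comb (K1 K2 : field A 'rV[R]_4) (c : R * R) :
    field A 'rV[R]_4 :=
  fun i p => c.1 *: K1 i p + c.2 *: K2 i p.

(* Ambitoric structure whose space of vector fields is spanned by K1 and K2.
   The independence clause is not automatic for the fields K1, K2 attached to a
   star-Killing form: for the restriction to the unit sphere S^4 of the constant
   form e1 /\ e2 + e3 /\ e4 on R^5, one has K2 = K1 / 4 everywhere. *)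
Definition ambitoric Om gp Jp omp gm Jm omm K1 K2 :=
  [/\ ambikahler Om gp Jp omp gm Jm omm,
      indep_on_dense_open Om K1 K2,
      forall c, killing Om gp (lin_comb K1 K2 c) /\
                killing Om gm (lin_comb K1 K2 c),
      forall c, hamiltonian Om gp Jp (lin_comb K1 K2 c) /\
                hamiltonian Om gm Jm (lin_comb K1 K2 c) &
      forall c d,
        poisson_commute Om omp (lin_comb K1 K2 c) (lin_comb K1 K2 d) /\
        poisson_commute Om omm (lin_comb K1 K2 c) (lin_comb K1 K2 d)].

End Tensors.

(* Main.v *)
Require Import Defs.
From HB Require Import structures.
From mathcomp Require Import all_boot all_order all_algebra.
From mathcomp Require Import all_classical all_reals all_analysis.
From mathcomp Require Import fingroup perm ring lra.
Import Order.TTheory GRing.Theory Num.Theory.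
Import numFieldNormedType.Exports.
Local Open Scope classical_set_scope.
Local Open Scope ring_scope.

(** The idea.  A star-Killing form satisfies nabla_x psi = alpha /\ x, and the
    Levi-Civita connection commutes with the Hodge star ([covd_star]), so the
    two halves psi_+ and psi_- have as covariant derivatives the two halves of
    alpha /\ x.  In dimension four the endomorphism of an antisymmetric form
    that is an eigenvector of the star squares to a multiple of the identity
    ([raise_sqr]), and the corresponding half of any other antisymmetric form
    chi is expressed by chi and J chi J ([raise_dual_part]).  Together these
    facts yield, with v the vector dual to alpha and X the endomorphism of
    alpha /\ x,
<<
      df(x) = - 1/2 alpha(J x),       nabla_x J = (X + J X J) / (2 f)
>>
    for (f, J) = (f_+, J_+) and (f_-, J_-) ([partial_norm_part],
    [dmx_J_part]).  The formula for df says that J grad f = - 1/2 v for both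
    signs: this is K1, and all the expressions of K1 and K2 as J-rotated
    gradients are instances of it, by the chain rule ([grad_frame]).  The
    formula for nabla J is what makes the structures (f^-2 g, J, omega) Kahler:
    the vanishing of the Nijenhuis tensor and of d omega become identities of
    linear algebra at a point ([nabla_J_nijenhuis], [nabla_J_closed]).

    That K1 is Killing is not formal: it means that A = nabla alpha is
    antisymmetric.  The Ricci identity applied to psi gives a linear relation
    between A and the curvature ([star_killing_curvature]).  In a frame adapted
    to the commuting structures J_+ and J_-, in which psi rotates two orthogonal
    planes with speeds f_+ + f_- and f_+ - f_-, the symmetries of the curvature
    then force A to be antisymmetric and to commute with J_+ and J_-
    ([star_killing_algebra]); this is where f_+ <> f_- enters.  After that
    nabla K2 is computed by the product rule, and the Killing equation of K2 and
    the vanishing of [K1, K2] are again linear algebra ([nabla_K2_killing],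
    [nabla_K1_K2]).  Since df_+ and df_- vanish on K1 and K2, both fields remain
    Killing for the conformal metrics ([lie_conformal]).

    The relations omega(K1, K2) = 0 hold because K1 is a multiple of v and K2 a
    combination of v and J_- J_+ v, and x is orthogonal to J x for every
    skew-symmetric J.  The orientations follow from comparing the determinant of
    a frame (X, JX, Y, JY) with the coefficient of omega /\ omega
    ([complex_frame_det]).  The ambitoric structure on an open set only combines
    these facts linearly ([ambitoric_of_momenta]).

    All differential computations are done in one chart, on functions of four
    real variables with matrix values.  Vectors are rows, so an endomorphism
    acts by multiplication on the right, and the composite J_- J_+ v is
    [v *m J_+ *m J_-].  The sign [sg], with [sg * sg = 1], is carried as a
    variable wherever the two halves behave in the same way. *)

Set Implicit Arguments.
Unset Strict Implicit.
Unset Printing Implicit Defensive.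

Local Notation coord := Defs.coord.

(** * Smooth functions on open subsets of R^4 *)

Section Calc.
Context {R : realType}.
Implicit Types (U V : set 'rV[R]_4) (f h : 'rV[R]_4 -> R) (u v : 'rV[R]_4).

Lemma Ck_mono k U f : Ck k.+1 U f -> Ck k U f.
Proof.
elim: k f => [|k IH] f [cf hf]; first by split.
split=> // a; have [d1 d2] := hf a; split=> //; exact: IH.
Qed.

Lemma Ck_sub k U V f : V `<=` U -> Ck k U f -> Ck k V f.
Proof.
move=> VU; elim: k f => [|k IH] f [cf hf].
  by split=> // u /VU; exact: cf.
split=> [u /VU|a]; first exact: cf.
have [d1 d2] := hf a; split=> [u /VU|]; [exact: d1 | exact: IH].
Qed.

Lemma near_eq_on U f h u : open U -> U u -> (forall w, U w -> f w = h w) ->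
  {near u, f =1 h}.
Proof.
move=> oU Uu fh; have : nbhs u U by exact: open_nbhs_nbhs.
by apply: filterS => w /fh.
Qed.

Lemma partial_ext U f h a u : open U -> U u -> (forall w, U w -> f w = h w) ->
  partial a f u = partial a h u.
Proof.
move=> oU Uu fh; rewrite /partial; apply: near_eq_derive.
exact: near_eq_on fh.
Qed.

Lemma Ck_ext k U f h : open U -> (forall w, U w -> f w = h w) -> Ck k U f -> Ck k U h.
Proof.
move=> oU; elim: k f h => [|k IH] f h fh [cf hf].
  split=> // u Uu; have nfh := near_eq_on oU Uu fh.
  change (h @ u --> h u); rewrite -(fh _ Uu); exact: cvg_trans (near_eq_cvg nfh) (cf u Uu).
split=> [u Uu|a].
  have nfh := near_eq_on oU Uu fh.
  change (h @ u --> h u); rewrite -(fh _ Uu); exact: cvg_trans (near_eq_cvg nfh) (cf u Uu).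
have [d1 d2] := hf a; split=> [u Uu|].
  apply: near_eq_derivable (d1 u Uu).
  exact: near_eq_on fh.
apply: IH d2 => w Uw; exact: partial_ext fh.
Qed.

Lemma Ck_cst k U (c : R) : Ck k U (fun=> c).
Proof.
elim: k c => [|k IH] c; (split=> [u _|]; first exact: cst_continuous) => //.
move=> a; split=> [u _|]; first exact: derivable_cst.
have -> : partial a (fun=> c) = fun=> (0 : R).
  by apply/funext=> u; rewrite /partial derive_cst.
exact: IH.
Qed.

Lemma CkD k U f h : open U -> Ck k U f -> Ck k U h -> Ck k U (fun u => f u + h u).
Proof.
move=> oU; elim: k f h => [|k IH] f h [cf hf] [ch hh].
  by split=> // u Uu; apply: continuousD; [exact: cf|exact: ch].
split=> [u Uu|a]; first by apply: continuousD; [exact: cf|exact: ch].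
have [d1 d2] := hf a; have [e1 e2] := hh a; split=> [u Uu|].
  by apply: derivableD; [exact: d1|exact: e1].
apply: Ck_ext (IH _ _ d2 e2) => // w Uw.
by rewrite /partial deriveD //; [exact: d1|exact: e1].
Qed.

Lemma CkM k U f h : open U -> Ck k U f -> Ck k U h -> Ck k U (fun u => f u * h u).
Proof.
move=> oU; elim: k f h => [|k IH] f h Hf Hh.
  have [cf _] := Hf; have [ch _] := Hh.
  by split=> // u Uu; apply: continuousM; [exact: cf|exact: ch].
have Hf' := Ck_mono Hf; have Hh' := Ck_mono Hh.
have [cf hf] := Hf; have [ch hh] := Hh.
split=> [u Uu|a]; first by apply: continuousM; [exact: cf|exact: ch].
have [d1 d2] := hf a; have [e1 e2] := hh a; split=> [u Uu|].
  by apply: derivableM; [exact: d1|exact: e1].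
apply: (Ck_ext (f := fun w => f w * partial a h w + h w * partial a f w)) => //.
  move=> w Uw; rewrite /partial [RHS](deriveM (f := f) (g := h)) //.
    exact: d1.
  exact: e1.
by apply: CkD => //; apply: IH.
Qed.

Lemma CkV k U f : open U -> (forall u, U u -> f u != 0) ->
  Ck k U f -> Ck k U (fun u => (f u)^-1).
Proof.
move=> oU nz; elim: k => [|k IH] Hf.
  have [cf _] := Hf.
  by split=> // u Uu; apply: continuousV; [exact: nz|exact: cf].
have Hf' := Ck_mono Hf.
have [cf hf] := Hf.
split=> [u Uu|a]; first by apply: continuousV; [exact: nz|exact: cf].
have [d1 d2] := hf a; split=> [u Uu|].
  by apply: derivableV; [exact: nz|exact: d1].
apply: (Ck_ext (f := fun w => (-1 * ((f w)^-1 * (f w)^-1)) * partial a f w)) => //.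
  move=> w Uw; rewrite /partial [RHS](deriveV (f := f)) //; last exact: d1.
    by rewrite mulN1r -expr2 exprVn.
  exact: nz.
apply: CkM => //; apply: CkM => //; first exact: Ck_cst.
by apply: CkM => //; apply: IH.
Qed.

(** Directional derivatives reduce to derivatives of functions of one real
    variable, for which the mean value theorem and the chain rule are available. *)
Lemma is_derive_line f u v (t d : R) : is_derive (t *: v + u) v f d ->
  is_derive t 1 (fun s : R => f (s *: v + u)) d.
Proof.
case=> fd <-.
have E : (fun h : R => h^-1 *: (f ((h *: (1 : R) + t) *: v + u) - f (t *: v + u)))
   = (fun h : R => h^-1 *: (f (h *: v + (t *: v + u)) - f (t *: v + u))).
  apply/funext => h; congr (_ *: (f _ - _)).
  by rewrite addrA -scalerDl /GRing.scale /= mulr1.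
by split; [rewrite /derivable /= E|rewrite /derive /= E].
Qed.

Lemma is_derive_sqrt f u v : 0 < f u -> derivable f u v ->
  is_derive u v (fun w => Num.sqrt (f w)) ((2 * Num.sqrt (f u))^-1 * 'D_v f u).
Proof.
move=> fu0 /derivableP fd.
have fd0 : is_derive (0 : R) (1:R) (fun s : R => f (s *: v + u)) ('D_v f u).
  by apply: is_derive_line; rewrite scale0r add0r.
have sd : is_derive ((fun s : R => f (s *: v + u)) 0) (1:R) (Num.sqrt : R -> R)
    (2 * Num.sqrt (f u))^-1.
  by rewrite /= scale0r add0r; apply: is_derive1_sqrt.
have [H1 H2] := is_derive1_comp sd fd0.
split; first by apply/derivable1P.
rewrite -H2 /derive.
have E : (fun h : R => h^-1 *: (Num.sqrt (f (h *: v + u)) - Num.sqrt (f u))) =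
  (fun h : R => h^-1 *: ((Num.sqrt \o (fun s : R => f (s *: v + u))) (h *: (1:R) + 0)
      - (Num.sqrt \o (fun s : R => f (s *: v + u))) 0)).
  by apply/funext => h /=; rewrite scale0r !add0r addr0 [_%:A]mulr1.
by rewrite E.
Qed.

Lemma Ck_sqrt k U f : open U -> (forall u, U u -> 0 < f u) ->
  Ck k U f -> Ck k U (fun u => Num.sqrt (f u)).
Proof.
move=> oU pos.
have C0 u : U u -> {for u, continuous f} -> {for u, continuous (fun u => Num.sqrt (f u))}.
  move=> Uu cf; apply: continuous_comp => //; exact: sqrt_continuous.
elim: k => [|k IH] Hf.
  have [cf _] := Hf; split=> // u Uu; apply: C0 => //; exact: cf.
have Hf' := Ck_mono Hf.
have [cf hf] := Hf.
split=> [u Uu|a]; first by apply: C0 => //; exact: cf.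
have [d1 d2] := hf a; split=> [u Uu|].
  by have [] := is_derive_sqrt (pos _ Uu) (d1 _ Uu).
apply: (Ck_ext (f := fun w => (2 * Num.sqrt (f w))^-1 * partial a f w)) => //.
  move=> w Uw; rewrite /partial.
  by have [_ ->] := is_derive_sqrt (pos _ Uw) (d1 _ Uw).
apply: CkM => //; apply: CkV => //.
  by move=> w Uw; rewrite mulf_neq0 // gt_eqF // sqrtr_gt0 pos.
by apply: CkM => //; [exact: Ck_cst | exact: IH].
Qed.

Lemma smooth_sub U V f : V `<=` U -> smooth U f -> smooth V f.
Proof. by move=> VU H k; apply: Ck_sub (H k). Qed.

Lemma smooth_ext U f h : open U -> (forall w, U w -> f w = h w) -> smooth U f -> smooth U h.
Proof. by move=> oU E H k; apply: Ck_ext (H k). Qed.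

Lemma smooth_cst U (c : R) : smooth U (fun=> c).
Proof. by move=> k; apply: Ck_cst. Qed.

Lemma smoothD U f h : open U -> smooth U f -> smooth U h -> smooth U (fun u => f u + h u).
Proof. by move=> oU Hf Hh k; apply: CkD. Qed.

Lemma smoothM U f h : open U -> smooth U f -> smooth U h -> smooth U (fun u => f u * h u).
Proof. by move=> oU Hf Hh k; apply: CkM. Qed.

Lemma smoothV U f : open U -> (forall u, U u -> f u != 0) -> smooth U f ->
  smooth U (fun u => (f u)^-1).
Proof. by move=> oU nz Hf k; apply: CkV. Qed.

Lemma smooth_sqrt U f : open U -> (forall u, U u -> 0 < f u) -> smooth U f ->
  smooth U (fun u => Num.sqrt (f u)).
Proof. by move=> oU nz Hf k; apply: Ck_sqrt. Qed.

Lemma smooth_partial U a f : smooth U f -> smooth U (partial a f).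
Proof. by move=> Hf k; have [_ /(_ a) []] := Hf k.+1. Qed.

Lemma smooth_continuous U f u : smooth U f -> U u -> {for u, continuous f}.
Proof. by move=> /(_ 0) [] H _; exact: H. Qed.

Lemma smooth_derivable U a f u : smooth U f -> U u -> derivable f u (delta_mx 0 a).
Proof. by move=> /(_ 1) [_ /(_ a) []] H _; exact: H. Qed.

Lemma smoothN U f : open U -> smooth U f -> smooth U (fun u => - f u).
Proof.
move=> oU Hf; apply: (smooth_ext (f := fun u => -1 * f u)) => //.
  by move=> w _; rewrite mulN1r.
by apply: smoothM => //; exact: smooth_cst.
Qed.

Lemma smoothB U f h : open U -> smooth U f -> smooth U h -> smooth U (fun u => f u - h u).
Proof. by move=> oU Hf Hh; apply: smoothD => //; exact: smoothN. Qed.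

Lemma smooth_sum U (I : Type) (r : seq I) (P : pred I) (F : I -> 'rV[R]_4 -> R) :
  open U -> (forall i, smooth U (F i)) -> smooth U (fun u => \sum_(i <- r | P i) F i u).
Proof.
move=> oU HF; elim: r => [|i r IH].
  by under eq_fun do rewrite big_nil; exact: smooth_cst.
under eq_fun do rewrite big_cons; case: (P i) => //.
by apply: smoothD.
Qed.

Lemma smooth_prod U (I : Type) (r : seq I) (P : pred I) (F : I -> 'rV[R]_4 -> R) :
  open U -> (forall i, smooth U (F i)) -> smooth U (fun u => \prod_(i <- r | P i) F i u).
Proof.
move=> oU HF; elim: r => [|i r IH].
  by under eq_fun do rewrite big_nil; exact: smooth_cst.
under eq_fun do rewrite big_cons; case: (P i) => //.
by apply: smoothM.
Qed.

Section rules.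
Variables (U : set 'rV[R]_4) (u : 'rV[R]_4).
Hypotheses (Uu : U u).

Lemma partial_cst a (c : R) : partial a (fun=> c) u = 0.
Proof. by rewrite /partial derive_cst. Qed.

Lemma partialD a f h : smooth U f -> smooth U h ->
  partial a (fun u => f u + h u) u = partial a f u + partial a h u.
Proof.
by move=> Hf Hh; rewrite /partial deriveD //; apply: smooth_derivable Uu.
Qed.

Lemma partialM a f h : smooth U f -> smooth U h ->
  partial a (fun u => f u * h u) u = partial a f u * h u + f u * partial a h u.
Proof.
move=> Hf Hh; rewrite /partial [LHS](deriveM (f := f) (g := h)) //.
- by rewrite addrC mulrC.
- exact: smooth_derivable Uu.
- exact: smooth_derivable Uu.
Qed.

Lemma partialZ a c f : smooth U f -> partial a (fun u => c * f u) u = c * partial a f u.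
Proof.
by move=> Hf; rewrite partialM // ?partial_cst ?mul0r ?add0r //; exact: smooth_cst.
Qed.

Lemma partialN a f : smooth U f -> partial a (fun u => - f u) u = - partial a f u.
Proof.
move=> Hf; rewrite -mulN1r -partialZ //; congr partial.
by apply/funext => w; rewrite mulN1r.
Qed.

Lemma partialV a f : f u != 0 -> smooth U f ->
  partial a (fun u => (f u)^-1) u = - (f u) ^- 2 * partial a f u.
Proof.
move=> nz Hf; rewrite /partial [LHS](deriveV (f := f)) //.
exact: smooth_derivable Uu.
Qed.

Lemma partial_sqrt a f : 0 < f u -> smooth U f ->
  partial a (fun u => Num.sqrt (f u)) u = (2 * Num.sqrt (f u))^-1 * partial a f u.
Proof.
move=> p Hf; rewrite /partial.
by have [_ ->] := is_derive_sqrt p (smooth_derivable (a := a) Hf Uu).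
Qed.

Lemma partial_sum a (I : Type) (r : seq I) (P : pred I) (F : I -> 'rV[R]_4 -> R) :
  open U -> (forall i, smooth U (F i)) ->
  partial a (fun u => \sum_(i <- r | P i) F i u) u = \sum_(i <- r | P i) partial a (F i) u.
Proof.
move=> oU HF; elim: r => [|i r IH].
  by under eq_fun do rewrite big_nil; rewrite partial_cst big_nil.
under eq_fun do rewrite big_cons; rewrite big_cons; case: (P i) => //.
by rewrite partialD // ?IH //; exact: smooth_sum.
Qed.
End rules.

(** The mean value theorem, applied first in direction a to the increment in
    direction b and then in direction b, turns the second difference quotient
    over a square of side t into a mixed derivative at some point of the square. *)
Lemma mixed_difference U f a b u w (t : R) : 0 < t ->
   w = t *: delta_mx 0 a + (t *: delta_mx 0 b + u) ->
   (forall r s, 0 <= r <= t -> 0 <= s <= t ->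
      U (r *: delta_mx 0 a + (s *: delta_mx 0 b + u))) ->
   smooth U f ->
   exists r s : R, [/\ 0 <= r <= t, 0 <= s <= t &
     f w - f (t *: delta_mx 0 a + u)
      - f (t *: delta_mx 0 b + u) + f u
     = partial b (partial a f) (r *: delta_mx 0 a + (s *: delta_mx 0 b + u)) * (t * t)].
Proof.
move=> t0 -> HU Hf.
set ea : 'rV[R]_4 := delta_mx 0 a; set eb : 'rV[R]_4 := delta_mx 0 b.
have tt : 0 <= t <= t by rewrite lexx ltW.
have oo : 0 <= (0:R) <= t by rewrite lexx ltW.
pose F (r : R) := f (r *: ea + (t *: eb + u)) - f (r *: ea + u).
pose dF (r : R) := partial a f (r *: ea + (t *: eb + u)) - partial a f (r *: ea + u).
have U0 r : 0 <= r <= t -> U (r *: ea + u).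
  by move=> rt; have := HU r 0 rt oo; rewrite scale0r add0r.
have FD r : 0 <= r <= t -> is_derive r (1:R) F (dF r).
  move=> rt; apply: is_deriveB; apply: is_derive_line; apply: derivableP.
    by apply: smooth_derivable Hf (HU r t rt tt).
  by apply: smooth_derivable Hf (U0 r rt).
have cts (G dG : R -> R) : (forall r : R, 0 <= r <= t -> is_derive r (1:R) G (dG r)) ->
   {within `[0, t], continuous G}.
  move=> HG; apply: derivable_within_continuous => r; rewrite in_itv /= => rt.
  by have [] := HG r rt.
have [r] := @MVT R F dF 0 t t0
  (fun r rt => FD r (subset_itv_oo_cc rt)) (cts F dF FD).
move=> /subset_itv_oo_cc; rewrite /= in_itv /= => rt; rewrite subr0 => E.
pose G (s : R) := partial a f (s *: eb + (r *: ea + u)).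
pose dG (s : R) := partial b (partial a f) (s *: eb + (r *: ea + u)).
have comm (s : R) : s *: eb + (r *: ea + u) = r *: ea + (s *: eb + u) by rewrite addrCA.
have GD s : 0 <= s <= t -> is_derive s (1:R) G (dG s).
  move=> st; apply: is_derive_line; apply: derivableP.
  by apply: smooth_derivable (smooth_partial a Hf) _; rewrite comm; exact: HU.
have [s] := @MVT R G dG 0 t t0
  (fun s st => GD s (subset_itv_oo_cc st)) (cts G dG GD).
move=> /subset_itv_oo_cc; rewrite /= in_itv /= => st; rewrite subr0 => E2.
exists r, s; split=> //.
have E2' : dF r = dG s * t by rewrite -E2 /G /dF scale0r add0r comm.
by rewrite mulrA -comm -[partial b _ _]/(dG s) -E2' -E /F scale0r !add0r; ring.
Qed.

(** Both orders of differentiation are limits of the same second difference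
    quotient. *)
Lemma schwarz U f a b u : open U -> U u -> smooth U f ->
  partial a (partial b f) u = partial b (partial a f) u.
Proof.
move=> oU Uu Hf.
set ea : 'rV[R]_4 := delta_mx 0 a; set eb : 'rV[R]_4 := delta_mx 0 b.
apply/eqP; rewrite -subr_eq0 -normr_le0; apply/ler_addgt0Pr => e e0; rewrite add0r.
have e20 : 0 < e / 2 by rewrite divr_gt0.
have c1 := smooth_continuous (smooth_partial a (smooth_partial b Hf)) Uu.
have c2 := smooth_continuous (smooth_partial b (smooth_partial a Hf)) Uu.
have n1 : \forall w \near u, `|partial a (partial b f) u - partial a (partial b f) w| < e / 2.
  by move/cvgrPdist_lt : c1 => /(_ _ e20).
have n2 : \forall w \near u, `|partial b (partial a f) u - partial b (partial a f) w| < e / 2.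
  by move/cvgrPdist_lt : c2 => /(_ _ e20).
have n3 : \forall w \near u, U w by exact: open_nbhs_nbhs.
have [d /= d0 Hd] := (nbhs_ballP u _).1 (filterI n1 (filterI n2 n3)).
pose c := `|ea| + `|eb| + 1.
have c0 : 0 < c by rewrite /c ltr_wpDl // addr_ge0.
(* c bounds the diagonal of the unit square spanned by ea and eb, so that the
   square of side t lies in the ball of radius d. *)
pose t := d / (2 * c).
have t0 : 0 < t by rewrite /t divr_gt0 // mulr_gt0.
have inB (r s : R) : 0 <= r <= t -> 0 <= s <= t -> ball u d (r *: ea + (s *: eb + u)).
  move=> /andP[r0 rt] /andP[s0 st]; rewrite -ball_normE /= addrA opprD addrCA subrr addr0 normrN.
  apply: (le_lt_trans (ler_normD _ _)); rewrite !normrZ !ger0_norm //.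
  have -> : d = t * c + t * c by rewrite /t; field; rewrite gt_eqF.
  have h1 : r * `|ea| <= t * `|ea| by rewrite ler_wpM2r.
  have h2 : s * `|eb| <= t * `|eb| by rewrite ler_wpM2r.
  have h3 : 0 <= t * `|ea| by rewrite mulr_ge0 // ltW.
  have h4 : 0 <= t * `|eb| by rewrite mulr_ge0 // ltW.
  have E : t * c = t * `|ea| + t * `|eb| + t by rewrite /c; ring.
  rewrite E; lra.
pose w := t *: ea + (t *: eb + u).
have [r [s [rt st E]]] : exists r s : R, [/\ 0 <= r <= t, 0 <= s <= t &
     f w - f (t *: ea + u) - f (t *: eb + u) + f u
     = partial b (partial a f) (r *: ea + (s *: eb + u)) * (t * t)].
  apply: mixed_difference Hf => // r s rt st; by have [_ []] := Hd _ (inB _ _ rt st).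
have [r' [s' [rt' st' E']]] : exists r s : R, [/\ 0 <= r <= t, 0 <= s <= t &
     f w - f (t *: eb + u) - f (t *: ea + u) + f u
     = partial a (partial b f) (r *: eb + (s *: ea + u)) * (t * t)].
  apply: mixed_difference Hf => //; first by rewrite /w; exact: addrCA.
  move=> r' s' rt' st'.
  by rewrite addrCA; have [_ []] := Hd _ (inB _ _ st' rt').
have [_ [B2 _]] := Hd _ (inB _ _ rt st).
have [B1 _] := Hd _ (inB _ _ st' rt').
rewrite /= in B1 B2; rewrite addrCA in B1.
have EE : partial b (partial a f) (r *: ea + (s *: eb + u)) =
   partial a (partial b f) (r' *: eb + (s' *: ea + u)).
  have tn : t * t != 0 by rewrite mulf_neq0 // gt_eqF.
  move: E E'.
  set X := partial b (partial a f) (r *: ea + (s *: eb + u)).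
  set Y := partial a (partial b f) (r' *: eb + (s' *: ea + u)).
  set F1 := f w; set F2 := f (t *: ea + u); set F3 := f (t *: eb + u); set F4 := f u.
  move=> E E'.
  clearbody X Y F1 F2 F3 F4; apply: (mulIf tn).
  by rewrite -E -E'; ring.
rewrite EE in B2; move: B1 B2.
set A := partial a _ u; set B := partial b _ u; set C := partial a _ _.
move=> B1 B2; clearbody A B C; have -> : A - B = (A - C) - (B - C) by ring.
apply: (le_trans (ler_normB _ _)).
by rewrite (splitr e); apply: lerD; exact: ltW.
Qed.
End Calc.

(** * Smooth matrix-valued functions *)

Section MxCalc.
Context {R : realType}.
Implicit Types (U : set 'rV[R]_4) (f : 'rV[R]_4 -> R) (u : 'rV[R]_4).

Definition smooth_mx m n U (F : 'rV[R]_4 -> 'M[R]_(m, n)) :=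
  forall i j, smooth U (fun w => F w i j).

Definition dmx m n (k : 'I_4) (F : 'rV[R]_4 -> 'M[R]_(m, n)) (u : 'rV[R]_4) : 'M[R]_(m, n) :=
  \matrix_(i, j) partial k (fun w => F w i j) u.

Section open.
Context {U : set 'rV[R]_4}.
Hypothesis oU : open U.

Lemma smooth_mx_ext m n (F G : 'rV[R]_4 -> 'M[R]_(m, n)) :
  (forall w, U w -> F w = G w) -> smooth_mx U F -> smooth_mx U G.
Proof.
move=> E HF i j; apply: smooth_ext (HF i j) => // w Uw; by rewrite E.
Qed.

Lemma smooth_mx_cst m n (A : 'M[R]_(m, n)) : smooth_mx U (fun=> A).
Proof. by move=> i j; exact: smooth_cst. Qed.

Lemma smooth_mxD m n (F G : 'rV[R]_4 -> 'M[R]_(m, n)) :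
  smooth_mx U F -> smooth_mx U G -> smooth_mx U (fun w => F w + G w).
Proof.
move=> HF HG i j; under eq_fun do rewrite mxE; exact: smoothD.
Qed.

Lemma smooth_mxN m n (F : 'rV[R]_4 -> 'M[R]_(m, n)) :
  smooth_mx U F -> smooth_mx U (fun w => - F w).
Proof.
by move=> HF i j; under eq_fun do rewrite mxE; exact: smoothN.
Qed.

Lemma smooth_mxB m n (F G : 'rV[R]_4 -> 'M[R]_(m, n)) :
  smooth_mx U F -> smooth_mx U G -> smooth_mx U (fun w => F w - G w).
Proof. by move=> HF HG; apply: smooth_mxD => //; exact: smooth_mxN. Qed.

Lemma smooth_mxZ m n f (F : 'rV[R]_4 -> 'M[R]_(m, n)) :
  smooth U f -> smooth_mx U F -> smooth_mx U (fun w => f w *: F w).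
Proof.
by move=> Hf HF i j; under eq_fun do rewrite mxE; exact: smoothM.
Qed.

Lemma smooth_mxT m n (F : 'rV[R]_4 -> 'M[R]_(m, n)) :
  smooth_mx U F -> smooth_mx U (fun w => (F w)^T).
Proof. by move=> HF i j; under eq_fun do rewrite mxE; exact: HF. Qed.

Lemma smooth_mxM m n p (F : 'rV[R]_4 -> 'M[R]_(m, n)) (G : 'rV[R]_4 -> 'M[R]_(n, p)) :
  smooth_mx U F -> smooth_mx U G -> smooth_mx U (fun w => F w *m G w).
Proof.
move=> HF HG i j; under eq_fun do rewrite mxE.
by apply: smooth_sum => // k; exact: smoothM.
Qed.

Lemma smooth_trace n (F : 'rV[R]_4 -> 'M[R]_n) :
  smooth_mx U F -> smooth U (fun w => \tr (F w)).
Proof. by move=> HF; apply: smooth_sum => // i; exact: HF. Qed.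

Lemma smooth_det n (F : 'rV[R]_4 -> 'M[R]_n) :
  smooth_mx U F -> smooth U (fun w => \det (F w)).
Proof.
move=> HF; apply: smooth_sum => // s; apply: smoothM => //; first exact: smooth_cst.
by apply: smooth_prod => // i; exact: HF.
Qed.

Lemma smooth_adj n (F : 'rV[R]_4 -> 'M[R]_n) :
  smooth_mx U F -> smooth_mx U (fun w => \adj (F w)).
Proof.
move=> HF i j; under eq_fun do rewrite mxE /cofactor.
apply: smoothM => //; first exact: smooth_cst.
apply: smooth_det => a b; under eq_fun do rewrite !mxE; exact: HF.
Qed.

Lemma smooth_invmx n (F : 'rV[R]_4 -> 'M[R]_n) :
  (forall w, U w -> F w \in unitmx) ->
  smooth_mx U F -> smooth_mx U (fun w => invmx (F w)).
Proof.
move=> un HF; apply: (smooth_mx_ext (F := fun w => (\det (F w))^-1 *: \adj (F w))).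
  by move=> w Uw; rewrite /invmx un.
apply: smooth_mxZ; last exact: smooth_adj.
apply: smoothV => //; last exact: smooth_det.
by move=> w /un; rewrite unitmxE unitfE.
Qed.

Section rules.
Context {u : 'rV[R]_4} {Uu : U u}.
Variable k : 'I_4.

Lemma dmx_ext m n (F G : 'rV[R]_4 -> 'M[R]_(m, n)) :
  (forall w, U w -> F w = G w) -> dmx k F u = dmx k G u.
Proof.
move=> E; apply/matrixP => i j; rewrite !mxE.
by apply: partial_ext oU Uu _ => w Uw; rewrite E.
Qed.

Lemma dmx_cst m n (A : 'M[R]_(m, n)) : dmx k (fun=> A) u = 0.
Proof. by apply/matrixP => i j; rewrite !mxE partial_cst. Qed.

Lemma dmxD m n (F G : 'rV[R]_4 -> 'M[R]_(m, n)) :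
  smooth_mx U F -> smooth_mx U G -> dmx k (fun w => F w + G w) u = dmx k F u + dmx k G u.
Proof.
move=> HF HG; apply/matrixP => i j; rewrite !mxE -(partialD Uu) //.
by congr (partial _ _ _); apply/funext => w; rewrite mxE.
Qed.

Lemma dmxN m n (F : 'rV[R]_4 -> 'M[R]_(m, n)) :
  smooth_mx U F -> dmx k (fun w => - F w) u = - dmx k F u.
Proof.
move=> HF; apply/matrixP => i j; rewrite !mxE -(partialN Uu) //.
by congr (partial _ _ _); apply/funext => w; rewrite mxE.
Qed.

Lemma dmxB m n (F G : 'rV[R]_4 -> 'M[R]_(m, n)) :
  smooth_mx U F -> smooth_mx U G -> dmx k (fun w => F w - G w) u = dmx k F u - dmx k G u.
Proof. by move=> HF HG; rewrite dmxD ?dmxN //; exact: smooth_mxN. Qed.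

Lemma dmxZ m n f (F : 'rV[R]_4 -> 'M[R]_(m, n)) :
  smooth U f -> smooth_mx U F ->
  dmx k (fun w => f w *: F w) u = partial k f u *: F u + f u *: dmx k F u.
Proof.
move=> Hf HF; apply/matrixP => i j; rewrite !mxE -(partialM Uu) //.
by congr (partial _ _ _); apply/funext => w; rewrite mxE.
Qed.

Lemma dmxT m n (F : 'rV[R]_4 -> 'M[R]_(m, n)) :
  dmx k (fun w => (F w)^T) u = (dmx k F u)^T.
Proof.
apply/matrixP => i j; rewrite !mxE.
by congr (partial _ _ _); apply/funext => w; rewrite mxE.
Qed.

Lemma dmxM m n p (F : 'rV[R]_4 -> 'M[R]_(m, n)) (G : 'rV[R]_4 -> 'M[R]_(n, p)) :
  smooth_mx U F -> smooth_mx U G ->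
  dmx k (fun w => F w *m G w) u = dmx k F u *m G u + F u *m dmx k G u.
Proof.
move=> HF HG; apply/matrixP => i j; rewrite !mxE -big_split /=.
rewrite (_ : (fun w => _) = (fun w => \sum_l F w i l * G w l j)); last first.
  by apply/funext => w; rewrite mxE.
rewrite (partial_sum Uu) //; last by move=> l; exact: smoothM.
by apply: eq_bigr => l _; rewrite (partialM Uu) // !mxE.
Qed.

Lemma dmx_invmx n (F : 'rV[R]_4 -> 'M[R]_n) :
  (forall w, U w -> F w \in unitmx) -> smooth_mx U F ->
  dmx k (fun w => invmx (F w)) u = - (invmx (F u) *m dmx k F u *m invmx (F u)).
Proof.
move=> un HF; have HI := smooth_invmx un HF.
have := dmxM HF HI; rewrite (dmx_ext (G := fun=> 1%:M)); last first.
  by move=> w /un H; rewrite mulmxV.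
rewrite dmx_cst => /esym/eqP; rewrite addrC addr_eq0 => /eqP E.
rewrite -[LHS](mulKmx (un _ Uu)) E mulmxN; congr (- _).
by rewrite mulmxA.
Qed.

Lemma partial_trace n (F : 'rV[R]_4 -> 'M[R]_n) : smooth_mx U F ->
  partial k (fun w => \tr (F w)) u = \tr (dmx k F u).
Proof.
move=> HF; rewrite /mxtrace (partial_sum Uu) //; apply: eq_bigr => i _; by rewrite mxE.
Qed.

Lemma partial_prod (I : eqType) (r : seq I) (F : I -> 'rV[R]_4 -> R) :
  uniq r -> (forall i, smooth U (F i)) ->
  partial k (fun w => \prod_(i <- r) F i w) u
    = \sum_(j <- r) partial k (F j) u * \prod_(i <- r | i != j) F i u.
Proof.
move=> + HF; elim: r => [|i r IH] /=.
  by under eq_fun do rewrite big_nil; rewrite partial_cst big_nil.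
move=> /andP[ir ur].
under eq_fun do rewrite big_cons.
rewrite (partialM Uu) //; last by apply: smooth_prod.
rewrite IH // big_cons big_cons eqxx /=; congr (_ * _ + _).
  rewrite [RHS]big_seq_cond [LHS]big_seq; apply: eq_bigl => j.
  by have [jr|//] := boolP (j \in r); apply/esym; apply: contraNneq ir => <-.
rewrite mulr_sumr !big_seq; apply: eq_bigr => j jr.
have ij : i != j.
  by apply: contraNneq ir => ->.
rewrite big_cons ij.
set W := F i u; set Y := partial k (F j) u; set Z := (X in _ = _ * (_ * X)).
by rewrite (mulrCA W).
Qed.

(** Jacobi's formula: differentiating the Leibniz sum one factor at a time
    gives a sum of determinants in which one row is differentiated, and each of
    them is expanded along that row. *)
Lemma partial_det n (F : 'rV[R]_4 -> 'M[R]_n) : smooth_mx U F ->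
  partial k (fun w => \det (F w)) u = \tr (dmx k F u *m \adj (F u)).
Proof.
move=> HF; rewrite /determinant (partial_sum Uu) //; last first.
  move=> s; apply: smoothM => //; first exact: smooth_cst.
  by apply: smooth_prod => // i; exact: HF.
transitivity (\sum_(s : 'S_n) \sum_i (-1) ^+ s * (partial k (fun w => F w i (s i)) u *
    \prod_(j | j != i) F u j (s j))).
  apply: eq_bigr => s _; rewrite (partialZ Uu); last first.
    by apply: smooth_prod => // i; exact: HF.
  rewrite (partial_prod (F := fun i w => F w i (s i))) ?index_enum_uniq //.
  by rewrite mulr_sumr.
rewrite exchange_big /=; apply: eq_bigr => i _.
pose A : 'M[R]_n := \matrix_(a, b) if a == i then dmx k F u i b else F u a b.
transitivity (\det A).
  apply: eq_bigr => s _; congr (_ * _); rewrite [RHS](bigD1 i) //= !mxE eqxx.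
  by congr (_ * _); apply: eq_bigr => j ji; rewrite mxE (negbTE ji).
rewrite (expand_det_row _ i) mxE; apply: eq_bigr => j _.
rewrite [A i j]mxE eqxx [(\adj _) _ _]mxE /cofactor; congr (_ * (_ * \det _)).
apply/matrixP => a b; rewrite !mxE ifN //.
by rewrite eq_sym neq_lift.
Qed.
End rules.
End open.
End MxCalc.

(** * Determinants and the permutation symbol in dimension four *)

Definition o0 : 'I_4 := @Ordinal 4 0 isT.
Definition o1 : 'I_4 := @Ordinal 4 1 isT.
Definition o2 : 'I_4 := @Ordinal 4 2 isT.
Definition o3 : 'I_4 := @Ordinal 4 3 isT.

Lemma ord4P (P : 'I_4 -> Prop) : P o0 -> P o1 -> P o2 -> P o3 -> forall i, P i.
Proof.
move=> P0 P1 P2 P3 [[|[|[|[|//]]]] H].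
- by rewrite (_ : Ordinal H = o0) //; exact: val_inj.
- by rewrite (_ : Ordinal H = o1) //; exact: val_inj.
- by rewrite (_ : Ordinal H = o2) //; exact: val_inj.
- by rewrite (_ : Ordinal H = o3) //; exact: val_inj.
Qed.

Lemma sum4 (V : nmodType) (F : 'I_4 -> V) :
  \sum_i F i = F o0 + F o1 + F o2 + F o3.
Proof.
rewrite !big_ord_recl big_ord0 addr0 !addrA.
by congr (F _ + F _ + F _ + F _); exact: val_inj.
Qed.

Section Algebra.
Context {R : comNzRingType}.
Implicit Types (A : 'M[R]_4).

Lemma det2 (A : 'M[R]_2) (B : nat -> nat -> R) : (forall i j, A i j = B i j) ->
  \det A = B 0 0 * B 1 1 - B 0 1 * B 1 0.
Proof.
move=> E; rewrite (expand_det_row _ ord0) !big_ord_recl big_ord0 /cofactor !det_mx11 !mxE !E /=.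
rewrite ?exprS ?expr0 /bump /=; ring.
Qed.

Lemma det3 (A : 'M[R]_3) (B : nat -> nat -> R) : (forall i j, A i j = B i j) ->
  \det A = B 0 0 * (B 1 1 * B 2 2 - B 1 2 * B 2 1)
         - B 0 1 * (B 1 0 * B 2 2 - B 1 2 * B 2 0)
         + B 0 2 * (B 1 0 * B 2 1 - B 1 1 * B 2 0).
Proof.
move=> E; rewrite (expand_det_row _ ord0) !big_ord_recl big_ord0 /cofactor.
have M (j : 'I_3) : \det (row' ord0 (col' j A)) =
   let C := fun i k => B (bump 0 i) (bump j k) in
    C 0%N 0%N * C 1%N 1%N - C 0%N 1%N * C 1%N 0%N.
  by apply: det2 => a b; rewrite !mxE E.
rewrite !M /bump /= !E /= ?exprS ?expr0; ring.
Qed.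

Lemma det4 A : \det A =
    A o0 o0 * (A o1 o1 * (A o2 o2 * A o3 o3 - A o2 o3 * A o3 o2)
             - A o1 o2 * (A o2 o1 * A o3 o3 - A o2 o3 * A o3 o1)
             + A o1 o3 * (A o2 o1 * A o3 o2 - A o2 o2 * A o3 o1))
  - A o0 o1 * (A o1 o0 * (A o2 o2 * A o3 o3 - A o2 o3 * A o3 o2)
             - A o1 o2 * (A o2 o0 * A o3 o3 - A o2 o3 * A o3 o0)
             + A o1 o3 * (A o2 o0 * A o3 o2 - A o2 o2 * A o3 o0))
  + A o0 o2 * (A o1 o0 * (A o2 o1 * A o3 o3 - A o2 o3 * A o3 o1)
             - A o1 o1 * (A o2 o0 * A o3 o3 - A o2 o3 * A o3 o0)
             + A o1 o3 * (A o2 o0 * A o3 o1 - A o2 o1 * A o3 o0))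
  - A o0 o3 * (A o1 o0 * (A o2 o1 * A o3 o2 - A o2 o2 * A o3 o1)
             - A o1 o1 * (A o2 o0 * A o3 o2 - A o2 o2 * A o3 o0)
             + A o1 o2 * (A o2 o0 * A o3 o1 - A o2 o1 * A o3 o0)).
Proof.
pose B (i j : nat) := A (inord i) (inord j).
have EB i j : A i j = B i j by rewrite /B !inord_val.
rewrite (expand_det_row _ ord0) sum4 /cofactor.
have M (j : 'I_4) : \det (row' ord0 (col' j A)) =
   let C := fun i k => B (bump 0 i) (bump j k) in
    C 0%N 0%N * (C 1 1 * C 2 2 - C 1 2 * C 2 1)
         - C 0%N 1%N * (C 1 0 * C 2 2 - C 1 2 * C 2 0)
         + C 0%N 2%N * (C 1 0 * C 2 1 - C 1 1 * C 2 0).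
  by apply: det3 => a b; rewrite !mxE EB.
rewrite !M /bump /= !EB /= ?exprS ?expr0; ring.
Qed.
End Algebra.

Section Dual.
Context {R : realType}.
Implicit Types (N P : 'M[R]_4).

(** The Hodge star without the metric.  It is locked because the
    permutation symbol is a determinant, which simplification would expand. *)
Definition dual N : 'M[R]_4 :=
  locked (\matrix_(a, b) (2^-1 * \sum_c \sum_d levi_civita c d a b * N c d)).

(** The six independent entries; the explicit table makes polynomial identities
    between entries accessible to [ring]. *)
Definition dual_entry N (a b : 'I_4) : R :=
  2^-1 * match val a, val b with
  | 0%N, 1%N => N o2 o3 - N o3 o2
  | 0%N, 2%N => N o3 o1 - N o1 o3
  | 0%N, 3%N => N o1 o2 - N o2 o1
  | 1%N, 2%N => N o0 o3 - N o3 o0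
  | 1%N, 3%N => N o2 o0 - N o0 o2
  | 2%N, 3%N => N o0 o1 - N o1 o0
  | 1%N, 0%N => N o3 o2 - N o2 o3
  | 2%N, 0%N => N o1 o3 - N o3 o1
  | 3%N, 0%N => N o2 o1 - N o1 o2
  | 2%N, 1%N => N o3 o0 - N o0 o3
  | 3%N, 1%N => N o0 o2 - N o2 o0
  | 3%N, 2%N => N o1 o0 - N o0 o1
  | _, _ => 0
  end.

(** Sign of a permutation of four indices by counting inversions, so that all
    values of the symbol are obtained by computation. *)
Definition perm_sign (c d a b : nat) : int :=
  if uniq [:: c; d; a; b] then
    if odd ((d < c) + (a < c) + (b < c) + (a < d) + (b < d) + (b < a))%N then -1 else 1
  else 0.

Lemma levi_civitaE (c d a b : 'I_4) :
  levi_civita c d a b = (perm_sign c d a b)%:~R :> R.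
Proof.
rewrite /levi_civita.
pose I : 'M[int]_4 := \matrix_(i < 4, j < 4) (tnth [tuple c; d; a; b] i == j)%:R.
have -> : \matrix_(i < 4, j < 4) (tnth [tuple c; d; a; b] i == j)%:R = map_mx intr I :> 'M[R]_4.
  by apply/matrixP => i j; rewrite !mxE rmorph_nat.
rewrite det_map_mx det4 !mxE; congr (_%:~R).
move: c d a b {I}.
by apply: ord4P; apply: ord4P; apply: ord4P; apply: ord4P; vm_compute.
Qed.

Lemma dualE N a b : dual N a b = dual_entry N a b.
Proof.
rewrite /dual -lock mxE /dual_entry; congr (_ * _); rewrite !sum4 !levi_civitaE.
move: a b.
by apply: ord4P; apply: ord4P; rewrite /perm_sign /= ?mul0r ?add0r ?addr0; ring.
Qed.

End Dual.

(** * Duality of antisymmetric matrices *)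

Section Dual2.
Context {R : realType}.
Implicit Types (N M P G : 'M[R]_4).

(** A rewriting rule that expresses all entries through those above the
    diagonal. *)
Lemma antisym_entries N : N^T = - N ->
  (N o1 o0 = - N o0 o1) * (N o2 o0 = - N o0 o2) * (N o3 o0 = - N o0 o3) *
  (N o2 o1 = - N o1 o2) * (N o3 o1 = - N o1 o3) * (N o3 o2 = - N o2 o3) *
  (N o0 o0 = 0) * (N o1 o1 = 0) * (N o2 o2 = 0) * (N o3 o3 = 0).
Proof.
move=> E; have F i j : N j i = - N i j by move/matrixP: E => /(_ i j); rewrite !mxE.
have Z i : N i i = 0 by have := F i i; lra.
by rewrite !Z; do !split; exact: F.
Qed.

(** The coefficient of N /\ M on the coordinate volume form, that is, the
    polarized Pfaffian. *)
Definition wedge_coef N M : R :=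
  N o0 o1 * M o2 o3 - N o0 o2 * M o1 o3 + N o0 o3 * M o1 o2
  + N o1 o2 * M o0 o3 - N o1 o3 * M o0 o2 + N o2 o3 * M o0 o1.

Lemma dual_tr N : (dual N)^T = - dual N.
Proof.
apply/matrixP => i j; rewrite !mxE !dualE /dual_entry.
by move: i j; apply: ord4P; apply: ord4P; rewrite /=; ring.
Qed.

Lemma dualD N M : dual (N + M) = dual N + dual M.
Proof.
by apply/matrixP => i j; rewrite mxE !dualE /dual_entry !mxE; move: i j;
 apply: ord4P; apply: ord4P; rewrite /=; ring.
Qed.
Lemma dualZ c N : dual (c *: N) = c *: dual N.
Proof.
by apply/matrixP => i j; rewrite mxE !dualE /dual_entry !mxE; move: i j;
 apply: ord4P; apply: ord4P; rewrite /=; ring.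
Qed.
Lemma dualK N : N^T = - N -> dual (dual N) = N.
Proof.
move=> /antisym_entries E.
apply/matrixP => i j; rewrite dualE /dual_entry !dualE /dual_entry.
by move: i j; apply: ord4P; apply: ord4P; rewrite /= !E; field.
Qed.

(** Polarization of N * dual N = - Pf(N), the source of all complex structures
    in dimension four. *)
Lemma mul_dual N M : N^T = - N -> M^T = - M ->
  N *m dual M + M *m dual N = (- wedge_coef N M)%:M.
Proof.
move=> /antisym_entries E /antisym_entries F.
apply/matrixP => i j; rewrite !mxE !sum4 !dualE /dual_entry /wedge_coef.
by move: i j; apply: ord4P; apply: ord4P; rewrite /= !E !F; field.
Qed.

Lemma tr_mul_dual N M : \tr (N *m dual M) = \tr (M *m dual N).
Proof.
rewrite /mxtrace !sum4 !mxE !sum4 !dualE /dual_entry /=; ring.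
Qed.

(** The derivative of [dual_congr] at the identity; it is the reason why a
    metric connection commutes with the Hodge star. *)
Lemma dual_infinitesimal G N : N^T = - N ->
  \tr G *: dual N - dual (G^T *m N + N *m G) = G *m dual N + dual N *m G^T.
Proof.
move=> /antisym_entries E.
apply/matrixP => i j; rewrite /mxtrace !mxE !sum4 !dualE /dual_entry !mxE !sum4 !mxE /=.
by move: i j; apply: ord4P; apply: ord4P; rewrite /= !E; field.
Qed.

Lemma dual_antisymE N : N^T = - N ->
  (dual N o0 o1 = N o2 o3) * (dual N o0 o2 = - N o1 o3) * (dual N o0 o3 = N o1 o2) *
  (dual N o1 o2 = N o0 o3) * (dual N o1 o3 = - N o0 o2) * (dual N o2 o3 = N o0 o1).
Proof.
by move=> /antisym_entries E; rewrite !dualE /dual_entry /= !E; do !split; field.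
Qed.

Lemma congr_antisym P N : N^T = - N -> (P *m N *m P^T)^T = - (P *m N *m P^T).
Proof. by move=> E; rewrite !trmx_mul trmxK E mulNmx mulmxN mulmxA. Qed.

(** The dual is a relative tensor: it changes contragrediently, up to the
    determinant of the change of basis. *)
Lemma dual_congr P N : N^T = - N ->
  P^T *m dual (P *m N *m P^T) *m P = \det P *: dual N.
Proof.
move=> aN; have aQ := congr_antisym P aN.
have E := dual_antisymE aQ; have F := antisym_entries (dual_tr (P *m N *m P^T)).
have E1 := dual_antisymE aN; have F1 := antisym_entries (dual_tr N).
have F2 := antisym_entries aN.
apply/matrixP => i j; rewrite [LHS]mxE sum4 ![(P^T *m _) _ _]mxE !sum4 ![P^T _ _]mxE !F !E.
rewrite [RHS]mxE det4.
have Q a b : (P *m N *m P^T) a b =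
  N o0 o1 * (P a o0 * P b o1 - P a o1 * P b o0) + N o0 o2 * (P a o0 * P b o2 - P a o2 * P b o0)
 + N o0 o3 * (P a o0 * P b o3 - P a o3 * P b o0) + N o1 o2 * (P a o1 * P b o2 - P a o2 * P b o1)
 + N o1 o3 * (P a o1 * P b o3 - P a o3 * P b o1) + N o2 o3 * (P a o2 * P b o3 - P a o3 * P b o2).
  by rewrite !mxE !sum4 !mxE !sum4 !F2; ring.
rewrite !Q.
move: i j; apply: ord4P; apply: ord4P; rewrite ?F1 ?E1.
ring.
all: ring.
Qed.
End Dual2.

(** * The Hodge star of a metric at a point *)

Definition posdef {R : realType} (g : 'M[R]_4) : Prop :=
  g^T = g /\ forall v : 'rV[R]_4, v != 0 -> 0 < (v *m g *m v^T) 0 0.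

Section Star.
Context {R : realType}.
Implicit Types (g N M P G phi chi : 'M[R]_4).

(** det (t + g) is the characteristic polynomial of - g at t: it is positive for
    large t, and it has no root t >= 0 since t + g is then positive definite. *)
Lemma posdef_det g : posdef g -> 0 < \det g.
Proof.
move=> pg; have [_ pd] := pg.
pose p := char_poly (- g).
have pE t : p.[t] = \det (t%:M + g).
  rewrite /p /char_poly -horner_evalE -det_map_mx; congr (\det _).
  apply/matrixP => i j; rewrite !mxE.
  change (('X *+ (i == j) - (- g i j)%:P).[t] = t *+ (i == j) + g i j).
  by rewrite !hornerE hornerMn hornerX opprK.
have nz t : 0 <= t -> p.[t] != 0.
  move=> t0; rewrite pE; apply/negP => /det0P[v v0 vE].
  have : 0 < (v *m (t%:M + g) *m v^T) 0 0.
    rewrite mulmxDr mulmxDl mxE ltr_wpDl ?pd //.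
    rewrite mul_mx_scalar -scalemxAl !mxE mulr_ge0 //; apply: sumr_ge0 => i _.
    by rewrite mxE -expr2 sqr_ge0.
  by rewrite vE mul0mx mxE ltxx.
rewrite (_ : \det g = p.[0]); last by rewrite pE (_ : 0%:M = 0) ?add0r // raddf0.
rewrite lt_neqAle eq_sym nz //= leNgt; apply/negP => p0.
have [n nP] := monic_Cauchy_bound (char_poly_monic (- g)).
pose b := Num.max n 0.
have pb : 0 <= p.[b] by apply/ltW/nP; rewrite le_max lexx.
have b0 : 0 <= b by rewrite le_max lexx orbT.
have p0b : p.[0] <= 0 <= p.[b] by rewrite ltW.
have [x /andP[x0 _] /rootP rx] := poly_ivt b0 p0b.
by have := nz x x0; rewrite rx eqxx.
Qed.

Lemma posdef_unit g : posdef g -> g \in unitmx.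
Proof. by move=> /posdef_det; rewrite unitmxE unitfE => /gt_eqF ->. Qed.

Definition star g phi := Num.sqrt (\det g) *: dual (invmx g *m phi *m invmx g).

Section at_g.
Context {g : 'M[R]_4}.
Hypothesis pg : posdef g.
Let s := Num.sqrt (\det g).
Let ug : g \in unitmx := posdef_unit pg.

Let gT : g^T = g. Proof. by case: pg. Qed.
Let giT : (invmx g)^T = invmx g. Proof. by rewrite trmx_inv gT. Qed.
Let s0 : 0 < s. Proof. by rewrite sqrtr_gt0 posdef_det. Qed.
Let ss : s ^+ 2 = \det g. Proof. by rewrite sqr_sqrtr // ltW // posdef_det. Qed.

(** Lowering the indices of the dual of phi instead of dualizing phi with
    raised indices; the two differ by the determinant of g, by [dual_congr]. *)
Lemma star_inv phi : phi^T = - phi -> star g phi = s^-1 *: (g *m dual phi *m g).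
Proof.
move=> aphi; have := dual_congr (invmx g) aphi; rewrite giT => E; rewrite /star.
have -> : dual (invmx g *m phi *m invmx g) = g *m (invmx g *m dual (invmx g *m phi *m invmx g) *m invmx g) *m g.
  by rewrite !mulmxA mulmxV // mul1mx mulmxKV.
rewrite E det_inv -/s -ss -scalemxAr -scalemxAl scalerA; congr (_ *: _).
by rewrite -/s; field; rewrite gt_eqF.
Qed.

Lemma starD phi chi : star g (phi + chi) = star g phi + star g chi.
Proof. by rewrite /star mulmxDr mulmxDl dualD scalerDr. Qed.

Lemma starZ c phi : star g (c *: phi) = c *: star g phi.
Proof. by rewrite /star -scalemxAr -scalemxAl dualZ !scalerA mulrC. Qed.

Lemma star_antisym phi : (star g phi)^T = - star g phi.
Proof. by rewrite /star linearZ /= dual_tr scalerN. Qed.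

Lemma starK phi : phi^T = - phi -> star g (star g phi) = phi.
Proof.
move=> aphi; rewrite {1}/star star_inv // -!scalemxAr -!scalemxAl !mulmxA mulVmx // mul1mx.
by rewrite -mulmxA mulmxV // mulmx1 dualZ scalerA divff ?gt_eqF // scale1r dualK.
Qed.

(** The endomorphism C with g(C x, y) = phi(x, y). *)
Definition raise phi := phi *m invmx g.

Lemma raise_star phi chi : phi^T = - phi -> chi^T = - chi ->
  raise phi *m raise (star g chi) + raise chi *m raise (star g phi) = (- (wedge_coef phi chi / s))%:M.
Proof.
move=> aphi achi; rewrite /raise !star_inv //.
have E a b : a *m invmx g *m (s^-1 *: (g *m dual b *m g) *m invmx g) = s^-1 *: (a *m dual b).
  rewrite -scalemxAl -scalemxAr; congr (_ *: _).
  by rewrite !mulmxA mulmxKV // mulmxK.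
by rewrite !E -scalerDr mul_dual // scale_scalar_mx mulrN mulrC.
Qed.

Lemma tr_raise_star phi chi : phi^T = - phi -> chi^T = - chi ->
  \tr (raise phi *m raise (star g chi)) = \tr (raise chi *m raise (star g phi)).
Proof.
move=> aphi achi; rewrite /raise !star_inv //.
have E a b : a *m invmx g *m (s^-1 *: (g *m dual b *m g) *m invmx g) = s^-1 *: (a *m dual b).
  rewrite -scalemxAl -scalemxAr; congr (_ *: _).
  by rewrite !mulmxA mulmxKV // mulmxK.
by rewrite !E !linearZ /= tr_mul_dual.
Qed.

(** The projection onto the eigenspace of the star for the eigenvalue sg, when
    sg is 1 or -1. *)
Definition dual_part (sg : R) phi := 2^-1 *: (phi + sg *: star g phi).

Lemma dual_part_antisym sg phi : phi^T = - phi -> (dual_part sg phi)^T = - dual_part sg phi.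
Proof.
by move=> a; rewrite /dual_part linearZ /= linearD /= linearZ /= a star_antisym scalerN -opprD scalerN.
Qed.

Lemma star_dual_part sg phi : sg * sg = 1 -> phi^T = - phi -> star g (dual_part sg phi) = sg *: dual_part sg phi.
Proof.
move=> s1 a; rewrite /dual_part starZ starD starZ starK // scalerA mulrC -scalerA; congr (_ *: _).
by rewrite scalerDr scalerA s1 scale1r addrC.
Qed.

Section sd.
Context {sg : R} {phi : 'M[R]_4}.
Hypotheses (s1 : sg * sg = 1) (aphi : phi^T = - phi) (sphi : star g phi = sg *: phi).

(** The case of equal arguments in [raise_star]; the scalar is later identified
    with - f^2 by taking traces. *)
Lemma raise_sqr : raise phi *m raise phi = (- (sg * wedge_coef phi phi / (2 * s)))%:M.
Proof.
have := raise_star aphi aphi; rewrite sphi {2 4}/raise -scalemxAl -scalemxAr -/(raise phi) => E.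
apply: (scalerI (a := 2 * sg)).
  by rewrite mulf_neq0 //; apply/eqP => z; move: s1; rewrite z mul0r => /esym/eqP; rewrite oner_eq0.
rewrite -scalerA scaler_nat mulr2n E scale_scalar_mx; congr (_%:M).
rewrite mulrN; congr (- _).
have -> : 2 * sg * (sg * wedge_coef phi phi / (2 * s)) = sg * sg * wedge_coef phi phi / s.
  by field; rewrite gt_eqF.
by rewrite s1 mul1r.
Qed.

(** By [raise_star], J * raise (star chi) + sg * raise chi * J is a scalar
    matrix.  Multiplying by J expresses raise (star chi) through J chi J, and
    the trace determines the scalar. *)
Lemma raise_dual_part chi f J : chi^T = - chi -> f != 0 -> J = f^-1 *: raise phi -> J *m J = - 1%:M ->
  raise (dual_part sg chi) = 2^-1 *: (raise chi + J *m raise chi *m J - (2^-1 * \tr (raise chi *m J)) *: J).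
Proof.
move=> achi f0 JE JJ.
set X := raise chi; set Y := raise (star g chi).
have E : J *m Y + sg *: (X *m J) = (- (f^-1 * (wedge_coef phi chi / s)))%:M.
  have := raise_star aphi achi; rewrite sphi.
  have -> : raise (sg *: phi) = sg *: raise phi by rewrite /raise -scalemxAl.
  move=> E; rewrite JE -scalemxAl -scalemxAr [sg *: (_ *: _)]scalerA [sg * _]mulrC -scalerA -scalerDr.
  by rewrite scalemxAr E scale_scalar_mx mulrN.
have T : \tr (J *m Y) = sg * \tr (X *m J).
  rewrite JE -scalemxAl -scalemxAr !linearZ /= tr_raise_star // sphi.
  have -> : raise (sg *: phi) = sg *: raise phi by rewrite /raise -scalemxAl.
  by rewrite -scalemxAr linearZ /= mulrCA.
set k := - _ in E.
have kE : k = 2^-1 * sg * \tr (X *m J).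
  have := congr1 mxtrace E; rewrite mxtrace_scalar linearD linearZ /= T -[k *+ 4]mulr_natr => H.
  have -> : k = (k * 4) / 4 by field.
  by rewrite -H; field.
have YE : Y = sg *: (J *m X *m J) - k *: J.
  have -> : Y = - (J *m (J *m Y)) by rewrite mulmxA JJ mulNmx mul1mx opprK.
  have -> : J *m Y = k%:M - sg *: (X *m J) by rewrite -E addrK.
  by rewrite mulmxBr mul_mx_scalar -scalemxAr mulmxA opprB.
have -> : raise (dual_part sg chi) = 2^-1 *: (X + sg *: Y).
  by rewrite /raise /dual_part -scalemxAl mulmxDl -scalemxAl.
rewrite YE scalerBr !scalerA s1 scale1r kE addrA; congr (_ *: (_ - _ *: _)).
by rewrite !mulrA [sg * _]mulrC -!mulrA; rewrite (mulrA sg sg) s1 mul1r.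
Qed.
End sd.

(** By [raise_star] the commutator is a scalar matrix, and its trace vanishes;
    the trace of the product is its own opposite by [tr_raise_star]. *)
Lemma raise_comm phi chi : phi^T = - phi -> star g phi = phi ->
  chi^T = - chi -> star g chi = - chi ->
  raise phi *m raise chi = raise chi *m raise phi /\ \tr (raise phi *m raise chi) = 0.
Proof.
move=> aphi sphi achi schi.
have upN x : raise (- x) = - raise x by rewrite /raise mulNmx.
have T : \tr (raise phi *m raise chi) = 0.
  have := tr_raise_star aphi achi; rewrite sphi schi upN mulmxN linearN /= [RHS]mxtrace_mulC.
  by move=> H; lra.
split=> //; have := raise_star aphi achi; rewrite sphi schi upN mulmxN.
set k := - (_ / _) => E.
have k0 : k = 0.
  have := congr1 mxtrace E; rewrite mxtrace_scalar linearD linearN /= [\tr (raise chi *m _)]mxtrace_mulC T -[k *+ 4]mulr_natr.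
  by rewrite oppr0 addr0 => /esym/eqP; rewrite mulf_eq0 pnatr_eq0 orbF => /eqP.
by move/eqP: E; rewrite k0 raddf0 addrC subr_eq0 => /eqP.
Qed.
End at_g.
End Star.

Arguments raise {R} g phi.
Arguments dual_part {R} g sg phi.

(** * The covariant derivative of J at a point *)

Section Vectors.
Context {R : realType}.
Implicit Types (g J A B : 'M[R]_4) (x y z v : 'rV[R]_4).

Definition bil B x y : R := (x *m B *m y^T) 0 0.

Lemma bilDl B x y z : bil B (x + y) z = bil B x z + bil B y z.
Proof. by rewrite /bil !mulmxDl mxE. Qed.
Lemma bilDr B x y z : bil B x (y + z) = bil B x y + bil B x z.
Proof. by rewrite /bil linearD /= mulmxDr mxE. Qed.
Lemma bilZl B c x y : bil B (c *: x) y = c * bil B x y.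
Proof. by rewrite /bil -!scalemxAl mxE. Qed.
Lemma bilZr B c x y : bil B x (c *: y) = c * bil B x y.
Proof. by rewrite /bil linearZ /= -scalemxAr mxE. Qed.
Lemma bilNl B x y : bil B (- x) y = - bil B x y.
Proof. by rewrite -scaleN1r bilZl mulN1r. Qed.
Lemma bilNr B x y : bil B x (- y) = - bil B x y.
Proof. by rewrite -scaleN1r bilZr mulN1r. Qed.
Lemma bil0l B x : bil B 0 x = 0.
Proof. by rewrite /bil !mul0mx mxE. Qed.
Lemma bil_tr B x y : bil B^T x y = bil B y x.
Proof.
rewrite /bil -[RHS](_ : ((y *m B *m x^T)^T) 0 0 = _); last by rewrite mxE.
by rewrite !trmx_mul trmxK mulmxA.
Qed.
Lemma bilN B x y : bil (- B) x y = - bil B x y.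
Proof. by rewrite /bil mulmxN mulNmx mxE. Qed.
Lemma bilD B1 B2 x y : bil (B1 + B2) x y = bil B1 x y + bil B2 x y.
Proof. by rewrite /bil mulmxDr mulmxDl mxE. Qed.
Lemma bilZ c B x y : bil (c *: B) x y = c * bil B x y.
Proof. by rewrite /bil -scalemxAr -scalemxAl mxE. Qed.
Lemma bil_mull J B x y : bil (J *m B) x y = bil B (x *m J) y.
Proof. by rewrite /bil mulmxA. Qed.
Lemma bil_mulr J B x y : bil (B *m J^T) x y = bil B x (y *m J).
Proof. by rewrite /bil trmx_mul !mulmxA. Qed.
Lemma bil_delta B i j : bil B (delta_mx 0 i) (delta_mx 0 j) = B i j.
Proof. by rewrite /bil -rowE trmx_delta -colE !mxE. Qed.

Definition bilE := (bilDl, bilDr, bilNl, bilNr, bilZl, bilZr).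

Lemma bil_eq A B : (forall x y, bil A x y = bil B x y) -> A = B.
Proof. by move=> H; apply/matrixP => i j; rewrite -!bil_delta H. Qed.

Section metric.
Context {g : 'M[R]_4}.
Hypothesis pg : posdef g.
Local Notation ip := (bil g).

Lemma ipC x y : ip x y = ip y x.
Proof. by case: pg => gT _; rewrite -{1}gT bil_tr. Qed.

Lemma ip_gt0 x : x != 0 -> 0 < ip x x.
Proof. by case: pg => _; exact. Qed.

Lemma ip_nondeg x : (forall y, ip x y = 0) -> x = 0.
Proof. by move=> H; apply/eqP; apply: contraT => /ip_gt0; rewrite H ltxx. Qed.

Lemma ip_inj x y : (forall z, ip x z = ip y z) -> x = y.
Proof.
move=> H; apply/eqP; rewrite -subr_eq0; apply/eqP/ip_nondeg => z.
by rewrite bilDl bilNl H subrr.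
Qed.

Lemma ip_sharp B x y : ip (x *m (B *m invmx g)) y = bil B x y.
Proof. by rewrite /bil !mulmxA mulmxKV ?posdef_unit. Qed.

Section alpha.
Variable al : 'rV[R]_4.
Let v := al *m invmx g.

Lemma sharp_ip x : (x *m al^T) 0 0 = ip v x.
Proof.
rewrite /bil /v mulmxKV ?posdef_unit //.
by rewrite -[RHS](_ : ((al *m x^T)^T) 0 0 = _); [rewrite trmx_mul trmxK|rewrite mxE].
Qed.

(** The endomorphism X of the 2-form al /\ x, where x is identified with a
    1-form by g. *)
Definition wedge_up x := raise g (wedge al (x *m g)).

Lemma mul_wedge_up x y : y *m wedge_up x = ip v y *: x - ip x y *: v.
Proof.
rewrite /wedge_up /raise /wedge mulmxBl mulmxBr; congr (_ - _).
  rewrite -!mulmxA [x *m _]mulmxA mulmxK ?posdef_unit //.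
  by rewrite mulmxA [y *m _]mx11_scalar sharp_ip mul_scalar_mx.
rewrite -!mulmxA -/v mulmxA [y *m _]mx11_scalar mul_scalar_mx; congr (_ *: _).
by rewrite -ipC /bil; case: pg => gT _; rewrite trmx_mul gT mulmxA.
Qed.

Lemma wedge_tr (a b : 'rV[R]_4) : (wedge a b)^T = - wedge a b.
Proof. by rewrite /wedge linearB /= !trmx_mul !trmxK opprB. Qed.

Section J.
Context {J : 'M[R]_4}.
Hypothesis JJ : J *m J = - 1%:M.
Hypothesis sJ : (J *m g)^T = - (J *m g).

Lemma mulJJ x : x *m J *m J = - x.
Proof. by rewrite -mulmxA JJ mulmxN mulmx1. Qed.

Lemma ipJ x y : ip (x *m J) y = - ip x (y *m J).
Proof.
by rewrite -bil_mull -[J *m g]opprK -sJ bilN bil_tr bil_mull ipC.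
Qed.

Lemma ipJC x y : ip y (x *m J) = - ip x (y *m J).
Proof. by rewrite ipC ipJ. Qed.

Lemma ipJJ x y : ip (x *m J) (y *m J) = ip x y.
Proof. by rewrite ipJ mulJJ bilNr opprK. Qed.

Lemma ipxJ x : ip x (x *m J) = 0.
Proof. by have := ipJ x x; rewrite ipC; lra. Qed.

Lemma JgJ : J *m g *m J^T = g.
Proof. by apply: bil_eq => x y; rewrite bil_mulr bil_mull ipJJ. Qed.

Lemma tr_wedge_up x : \tr (wedge_up x *m J) = 2 * ip v (x *m J).
Proof.
rewrite /wedge_up /raise /wedge mulmxBl mulmxBl linearB /=.
have -> : al^T *m (x *m g) *m invmx g *m J = al^T *m (x *m J).
  by rewrite !mulmxA mulmxK ?posdef_unit.
have -> : (x *m g)^T *m al *m invmx g *m J = (x *m g)^T *m (v *m J).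
  by rewrite /v !mulmxA.
rewrite ![\tr (_^T *m _)]mxtrace_mulC !trace_mx11 sharp_ip.
have -> : (v *m J *m (x *m g)^T) 0 0 = ip (v *m J) x.
  by rewrite /bil trmx_mul mulmxA; case: pg => ->.
by rewrite ipJ; ring.
Qed.

Variable f : R.
Hypothesis f0 : 0 < f.

(** The value of nabla_x J for the complex structure of either half of a
    star-Killing form, see [dmx_J_part]. *)
Definition nabla_J x := (2 * f)^-1 *: (wedge_up x + J *m wedge_up x *m J).

Lemma mul_nabla_J x y : y *m nabla_J x =
  (2 * f)^-1 *: (ip v y *: x - ip x y *: v + (ip v (y *m J) *: (x *m J) - ip x (y *m J) *: (v *m J))).
Proof.
rewrite /nabla_J -scalemxAr mulmxDr [y *m (_ *m J)]mulmxA [y *m (J *m _)]mulmxA.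
by rewrite !mul_wedge_up mulmxBl -!scalemxAl.
Qed.

(** In terms of a torsion-free connection the Nijenhuis tensor is an
    antisymmetrization of nabla J; with the explicit value of nabla J all terms
    cancel, because J is an isometry and skew-symmetric. *)
Lemma nabla_J_nijenhuis x y :
  y *m nabla_J (x *m J) - x *m nabla_J (y *m J) + x *m nabla_J y *m J - y *m nabla_J x *m J = 0.
Proof.
have E a b : a *m nabla_J b *m J = (2 * f)^-1 *:
   (ip v a *: (b *m J) - ip b a *: (v *m J) - (ip v (a *m J) *: b - ip b (a *m J) *: v)).
  rewrite mul_nabla_J -scalemxAl !(mulmxDl, mulNmx) -!scalemxAl !mulJJ !scalerN.
  by rewrite opprB; congr (_ *: (_ + _)); rewrite opprK addrC.
apply: ip_nondeg => z; rewrite !E !mul_nabla_J !mulJJ !bilE !ipJ ?mulJJ !bilE.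
rewrite (ipC y x) (ipJC x y); field.
by rewrite gt_eqF.
Qed.

(** The cyclic sum of (nabla_x J) y and of the derivative of the conformal
    factor f^-2 is the exterior derivative of the Kahler form; here [df x] is the
    derivative of f. *)
Lemma nabla_J_closed x y z : let df x := - 2^-1 * ip v (x *m J) in
  let T x y z := ip (y *m nabla_J x) z - 2 * f^-1 * df x * ip (y *m J) z in
  T x y z + T y z x + T z x y = 0.
Proof.
move=> /=; rewrite !mul_nabla_J !bilE !ipJ.
rewrite (ipC y x) (ipC z x) (ipC z y) (ipJC x y) (ipJC x z) (ipJC y z); field.
by rewrite gt_eqF.
Qed.
End J.
End alpha.
End metric.
End Vectors.

Arguments wedge_up {R} g al x.
Arguments nabla_J {R} g al J f x.

(** * The two vector fields at a point *)

Section Pair.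
Context {R : realType} {g : 'M[R]_4} (pg : posdef g) (al : 'rV[R]_4).
Context {p m : 'M[R]_4}.
Hypotheses (pp : p *m p = - 1%:M) (sp : (p *m g)^T = - (p *m g)).
Hypotheses (mm : m *m m = - 1%:M) (sm : (m *m g)^T = - (m *m g)).
Hypothesis pm : p *m m = m *m p.
Context {fp fm : R}.
Hypotheses (fp0 : 0 < fp) (fm0 : 0 < fm).
Local Notation ip := (bil g).
Let v := al *m invmx g.
Implicit Types x y z : 'rV[R]_4.

Lemma mulmp x : x *m m *m p = x *m p *m m.
Proof. by rewrite -!mulmxA pm. Qed.

Lemma ippmC x y : ip y (x *m p *m m) = ip x (y *m p *m m).
Proof. by rewrite ipC // !(ipJ pg sp, ipJ pg sm) opprK mulmp. Qed.

Lemma ipmp x y : ip (x *m m *m p) y = ip x (y *m p *m m).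
Proof. by rewrite (ipJ pg sp) (ipJ pg sm) opprK. Qed.

Definition K1v : 'rV[R]_4 := - 2^-1 *: v.

(** Insert grad f = 1/2 v J in y^2 J_+ grad x + x^2 J_+ grad y, with
    x = (f_+ + f_-) / 2 and y = (f_+ - f_-) / 2. *)
Definition K2v : 'rV[R]_4 :=
  - 8^-1 * (fp ^+ 2 + fm ^+ 2) *: v - 4^-1 * (fp * fm) *: (v *m m *m p).

(** The derivative in direction x of the norm f attached to J, see
    [partial_norm_part]. *)
Definition dnorm (J : 'M[R]_4) x := - 2^-1 * ip v (x *m J).

Variable A : 'M[R]_4.
Let Dv x := x *m (A *m invmx g).
Definition nabla_K1 x := - 2^-1 *: Dv x.

(** The covariant derivative of [K2v] by the product rule, when A is that of
    the 1-form al. *)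
Definition nabla_K2 x :=
  - 8^-1 * (2 * fp * dnorm p x + 2 * fm * dnorm m x) *: v
  + - 8^-1 * (fp ^+ 2 + fm ^+ 2) *: Dv x
  - (4^-1 * (dnorm p x * fm + fp * dnorm m x) *: (v *m m *m p)
     + 4^-1 * (fp * fm) *: (Dv x *m m *m p + v *m nabla_J g al m fm x *m p
         + v *m m *m nabla_J g al p fp x)).

Lemma dnorm_K1 : dnorm p K1v = 0 /\ dnorm m K1v = 0.
Proof.
by rewrite /dnorm /K1v -!scalemxAl !bilZr (ipxJ pg sp) (ipxJ pg sm) !mulr0.
Qed.

(** Both K1 and K2 are combinations of v and J_- J_+ v, and df vanishes on
    these vectors since v is orthogonal to J v for skew-symmetric J. *)
Lemma dnorm_K2 : dnorm p K2v = 0 /\ dnorm m K2v = 0.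
Proof.
have Ep : ip v (v *m m *m p *m p) = 0 by rewrite (mulJJ pp) bilNr (ipxJ pg sm) oppr0.
have Em : ip v (v *m m *m p *m m) = 0 by rewrite mulmp (mulJJ mm) bilNr (ipxJ pg sp) oppr0.
rewrite /dnorm /K2v !mulmxBl -!scalemxAl !bilE Ep Em (ipxJ pg sp) (ipxJ pg sm).
by rewrite !mulr0 subr0 !mulr0.
Qed.

Lemma poisson_K1_K2 : ip (K1v *m p) K2v = 0 /\ ip (K1v *m m) K2v = 0.
Proof.
have H (x : 'M[R]_4) (y : 'rV[R]_4) : dnorm x y = 0 -> ip v (y *m x) = 0.
  rewrite /dnorm => /eqP; rewrite mulf_eq0 oppr_eq0 invr_eq0 pnatr_eq0 /= => /eqP //.
have [h1 h2] := dnorm_K2.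
by rewrite (ipJ pg sp) (ipJ pg sm) /K1v !bilZl (H p) // (H m) // mulr0 oppr0.
Qed.

Hypothesis aA : A^T = - A.
Hypothesis Ap : forall x y, bil A (x *m p) y = - bil A x (y *m p).
Hypothesis Am : forall x y, bil A (x *m m) y = - bil A x (y *m m).

Let AC x y : bil A y x = - bil A x y.
Proof. by rewrite -bil_tr aA bilN. Qed.

Lemma ip_Dv x y : ip (Dv x) y = bil A x y.
Proof. by rewrite /Dv ip_sharp. Qed.

Lemma nabla_K1_killing x y : ip (nabla_K1 x) y + ip (nabla_K1 y) x = 0.
Proof. by rewrite /nabla_K1 !bilZl !ip_Dv (AC x y); ring. Qed.

Let SL (c : R) (a : 'rV[R]_4) (b : 'M[R]_4) : (c *: a) *m b = c *: (a *m b).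
Proof. by rewrite scalemxAl. Qed.

Lemma ip_nabla_m x y : ip (v *m nabla_J g al m fm x *m p) y =
  (2 * fm)^-1 * (- (ip v v * ip x (y *m p)) + ip v x * ip v (y *m p)
     + ip v (x *m m) * ip v (y *m p *m m)).
Proof.
rewrite (mul_nabla_J pg) -/v SL (ipxJ pg sm) scale0r add0r !(mulmxDl, mulNmx, SL) mulmp.
rewrite !bilE !(ipJ pg sp, ipJ pg sm) mulmp (ipC pg x v) (ipJC pg sm v x); ring.
Qed.

Lemma ip_nabla_p x y : ip (v *m m *m nabla_J g al p fp x) y =
  (2 * fp)^-1 * (ip v (x *m m) * ip v y - ip v (v *m p *m m) * ip x (y *m p)
     + ip v (x *m p *m m) * ip v (y *m p)).
Proof.
rewrite (mul_nabla_J pg) -/v (ipxJ pg sm) scale0r add0r !mulmp (ippmC v x).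
rewrite (ipJC pg sm v x).
by rewrite !bilE !(ipJ pg sp, ipJ pg sm); ring.
Qed.

Lemma ip_nabla_K2 a b : ip (nabla_K2 a) b =
  - 8^-1 * (2 * fp * dnorm p a + 2 * fm * dnorm m a) * ip v b
  + - 8^-1 * (fp ^+ 2 + fm ^+ 2) * bil A a b
  - (4^-1 * (dnorm p a * fm + fp * dnorm m a) * ip v (b *m p *m m)
     + 4^-1 * (fp * fm) * (bil A a (b *m p *m m) +
        (2 * fm)^-1 * (- (ip v v * ip a (b *m p)) + ip v a * ip v (b *m p)
           + ip v (a *m m) * ip v (b *m p *m m)) +
        (2 * fp)^-1 * (ip v (a *m m) * ip v b - ip v (v *m p *m m) * ip a (b *m p)
           + ip v (a *m p *m m) * ip v (b *m p)))).
Proof.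
rewrite /nabla_K2 !bilE !ipmp !ip_Dv; congr (_ - (_ + _ * (_ + _ + _))).
  exact: ip_nabla_m.
exact: ip_nabla_p.
Qed.

(** A is antisymmetric and commutes with p and m, so its contribution is
    antisymmetric; the remaining terms are antisymmetric or cancel after
    symmetrization. *)
Lemma nabla_K2_killing x y : ip (nabla_K2 x) y + ip (nabla_K2 y) x = 0.
Proof.
apply: (etrans (congr2 +%R (ip_nabla_K2 x y) (ip_nabla_K2 y x))); rewrite /dnorm.
have -> : bil A y (x *m p *m m) = - bil A x (y *m p *m m).
  by rewrite AC Am Ap opprK mulmp.
rewrite (AC x y) (ipJC pg sp x y).
by field; rewrite !gt_eqF.
Qed.

(** For a torsion-free connection this is the vanishing of [K1, K2]. *)
Lemma nabla_K1_K2 : nabla_K2 K1v = nabla_K1 K2v.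
Proof.
have [d1 d2] := dnorm_K1.
apply: (ip_inj pg) => z.
apply: (etrans (ip_nabla_K2 K1v z)); rewrite d1 d2 /nabla_K1 !bilZl ip_Dv.
rewrite /K1v /K2v !SL !mulmp !bilE.
rewrite (ipxJ pg sm) (Am (v *m p)) Ap mulmp.
by field; rewrite !gt_eqF.
Qed.
End Pair.

Arguments K1v {R} g al.
Arguments K2v {R} g al p m fp fm.
Arguments dnorm {R} g al J x.
Arguments nabla_K1 {R} g A x.
Arguments nabla_K2 {R} g al p m fp fm A x.

(** * Frames adapted to two commuting complex structures *)

Section Frame.
Context {R : realType} {g : 'M[R]_4} (pg : posdef g).
Context {p m : 'M[R]_4}.
Hypotheses (pp : p *m p = - 1%:M) (sp : (p *m g)^T = - (p *m g)).
Hypotheses (mm : m *m m = - 1%:M) (sm : (m *m g)^T = - (m *m g)).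
Hypothesis pm : p *m m = m *m p.
Hypothesis tpm : \tr (p *m m) = 0.
Local Notation ip := (bil g).
Implicit Types x y z : 'rV[R]_4.

(** The product Q = p m is a trace-free involution, so neither Q = 1 nor
    Q = -1; hence some row of c + Q is nonzero, and it is an eigenvector. *)
Lemma unit_eigenvector (c : R) : c * c = 1 ->
  exists2 e : 'rV[R]_4, ip e e = 1 & e *m (p *m m) = c *: e.
Proof.
move=> cc; set Q := p *m m.
have QQ : Q *m Q = 1%:M.
  by rewrite /Q {2}pm mulmxA -[p *m m *m m]mulmxA mm mulmxN mulmx1 mulNmx pp opprK.
have [i nz] : exists i, row i (c%:M + Q) != 0.
  apply/existsP; apply: contraT; rewrite negb_exists => /forallP H.
  have Z : c%:M + Q = 0 by apply/row_matrixP => i; rewrite row0; apply/eqP/negPn/H.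
  have := congr1 mxtrace Z; rewrite linearD /= tpm addr0 mxtrace_scalar mxtrace0 => /eqP.
  rewrite mulrn_eq0 /= => /eqP c0; move: cc; rewrite c0 mul0r => /eqP.
  by rewrite eq_sym oner_eq0.
set e := row i _ in nz.
have eQ : e *m Q = c *: e.
  rewrite /e -row_mul mulmxDl QQ mul_scalar_mx; apply/rowP => j.
  by rewrite !mxE mulrDr addrC mulrnAr cc.
have n0 := ip_gt0 pg nz.
exists ((Num.sqrt (ip e e))^-1 *: e).
  rewrite bilZl bilZr mulrA -invfM -expr2 sqr_sqrtr ?ltW //.
  by rewrite mulVf // gt_eqF.
by rewrite -scalemxAl eQ !scalerA mulrC.
Qed.

(** Q = p m is self-adjoint. *)
Lemma eigen_orthogonal x y : x *m (p *m m) = - x -> y *m (p *m m) = y -> ip x y = 0.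
Proof.
move=> hx hy; have : ip (x *m p *m m) y = ip x (y *m p *m m).
  by rewrite !(ipJ pg sp, ipJ pg sm) opprK -!mulmxA pm.
by rewrite -!mulmxA hx hy bilNl => h; lra.
Qed.

Lemma frame_eq0 (e : 'I_4 -> 'rV[R]_4) (C : 'M[R]_4) :
  (forall i j, ip (e i) (e j) = (i == j)%:R) ->
  (forall i j, bil C (e i) (e j) = 0) -> C = 0.
Proof.
move=> on H; pose E := \matrix_(i < 4) e i.
have B (D : 'M[R]_4) i j : (E *m D *m E^T) i j = bil D (e i) (e j).
  rewrite /bil mxE [RHS]mxE; apply: eq_bigr => k _; congr (_ * _); last by rewrite !mxE.
  by rewrite -[in RHS](rowK e i) -row_mul [RHS]mxE.
have E1 : E *m (g *m E^T) = 1%:M.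
  by rewrite mulmxA; apply/matrixP => i j; rewrite B on mxE.
have uE : E \in unitmx by case: (mulmx1_unit E1).
have : E *m C *m E^T = 0 by apply/matrixP => i j; rewrite B H mxE.
move/(congr1 (fun X => invmx E *m X *m invmx E^T)).
by rewrite mulmx0 mul0mx -!mulmxA mulmxV ?unitmx_tr // mulmx1 mulKmx.
Qed.

(** Unit eigenvectors a, b of p m for the eigenvalues -1 and 1, completed by
    a p and b p; on the eigenspaces m is p and - p respectively. *)
Lemma adapted_frame : exists e : 'I_4 -> 'rV[R]_4,
  [/\ forall i j, ip (e i) (e j) = (i == j)%:R,
      [/\ e o0 *m p = e o1, e o1 *m p = - e o0, e o2 *m p = e o3 & e o3 *m p = - e o2] &
      [/\ e o0 *m m = e o1, e o1 *m m = - e o0, e o2 *m m = - e o3 & e o3 *m m = e o2]].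
Proof.
have NN : -1 * -1 = 1 :> R by ring.
have [a a1 aQ] := unit_eigenvector NN.
have [b b1 bQ] := unit_eigenvector (mulr1 1).
rewrite scaleN1r in aQ; rewrite scale1r in bQ.
have am : a *m m = a *m p.
  by apply: oppr_inj; rewrite -mulNmx -aQ -mulmxA -[p *m m *m m]mulmxA mm mulmxN mulmx1 mulmxN.
have bm : b *m m = - (b *m p).
  by rewrite -{1}bQ -mulmxA -[p *m m *m m]mulmxA mm mulmxN mulmx1 mulmxN.
have apQ : a *m p *m (p *m m) = - (a *m p).
  by rewrite pm -mulmxA [p *m (m *m p)]mulmxA mulmxA aQ mulNmx.
have bpQ : b *m p *m (p *m m) = b *m p.
  by rewrite pm -mulmxA [p *m (m *m p)]mulmxA mulmxA bQ.
pose e (i : 'I_4) := if val i == 0%N then a else if val i == 1%N then a *m p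
   else if val i == 2%N then b else b *m p.
exists e; split; rewrite /e /=.
- have O1 := eigen_orthogonal aQ bQ; have O2 := eigen_orthogonal apQ bQ.
  have O3 := eigen_orthogonal aQ bpQ; have O4 := eigen_orthogonal apQ bpQ.
  have C x y : ip x y = 0 -> ip y x = 0 by rewrite ipC.
  have Z x := ipxJ pg sp x.
  apply: ord4P; apply: ord4P; rewrite /= ?(ipJJ pg pp sp) ?a1 ?b1 //; by [apply: C].
- by split=> //; rewrite (mulJJ pp).
- split=> //; first by rewrite -mulmxA pm mulmxA am (mulJJ pp).
  by rewrite -mulmxA pm mulmxA bm mulNmx (mulJJ pp) opprK.
Qed.

(** The tensor T stands for the curvature and A for nabla alpha.  In the adapted
    frame the hypothesis is a linear system for the entries of A whose
    coefficients are f_+ + f_- and f_+ - f_-.  The instances in which both pairs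
    of arguments mix the two planes, or both lie in a plane, allow to eliminate
    the curvature and show that A is antisymmetric on each plane; the instances
    with three arguments in one plane show that A does not mix the planes. *)
Lemma star_killing_algebra (fp fm : R) (A : 'M[R]_4) (T : 'rV[R]_4 -> 'rV[R]_4 -> 'M[R]_4) :
  0 < fp -> 0 < fm -> fp <> fm ->
  (forall x y z w, bil (T x y) z w = - bil (T y x) z w) ->
  (forall x y z w, bil (T x y) z w = - bil (T x y) w z) ->
  (forall x y z w, bil (T x y) z w = bil (T z w) x y) ->
  (forall x y z w, bil A x z * ip y w - bil A x w * ip y z - bil A y z * ip x w + bil A y w * ip x z
     = bil (T x y) (z *m (fp *: p + fm *: m)) w + bil (T x y) z (w *m (fp *: p + fm *: m))) ->
  [/\ A^T = - A,
      forall x y, bil A (x *m p) y = - bil A x (y *m p) &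
      forall x y, bil A (x *m m) y = - bil A x (y *m m)].
Proof.
move=> fp0 fm0 fpm T12 T34 Tpair key.
have [e [on [p0 p1 p2 p3] [m0 m1 m2 m3]]] := adapted_frame.
(* psi = fp p + fm m rotates the planes (e0, e1) and (e2, e3) with these speeds. *)
pose la := fp + fm; pose mu := fp - fm.
have la0 : la != 0 by rewrite gt_eqF // addr_gt0.
have mu0 : mu != 0 by rewrite subr_eq0; apply/eqP.
pose psi := fp *: p + fm *: m.
have S0 : e o0 *m psi = la *: e o1 by rewrite mulmxDr -!scalemxAr p0 m0 -scalerDl.
have S1 : e o1 *m psi = - (la *: e o0).
  by rewrite mulmxDr -!scalemxAr p1 m1 -scalerDl scalerN.
have S2 : e o2 *m psi = mu *: e o3 by rewrite mulmxDr -!scalemxAr p2 m2 scalerN -scalerBl.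
have S3 : e o3 *m psi = - (mu *: e o2).
  by rewrite mulmxDr -!scalemxAr p3 m3 scalerN -scaleNr -scalerDl -scaleNr opprB addrC.
pose a i j := bil A (e i) (e j).
pose r i j k l := bil (T (e i) (e j)) (e k) (e l).
(* pe k F is F evaluated at psi (e k), for F linear and given on the frame. *)
pose pe (k : 'I_4) (F : 'I_4 -> R) := match val k with
  | 0%N => la * F o1 | 1%N => - (la * F o0) | 2%N => mu * F o3 | _ => - (mu * F o2) end.
have peE (k : 'I_4) (B : 'rV[R]_4 -> R) :
    (forall c x, B (c *: x) = c * B x) -> B (e k *m psi) = pe k (fun l => B (e l)).
  move=> Bl; have BN x : B (- x) = - B x by rewrite -scaleN1r Bl mulN1r.
  by move: k; apply: ord4P; rewrite /pe /= ?S0 ?S1 ?S2 ?S3 ?BN Bl.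
have K i j k l : a i k * (j == l)%:R - a i l * (j == k)%:R - a j k * (i == l)%:R
    + a j l * (i == k)%:R = pe k (fun k' => r i j k' l) + pe l (fun l' => r i j k l').
  have := key (e i) (e j) (e k) (e l); rewrite !on => ->.
  rewrite (peE k (fun x => bil (T (e i) (e j)) x (e l))); last by move=> c x; rewrite bilZl.
  by rewrite (peE l (fun x => bil (T (e i) (e j)) (e k) x)) // => c x; rewrite bilZr.
have r12 i j k l : r i j k l = - r j i k l by exact: T12.
have r34 i j k l : r i j k l = - r i j l k by exact: T34.
have rp i j k l : r i j k l = r k l i j by exact: Tpair.
have rz i j k : r i j k k = 0 by have := r34 i j k k; lra.
(* The digits in these names count the vectors of the frame from 1. *)
have K13_13 := K o0 o2 o0 o2; have K13_24 := K o0 o2 o1 o3.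
have K13_14 := K o0 o2 o0 o3; have K13_23 := K o0 o2 o1 o2.
have K24_13 := K o1 o3 o0 o2; have K24_24 := K o1 o3 o1 o3.
have K24_14 := K o1 o3 o0 o3; have K24_23 := K o1 o3 o1 o2.
have K14_13 := K o0 o3 o0 o2; have K14_24 := K o0 o3 o1 o3.
have K14_14 := K o0 o3 o0 o3; have K14_23 := K o0 o3 o1 o2.
have K23_13 := K o1 o2 o0 o2; have K23_24 := K o1 o2 o1 o3.
have K23_14 := K o1 o2 o0 o3; have K23_23 := K o1 o2 o1 o2.
have K12_12 := K o0 o1 o0 o1; have K34_34 := K o2 o3 o2 o3.
have K13_12 := K o0 o2 o0 o1; have K23_12 := K o1 o2 o0 o1.
have K14_12 := K o0 o3 o0 o1; have K24_12 := K o1 o3 o0 o1.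
have K31_34 := K o2 o0 o2 o3; have K32_34 := K o2 o1 o2 o3.
have K41_34 := K o3 o0 o2 o3; have K42_34 := K o3 o1 o2 o3.
rewrite /pe /= !(rz, mulr0, mulr1, subr0, sub0r, addr0, add0r, oppr0) in
  K13_13, K13_24, K13_14, K13_23, K24_13, K24_24, K24_14, K24_23, K14_13, K14_24, K14_14, K14_23,
  K23_13, K23_24, K23_14, K23_23, K12_12, K34_34, K13_12, K23_12, K14_12, K24_12, K31_34, K32_34,
  K41_34, K42_34.
rewrite !(rp o0 o3 o0 o2, rp o0 o3 o1 o3, rp o1 o2 o0 o2, rp o1 o2 o1 o3, rp o1 o3 o0 o2, rp o1 o2 o0 o3) in
  K24_14, K24_23, K14_14, K14_23, K23_13, K23_24, K23_14, K23_23.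
set u := r o0 o2 o1 o2 in K13_13 K13_24 K23_14 K23_23.
set w := r o0 o2 o0 o3 in K13_13 K13_24 K14_14 K14_23.
set q := r o1 o3 o0 o3 in K24_13 K24_24 K14_14 K14_23.
set t := r o1 o3 o1 o2 in K24_13 K24_24 K23_14 K23_23.
have a0 : a o0 o0 = 0.
  have uq : mu * (u + q) = 0 by lra.
  move/eqP: uq; rewrite mulf_eq0 (negbTE mu0) /= => /eqP uq.
  have : la * (u + q) = 0 by rewrite uq mulr0.
  lra.
have a2 : a o2 o2 = 0.
  have h1 : mu * (la * t) = - (mu * (mu * q)) by rewrite -mulrN; congr (_ * _); lra.
  have h2 : mu * (la * w) = mu * (mu * q) by congr (_ * _); lra.
  have h3 : la * (a o0 o0 + a o2 o2) = la * (la * q + mu * t) by congr (_ * _); lra.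
  have h4 : la * (a o0 o0 + a o3 o3) = la * (la * q - mu * w) by congr (_ * _); lra.
  have h5 : la * a o3 o3 = - (la * a o2 o2) by rewrite -mulrN; congr (_ * _); lra.
  have : la * a o2 o2 = 0 by lra.
  by move/eqP; rewrite mulf_eq0 (negbTE la0) => /eqP.
set b := r o0 o2 o1 o3 in K13_14 K13_23 K24_14 K24_23.
set j := r o0 o3 o1 o2 in K14_13 K14_24 K23_13 K23_24.
set k1 := r o0 o2 o0 o2 in K13_14 K13_23.
set k2 := r o1 o3 o1 o3 in K24_14 K24_23.
set k3 := r o0 o3 o0 o3 in K14_13 K14_24.
set k4 := r o1 o2 o1 o2 in K23_13 K23_24.
have k12 : k2 - k1 = 0.
  have h1 : la * ((k2 - k1) - (k4 - k3)) = 0 by lra.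
  have h2 : mu * ((k2 - k1) + (k4 - k3)) = 0 by lra.
  move/eqP: h1; rewrite mulf_eq0 (negbTE la0) /= => /eqP h1.
  move/eqP: h2; rewrite mulf_eq0 (negbTE mu0) /= => /eqP h2; lra.
have a01 : a o0 o1 + a o1 o0 = 0.
  have : la * (k2 - k1) = 0 by rewrite k12 mulr0.
  lra.
have a23 : a o2 o3 + a o3 o2 = 0.
  have : mu * (k2 - k1) = 0 by rewrite k12 mulr0.
  lra.
have a1 : a o1 o1 = 0 by lra.
have a3 : a o3 o3 = 0 by lra.
clear - on p0 p1 p2 p3 m0 m1 m2 m3 a a0 a1 a2 a3 a01 a23 K13_12 K23_12 K14_12 K24_12 K31_34 K32_34 K41_34 K42_34.
have aE k l : bil A (e k) (e l) = a k l by [].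
split.
- apply/eqP; rewrite -subr_eq0 opprK; apply/eqP/(frame_eq0 on) => k l.
  rewrite bilD bil_tr !aE; move: k l.
  by apply: ord4P; apply: ord4P; lra.
- suff E : p *m A + A *m p^T = 0.
    move=> x y; apply/eqP; rewrite -subr_eq0 opprK -bil_mull -bil_mulr -bilD E /bil.
    by rewrite mulmx0 mul0mx mxE.
  apply: (frame_eq0 on) => k l; rewrite bilD bil_mull bil_mulr; move: k l.
  by apply: ord4P; apply: ord4P; rewrite ?p0 ?p1 ?p2 ?p3 ?bilNl ?bilNr !aE; lra.
- suff E : m *m A + A *m m^T = 0.
    move=> x y; apply/eqP; rewrite -subr_eq0 opprK -bil_mull -bil_mulr -bilD E /bil.
    by rewrite mulmx0 mul0mx mxE.
  apply: (frame_eq0 on) => k l; rewrite bilD bil_mull bil_mulr; move: k l.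
  by apply: ord4P; apply: ord4P; rewrite ?m0 ?m1 ?m2 ?m3 ?bilNl ?bilNr !aE; lra.
Qed.
End Frame.

(** * The Levi-Civita connection in a chart *)

(** The derivative of gi * P * gi when gi is the inverse of a parallel metric,
    with connection matrix ga and covariant derivative D of P. *)
Lemma congr_derivative (R : comNzRingType) (gi ga D P : 'M[R]_4) :
  (- (gi *m ga + ga^T *m gi) *m P + gi *m (D + ga *m P + P *m ga^T)) *m gi
    + gi *m P *m (- (gi *m ga + ga^T *m gi))
  = gi *m D *m gi - (ga^T *m (gi *m P *m gi) + gi *m P *m gi *m ga).
Proof.
rewrite !(mulmxDl, mulmxDr, mulNmx, mulmxN, mulmxA).
move: (gi *m ga *m P *m gi) (ga^T *m gi *m P *m gi) (gi *m D *m gi) (gi *m P *m ga^T *m gi)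
  (gi *m P *m gi *m ga) => a b c d e.
by apply/matrixP => i j; rewrite !mxE; ring.
Qed.

(** The algebra behind the Ricci identity: W, D and g stand for first covariant
    derivatives, derivatives of the connection and the connection itself, and
    the hypothesis is the symmetry of second partial derivatives. *)
Lemma ricci_algebra (R : comNzRingType) (Wkl Wlk Wl Wk gl gk Dkl Dlk B : 'M[R]_4) :
  Wkl + (Dkl *m B + gk *m (Wl + gl *m B + B *m gl^T))
    + ((Wl + gl *m B + B *m gl^T) *m gk^T + B *m Dkl^T)
  = Wlk + (Dlk *m B + gl *m (Wk + gk *m B + B *m gk^T))
    + ((Wk + gk *m B + B *m gk^T) *m gl^T + B *m Dlk^T) ->
  (Wkl - gl *m Wk - Wk *m gl^T) - (Wlk - gk *m Wl - Wl *m gk^T)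
   + (Dkl - Dlk + gk *m gl - gl *m gk) *m B + B *m (Dkl - Dlk + gk *m gl - gl *m gk)^T = 0.
Proof.
have -> : (Dkl - Dlk + gk *m gl - gl *m gk)^T = Dkl^T - Dlk^T + gl^T *m gk^T - gk^T *m gl^T.
  by rewrite linearB linearD linearB /= !trmx_mul.
rewrite !(mulmxDl, mulmxDr, mulNmx, mulmxN, mulmxA).
move: (Dkl^T) (Dlk^T) (gl^T) (gk^T) => Dkl' Dlk' gl' gk'.
move: (Dkl *m B) (gk *m Wl) (gk *m gl *m B) (gk *m B *m gl') => a1 a2 a3 a4.
move: (Wl *m gk') (gl *m B *m gk') (B *m gl' *m gk') (B *m Dkl') => b1 b2 b3 b4.
move: (Dlk *m B) (gl *m Wk) (gl *m gk *m B) => c1 c2 c3.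
move: (Wk *m gl') (B *m gk' *m gl') (B *m Dlk') => d1 d2 d3.
move/eqP; rewrite -subr_eq0 => /eqP E; rewrite -[RHS]E {E}.
by apply/matrixP => i j; rewrite !mxE; ring.
Qed.

Section LeviCivita.
Context {R : realType} {U : set 'rV[R]_4} (oU : open U).
Context {G : 'rV[R]_4 -> 'M[R]_4} (sG : smooth_mx U G) (pG : forall u, U u -> posdef (G u)).
Implicit Types (u : 'rV[R]_4) (k l a : 'I_4).
Local Notation Gi := (fun w => invmx (G w)).
Local Notation e_ k := (delta_mx 0 k : 'rV[R]_4).

(** The matrix of the connection in direction k: its row a holds the components
    of nabla_k e_a. *)
Definition conn k u : 'M[R]_4 := \matrix_(a, l)
  (2^-1 * \sum_m invmx (G u) l m *
    (partial k (fun w => G w m a) u + partial a (fun w => G w m k) u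
     - partial m (fun w => G w k a) u)).

Let uG u : U u -> G u \in unitmx. Proof. by move=> /pG; exact: posdef_unit. Qed.
Let GT u : U u -> (G u)^T = G u. Proof. by move=> /pG []. Qed.

Let GiT u : U u -> (invmx (G u))^T = invmx (G u).
Proof. by move=> Uu; rewrite trmx_inv GT. Qed.

Lemma smooth_inv_metric : smooth_mx U Gi.
Proof. exact: smooth_invmx. Qed.

Lemma partial_metric_sym k a b u : U u ->
  partial k (fun w => G w a b) u = partial k (fun w => G w b a) u.
Proof.
move=> Uu; apply: partial_ext oU Uu _ => w Uw; by rewrite -{1}(GT Uw) mxE.
Qed.

(** The Levi-Civita connection is torsion-free. *)
Lemma conn_sym k a u : U u -> e_ a *m conn k u = e_ k *m conn a u.
Proof.
move=> Uu; rewrite -!rowE; apply/rowP => l; rewrite !mxE; congr (_ * _).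
apply: eq_bigr => m _; congr (_ * _).
by rewrite (partial_metric_sym m k a) //; congr (_ - _); exact: addrC.
Qed.

Lemma conn_lower k a b u : U u -> (conn k u *m G u) a b =
  2^-1 * (partial k (fun w => G w b a) u + partial a (fun w => G w b k) u
     - partial b (fun w => G w k a) u).
Proof.
move=> Uu; pose c m := partial k (fun w => G w m a) u + partial a (fun w => G w m k) u
     - partial m (fun w => G w k a) u.
have -> : (conn k u *m G u) a b = 2^-1 * \sum_m c m * (invmx (G u) *m G u) m b.
  rewrite mxE mulr_sumr.
  under eq_bigr do rewrite mxE -mulrA mulr_suml.
  under [RHS]eq_bigr do rewrite mxE mulr_sumr.
  rewrite -mulr_sumr -mulr_sumr exchange_big /=; congr (_ * _).
  apply: eq_bigr => m _; apply: eq_bigr => l _.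
  have E : invmx (G u) m l = invmx (G u) l m by rewrite -[in LHS](GiT Uu) mxE.
  by rewrite E -/(c m); ring.
rewrite mulVmx ?uG //; congr (_ * _); rewrite (bigD1 b) //= big1 ?addr0.
  by rewrite mxE eqxx mulr1.
by move=> m mb; rewrite mxE (negbTE mb) mulr0.
Qed.

(** The Levi-Civita connection preserves the metric. *)
Lemma conn_metric k u : U u -> dmx k G u = conn k u *m G u + G u *m (conn k u)^T.
Proof.
move=> Uu; rewrite -[G u in X in _ + X](GT Uu) -trmx_mul.
apply/matrixP => a b; rewrite [RHS]mxE [in X in _ + X]mxE !conn_lower // mxE.
rewrite (partial_metric_sym k b a) // (partial_metric_sym b k a) // (partial_metric_sym a k b) //.
lra.
Qed.

Lemma smooth_conn k : smooth_mx U (conn k).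
Proof.
move=> a l; under eq_fun do rewrite mxE.
apply: smoothM => //; first exact: smooth_cst.
apply: smooth_sum => // m; apply: smoothM => //; first exact: smooth_inv_metric.
by apply: smoothB => //; [apply: smoothD => //|]; apply: smooth_partial; exact: sG.
Qed.

(** The covariant derivative of a bilinear form in direction k. *)
Definition covd k (B : 'rV[R]_4 -> 'M[R]_4) u : 'M[R]_4 :=
  dmx k B u - conn k u *m B u - B u *m (conn k u)^T.

Lemma dmx_covd k B u : dmx k B u = covd k B u + conn k u *m B u + B u *m (conn k u)^T.
Proof. by rewrite /covd addrAC subrK subrK. Qed.

Lemma dmx_inv_metric k u : U u -> dmx k Gi u = - (invmx (G u) *m conn k u + (conn k u)^T *m invmx (G u)).
Proof.
move=> Uu; rewrite (dmx_invmx oU) // conn_metric // mulmxDr mulmxDl.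
by rewrite !mulmxA mulVmx ?uG // mul1mx -!mulmxA mulmxV ?uG // mulmx1.
Qed.

Lemma smooth_dual (N : 'rV[R]_4 -> 'M[R]_4) : smooth_mx U N -> smooth_mx U (fun w => dual (N w)).
Proof.
move=> sN a b; under eq_fun do rewrite /dual -lock mxE.
apply: smoothM => //; first exact: smooth_cst.
apply: smooth_sum => // c; apply: smooth_sum => // d.
by apply: smoothM => //; exact: smooth_cst.
Qed.

Lemma dmx_dual k (N : 'rV[R]_4 -> 'M[R]_4) u : U u -> smooth_mx U N ->
  dmx k (fun w => dual (N w)) u = dual (dmx k N u).
Proof.
move=> Uu sN; apply/matrixP => a b; rewrite mxE.
have dE (M : 'M[R]_4) : dual M a b = 2^-1 * \sum_c \sum_d levi_civita c d a b * M c d.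
  by rewrite /dual -lock mxE.
under eq_fun do rewrite dE; rewrite dE.
have sC c d (x y : 'I_4) : smooth U (fun w => levi_civita c d x y * N w c d).
  by apply: smoothM => //; exact: smooth_cst.
rewrite (partialZ Uu); last by do 2!(apply: smooth_sum => // ?).
congr (_ * _); rewrite (partial_sum Uu) //; last by move=> c; apply: smooth_sum.
apply: eq_bigr => c _; rewrite (partial_sum Uu) //; apply: eq_bigr => d _.
by rewrite (partialZ Uu) // mxE.
Qed.

Definition vol u := Num.sqrt (\det (G u)).

Lemma smooth_vol : smooth U vol.
Proof.
by apply: smooth_sqrt => // [u /pG /posdef_det //|]; exact: smooth_det.
Qed.

(** The volume density is parallel: by Jacobi's formula its logarithmic
    derivative is half the trace of g^-1 dg, that is, the trace of the connection. *)
Lemma partial_vol k u : U u -> partial k vol u = vol u * \tr (conn k u).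
Proof.
move=> Uu; have d0 := posdef_det (pG Uu).
have v0 : 0 < vol u by rewrite sqrtr_gt0.
rewrite /vol (partial_sqrt Uu) //; last exact: smooth_det.
rewrite (partial_det oU) // conn_metric //.
have E1 : \tr (conn k u *m G u *m \adj (G u)) = \det (G u) * \tr (conn k u).
  by rewrite -mulmxA mul_mx_adj mul_mx_scalar linearZ.
have E2 : \tr (G u *m (conn k u)^T *m \adj (G u)) = \det (G u) * \tr (conn k u).
  by rewrite mxtrace_mulC mulmxA mul_adj_mx mul_scalar_mx linearZ /= mxtrace_tr.
rewrite mulmxDl [\tr (_ + _)]linearD /= E1 E2.
rewrite -/(vol u) -[\det (G u) in LHS](sqr_sqrtr (ltW d0)) -/(vol u); field.
by rewrite gt_eqF.
Qed.

Lemma smooth_star (Phi : 'rV[R]_4 -> 'M[R]_4) : smooth_mx U Phi ->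
  smooth_mx U (fun w => star (G w) (Phi w)).
Proof.
move=> sP; apply: (smooth_mxZ oU); first exact: smooth_vol.
by apply: smooth_dual; apply: (smooth_mxM oU); [apply: (smooth_mxM oU) => //|]; exact: smooth_inv_metric.
Qed.

(** The star is a polynomial expression in the parallel tensors g^-1 and vol;
    the trace of the connection produced by vol is compensated by the rule
    [dual_infinitesimal] for the dual. *)
Lemma covd_star k (Phi : 'rV[R]_4 -> 'M[R]_4) u : U u -> smooth_mx U Phi ->
  (forall w, U w -> (Phi w)^T = - Phi w) ->
  covd k (fun w => star (G w) (Phi w)) u = star (G u) (covd k Phi u).
Proof.
move=> Uu sP aP; have sI := smooth_inv_metric.
pose N w := invmx (G w) *m Phi w *m invmx (G w).
have sN : smooth_mx U N by apply: (smooth_mxM oU) => //; exact: (smooth_mxM oU).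
have aN : (N u)^T = - N u.
  rewrite /N; have := congr_antisym (invmx (G u)) (aP _ Uu).
  by rewrite trmx_inv GT.
set g := G u; set ga := conn k u; set D := covd k Phi u.
have dN : dmx k N u = invmx g *m D *m invmx g - (ga^T *m N u + N u *m ga).
  rewrite (dmxM oU (u := u)) //; last exact: (smooth_mxM oU).
  rewrite (dmxM oU (u := u)) // dmx_inv_metric // dmx_covd -/g -/ga -/D.
  exact: congr_derivative.
rewrite /covd /star (dmxZ (Uu := Uu)) //; [|exact: smooth_vol|exact: smooth_dual].
rewrite partial_vol // dmx_dual // dN -/(vol u) -/(N u) -/ga -/g -/D.
have dualB (A B : 'M[R]_4) : dual (A - B) = dual A - dual B.
  by rewrite dualD -scaleN1r dualZ scaleN1r.
have H := dual_infinitesimal ga aN.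
rewrite dualB scalerBr -!scalemxAl -!scalemxAr -scalerA.
have -> : dual (ga^T *m N u + N u *m ga) = \tr ga *: dual (N u) - (ga *m dual (N u) + dual (N u) *m ga^T).
  by rewrite -H opprB addrCA subrr addr0.
move: (ga *m dual (N u)) (dual (N u) *m ga^T) (\tr ga *: dual (N u)) (dual (_ *m D *m _)) (vol u).
by move=> a b c d v; apply/matrixP => i j; rewrite !mxE; ring.
Qed.

Definition curvature l k u : 'M[R]_4 :=
  dmx l (conn k) u - dmx k (conn l) u + conn k u *m conn l u - conn l u *m conn k u.

Lemma dmx_schwarz k l m n (B : 'rV[R]_4 -> 'M[R]_(m, n)) u : U u -> smooth_mx U B ->
  dmx l (dmx k B) u = dmx k (dmx l B) u.
Proof.
move=> Uu sB; apply/matrixP => i j.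
have E a : (fun w => dmx a B w i j) = partial a (fun w => B w i j).
  by apply/funext => w; rewrite mxE.
have E2 a b : dmx a (dmx b B) u i j = partial a (partial b (fun w => B w i j)) u.
  by rewrite mxE E.
exact: etrans (E2 l k) (etrans (@schwarz R U (fun w => B w i j) l k u oU Uu (sB i j)) (esym (E2 k l))).
Qed.

Lemma smooth_dmx k m n (B : 'rV[R]_4 -> 'M[R]_(m, n)) : smooth_mx U B -> smooth_mx U (dmx k B).
Proof.
by move=> sB i j; under eq_fun do rewrite mxE; exact: smooth_partial.
Qed.

Lemma smooth_covd k B : smooth_mx U B -> smooth_mx U (covd k B).
Proof.
move=> sB; have sg := smooth_conn k.
apply: (smooth_mxB oU); last by apply: (smooth_mxM oU) => //; exact: smooth_mxT.
by apply: (smooth_mxB oU); [exact: smooth_dmx | exact: (smooth_mxM oU)].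
Qed.

(** Expanding both second covariant derivatives, the second partial derivatives
    of B cancel by [schwarz] and what remains is the curvature acting on B. *)
Lemma ricci_identity l k B u : U u -> smooth_mx U B ->
  covd l (covd k B) u - covd k (covd l B) u
    + curvature l k u *m B u + B u *m (curvature l k u)^T = 0.
Proof.
move=> Uu sB.
have E a b : dmx a (dmx b B) u = dmx a (covd b B) u
   + (dmx a (conn b) u *m B u + conn b u *m (covd a B u + conn a u *m B u + B u *m (conn a u)^T))
   + ((covd a B u + conn a u *m B u + B u *m (conn a u)^T) *m (conn b u)^T + B u *m (dmx a (conn b) u)^T).
  have sg := smooth_conn b; have sgT := smooth_mxT sg; have sn := smooth_covd b sB.
  have s1 := smooth_mxM oU sg sB; have s2 := smooth_mxM oU sB sgT.
  have EF : dmx b B = (fun w => covd b B w + conn b w *m B w + B w *m (conn b w)^T).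
    by apply/funext => w; exact: dmx_covd.
  rewrite EF.
  rewrite (dmxD (Uu := Uu)) //; last exact: (smooth_mxD oU).
  rewrite (dmxD (Uu := Uu)) //.
  by rewrite (dmxM oU (Uu := Uu)) // (dmxM oU (Uu := Uu)) // dmxT (dmx_covd a B).
have S := dmx_schwarz k l Uu sB.
exact: ricci_algebra (etrans (esym (E l k)) (etrans S (E k l))).
Qed.
End LeviCivita.

Arguments conn {R} G k u.
Arguments covd {R} G k B u.
Arguments curvature {R} G l k u.
Arguments vol {R} G u.

(** * Curvature of a metric admitting a star-Killing form *)

(** The classical octahedron argument: a signed sum of four instances of the
    Bianchi identity. *)
Lemma pair_symmetry (R : realType) (I : Type) (t : I -> I -> I -> I -> R) :
  (forall i j k l, t i j k l = - t j i k l) -> (forall i j k l, t i j k l = - t i j l k) ->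
  (forall i j k l, t i j k l + t j k i l + t k i j l = 0) ->
  forall i j k l, t i j k l = t k l i j.
Proof.
move=> t12 t34 B i j k l.
have b1 := B i j k l; have b2 := B j k l i; have b3 := B k l i j; have b4 := B l i j k.
have := t34 j k l i; have := t34 k l j i; have := t12 l j k i; have := t34 j l k i.
have := t34 l i k j; have := t12 i k l j; have := t34 k i l j; have := t34 i j l k; lra.
Qed.

Section Lift.
Context {R : realType}.
Implicit Types (x y z w : 'rV[R]_4).
Local Notation e_ k := (delta_mx 0 k : 'rV[R]_4).

Lemma linear_ext (F H : 'rV[R]_4 -> R) :
  (forall c x y, F (c *: x + y) = c * F x + F y) ->
  (forall c x y, H (c *: x + y) = c * H x + H y) ->
  (forall i, F (e_ i) = H (e_ i)) -> forall x, F x = H x.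
Proof.
move=> lF lH E x; rewrite [x]row_sum_delta.
have Z (K : 'rV[R]_4 -> R) : (forall c x y, K (c *: x + y) = c * K x + K y) -> K 0 = 0.
  by move=> lK; have := lK 1 0 0; rewrite scaler0 addr0 mul1r => h; lra.
elim: (index_enum _) => [|i s IH]; first by rewrite !big_nil !Z.
by rewrite !big_cons lF lH IH E.
Qed.

Variable t : 'I_4 -> 'I_4 -> 'M[R]_4.

(** Extends a family of matrices indexed by pairs of coordinate directions
    bilinearly to all tangent vectors. *)
Definition lift2 x y : 'M[R]_4 := \sum_l \sum_k (x 0 l * y 0 k) *: t l k.

Lemma lift2_linl c x x' y : lift2 (c *: x + x') y = c *: lift2 x y + lift2 x' y.
Proof.
rewrite /lift2 scaler_sumr -big_split; apply: eq_bigr => l _ /=.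
rewrite scaler_sumr -big_split; apply: eq_bigr => k _ /=.
by rewrite !mxE scalerA -scalerDl; congr (_ *: _); ring.
Qed.

Lemma lift2_linr c x y y' : lift2 x (c *: y + y') = c *: lift2 x y + lift2 x y'.
Proof.
rewrite /lift2 scaler_sumr -big_split; apply: eq_bigr => l _ /=.
rewrite scaler_sumr -big_split; apply: eq_bigr => k _ /=.
by rewrite !mxE scalerA -scalerDl; congr (_ *: _); ring.
Qed.

Lemma lift2_delta l k : lift2 (e_ l) (e_ k) = t l k.
Proof.
rewrite /lift2 (bigD1 l) //= [X in _ + X]big1 ?addr0.
  rewrite (bigD1 k) //= big1 ?addr0; first by rewrite !mxE !eqxx mulr1 scale1r.
  by move=> j jk; rewrite !mxE (negbTE jk) eqxx andbF mulr0 scale0r.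
move=> j jl; apply: big1 => i _.
by rewrite !mxE (negbTE jl) andbF mul0r scale0r.
Qed.

Lemma lift2_bilinear_ext (F : 'rV[R]_4 -> 'rV[R]_4 -> R) z w :
  (forall c x x' y, F (c *: x + x') y = c * F x y + F x' y) ->
  (forall c x y y', F x (c *: y + y') = c * F x y + F x y') ->
  (forall l k, bil (t l k) z w = F (e_ l) (e_ k)) ->
  forall x y, bil (lift2 x y) z w = F x y.
Proof.
move=> Fl Fr E x y.
apply: (linear_ext (F := fun x => bil (lift2 x y) z w) (H := F ^~ y)) => //.
  by move=> c a b; rewrite lift2_linl bilD bilZ.
move=> l; apply: (linear_ext (F := fun y => bil (lift2 (e_ l) y) z w) (H := F (e_ l))) => //.
  by move=> c a b; rewrite lift2_linr bilD bilZ.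
by move=> k; rewrite lift2_delta.
Qed.

Hypothesis t12 : forall i j k l, t i j k l = - t j i k l.
Hypothesis t34 : forall i j k l, t i j k l = - t i j l k.
Hypothesis tp : forall i j k l, t i j k l = t k l i j.

Lemma lift2_12 x y z w : bil (lift2 x y) z w = - bil (lift2 y x) z w.
Proof.
apply: (lift2_bilinear_ext (F := fun x y => - bil (lift2 y x) z w)).
- by move=> c a b d; rewrite lift2_linr bilD bilZ; ring.
- by move=> c a b d; rewrite lift2_linl bilD bilZ; ring.
move=> l k; rewrite lift2_delta -bilN; congr bil.
by apply/matrixP => a b; rewrite t12 mxE.
Qed.

Lemma lift2_34 x y z w : bil (lift2 x y) z w = - bil (lift2 x y) w z.
Proof.
apply: (lift2_bilinear_ext (F := fun x y => - bil (lift2 x y) w z)).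
- by move=> c a b d; rewrite lift2_linl bilD bilZ; ring.
- by move=> c a b d; rewrite lift2_linr bilD bilZ; ring.
move=> l k; rewrite lift2_delta -bil_tr -bilN; congr bil.
by apply/matrixP => a b; rewrite !mxE t34.
Qed.

Lemma lift2_pair x y z w : bil (lift2 x y) z w = bil (lift2 z w) x y.
Proof.
apply: (lift2_bilinear_ext (F := fun x y => bil (lift2 z w) x y)).
- by move=> c a b d; rewrite bilDl bilZl.
- by move=> c a b d; rewrite bilDr bilZr.
move=> l k; symmetry; apply: (lift2_bilinear_ext (F := fun z w => bil (t l k) z w)).
- by move=> c a b d; rewrite bilDl bilZl.
- by move=> c a b d; rewrite bilDr bilZr.
by move=> i j; rewrite !bil_delta tp.
Qed.
End Lift.

Section Curvature.
Context {R : realType} {U : set 'rV[R]_4} (oU : open U).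
Context {G : 'rV[R]_4 -> 'M[R]_4} (sG : smooth_mx U G) (pG : forall u, U u -> posdef (G u)).
Implicit Types (u : 'rV[R]_4) (k l a : 'I_4).
Local Notation e_ k := (delta_mx 0 k : 'rV[R]_4).
Local Notation Gam := (conn G).
Local Notation nabla := (covd G).
Local Notation curv := (curvature G).

Lemma curv_swap l k u : curv l k u = - curv k l u.
Proof.
rewrite /curvature; apply/matrixP => i j.
move: (dmx _ _ _) (dmx _ _ _) (_ *m _) (_ *m _) => a b c d; rewrite !mxE; ring.
Qed.

Lemma covd_metric k u : U u -> nabla k G u = 0.
Proof.
move=> Uu; rewrite /covd (conn_metric oU pG) //.
by rewrite addrAC addrK subrr.
Qed.

Lemma covd_ext l (B C : 'rV[R]_4 -> 'M[R]_4) u : U u -> (forall w, U w -> B w = C w) ->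
  nabla l B u = nabla l C u.
Proof. by move=> Uu E; rewrite /covd (dmx_ext oU (Uu := Uu) l E) E. Qed.

(** The Ricci identity applied to the parallel tensor G. *)
Lemma curv_metric l k u : U u -> curv l k u *m G u + G u *m (curv l k u)^T = 0.
Proof.
move=> Uu; have := ricci_identity oU sG pG l k Uu sG.
have Z a b : nabla a (nabla b G) u = 0.
  have -> : nabla a (nabla b G) u = nabla a (fun=> 0) u.
    by apply: covd_ext => // w Uw; rewrite covd_metric.
  by rewrite /covd dmx_cst mulmx0 mul0mx !subr0.
by rewrite !Z subrr add0r.
Qed.

(** Substituting the definition of the curvature, all terms cancel in pairs by
    the symmetry of the connection and of its derivative. *)
Lemma bianchi l k m u : U u ->
  e_ m *m curv l k u + e_ l *m curv k m u + e_ k *m curv m l u = 0.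
Proof.
move=> Uu.
have sg a := smooth_conn oU sG pG a.
have S a b := conn_sym oU pG a b Uu.
have D a b c : e_ c *m dmx a (Gam b) u = e_ b *m dmx a (Gam c) u.
  have E (x y : 'I_4) : dmx a (fun w => e_ x *m Gam y w) u = e_ x *m dmx a (Gam y) u.
    by rewrite (dmxM oU (Uu := Uu)) ?dmx_cst ?mul0mx ?add0r //; exact: smooth_mx_cst.
  rewrite -!E; apply: (dmx_ext oU (Uu := Uu)) => w Uw; exact: (conn_sym oU pG).
have C a b c : e_ c *m curv a b u = e_ c *m dmx a (Gam b) u - e_ c *m dmx b (Gam a) u
    + e_ c *m Gam b u *m Gam a u - e_ c *m Gam a u *m Gam b u.
  rewrite /curvature; move: (dmx _ _ _) (dmx _ _ _) (Gam b u) (Gam a u) => x y z t.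
  by rewrite mulmxBr mulmxDr mulmxBr !mulmxA.
have S2 a b c : e_ c *m Gam a u *m Gam b u = e_ a *m Gam c u *m Gam b u by rewrite S.
move: C D S2; set d := fun a b c => e_ c *m dmx a (Gam b) u.
set s := fun a b c => e_ c *m Gam a u *m Gam b u.
move=> C D S2.
have {}C a b c : e_ c *m curv a b u = d a b c - d b a c + s b a c - s a b c by exact: C.
have {}D a b c : d a b c = d a c b by exact: D.
have {}S2 a b c : s a b c = s c b a by exact: S2.
rewrite !C; clearbody d s; clear C S.
rewrite (D l k m) (D k l m) (D m k l) (S2 k l m) (S2 l k m) (S2 k m l).
by apply/matrixP => i j; rewrite !mxE; ring.
Qed.

(** The curvature with its endomorphism index lowered: [riem u i j k l] is
    g(R(e_i, e_j) e_k, e_l). *)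
Definition riem u l k : 'M[R]_4 := curv l k u *m G u.

Lemma riem_antisym12 u i j k l : riem u i j k l = - riem u j i k l.
Proof. by rewrite /riem curv_swap mulNmx mxE. Qed.

Lemma riem_antisym34 u i j k l : U u -> riem u i j k l = - riem u i j l k.
Proof.
move=> Uu; have [gT _] := pG Uu; have := curv_metric i j Uu.
rewrite -{2}gT -trmx_mul -/(riem u i j) => /matrixP/(_ k l); rewrite !mxE => h.
lra.
Qed.

Lemma riem_bianchi u i j k l : U u -> riem u i j k l + riem u j k i l + riem u k i j l = 0.
Proof.
move=> Uu.
have gen (x y z : 'rV[R]_4) (M : 'M[R]_4) : x + y + z = 0 ->
    (x *m M) 0 l + (y *m M) 0 l + (z *m M) 0 l = 0.
  move=> h; have := congr1 (fun X => (X *m M) 0 l) h.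
  by rewrite !mulmxDl mul0mx; rewrite [LHS]mxE [X in X + _]mxE [RHS]mxE.
have E a b c : (e_ c *m curv a b u *m G u) 0 l = riem u a b c l.
  by rewrite -mulmxA -rowE mxE.
have H := gen _ _ _ (G u) (bianchi i j k Uu).
exact: etrans (congr2 +%R (congr2 +%R (esym (E i j k)) (esym (E j k i))) (esym (E k i j))) H.
Qed.

Lemma riem_pair_sym u i j k l : U u -> riem u i j k l = riem u k l i j.
Proof.
move=> Uu; apply: (pair_symmetry (t := fun i j k l => riem u i j k l)).
- exact: riem_antisym12.
- by move=> *; exact: riem_antisym34.
- by move=> *; exact: riem_bianchi.
Qed.

Definition Riemann u := lift2 (riem u).

Section SK.
Context {Psi : 'rV[R]_4 -> 'M[R]_4} {Al : 'rV[R]_4 -> 'rV[R]_4}.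
Hypotheses (sPsi : smooth_mx U Psi) (sAl : smooth_mx U Al).
Hypothesis aPsi : forall u, U u -> (Psi u)^T = - Psi u.
Hypothesis SK : forall k u, U u -> nabla k Psi u = wedge (Al u) (e_ k *m G u).

Definition covd_form k u : 'rV[R]_4 := dmx k Al u - Al u *m (Gam k u)^T.

(** The covariant derivative of the 1-form Al as a bilinear form. *)
Definition nabla_alpha u : 'M[R]_4 := \matrix_k covd_form k u.

Lemma covd2_psi l k u : U u ->
  nabla l (nabla k Psi) u = wedge (covd_form l u) (e_ k *m G u) + wedge (Al u) (e_ k *m Gam l u *m G u).
Proof.
move=> Uu; rewrite (covd_ext l Uu (SK k)) /covd.
have sE : smooth_mx U (fun w => e_ k *m G w).
  by apply: (smooth_mxM oU) => //; exact: smooth_mx_cst.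
have sET := smooth_mxT sE; have sAT := smooth_mxT sAl.
have dE : dmx l (fun w => e_ k *m G w) u = e_ k *m Gam l u *m G u + e_ k *m G u *m (Gam l u)^T.
  rewrite (dmxM oU (Uu := Uu)) //; last exact: smooth_mx_cst.
  by rewrite dmx_cst mul0mx add0r (conn_metric oU pG) // mulmxDr !mulmxA.
rewrite /wedge (dmxB oU (Uu := Uu)) //; [|exact: (smooth_mxM oU)|exact: (smooth_mxM oU)].
have M1 := dmxM oU (Uu := Uu) l sAT sE; have M2 := dmxM oU (Uu := Uu) l sET sAl.
rewrite {}M1 {}M2 (dmxT l Al) (dmxT l (fun w => e_ k *m G w)) dE.
have -> : dmx l Al u = covd_form l u + Al u *m (Gam l u)^T by rewrite /covd_form subrK.
move: (covd_form l u) (e_ k *m G u) (e_ k *m Gam l u *m G u) (Al u) (Gam l u) => n a b al ga.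
have tD (d1 d2 : nat) (x y : 'M[R]_(d1, d2)) : (x + y)^T = x^T + y^T by rewrite linearD.
rewrite !tD !trmx_mul trmxK !(mulmxDl, mulmxDr, mulNmx, mulmxN, mulmxBl, mulmxBr, mulmxA).
move: (n^T *m a) (ga *m al^T *m a) (al^T *m b) (al^T *m a *m ga^T) (b^T *m al) (ga *m a^T *m al)
  (a^T *m n) (a^T *m al *m ga^T) => x1 x2 x3 x4 x5 x6 x7 x8.
by apply/matrixP => i j; rewrite !mxE; ring.
Qed.

Lemma bil_wedge2 (A g : 'M[R]_4) (x y z w : 'rV[R]_4) :
  bil (wedge (x *m A) (y *m g)) z w = bil A x z * bil g y w - bil A x w * bil g y z.
Proof.
have D (a b : 'rV[R]_4) : bil (a^T *m b) z w = (a *m z^T) 0 0 * (b *m w^T) 0 0.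
  rewrite /bil mulmxA [z *m _]mx11_scalar mul_scalar_mx -scalemxAl mxE; congr (_ * _).
  by rewrite -[LHS](_ : ((z *m a^T)^T) 0 0 = _); [rewrite trmx_mul trmxK | rewrite mxE].
by rewrite /wedge bilD bilN !D [X in _ - X]mulrC.
Qed.

(** The Ricci identity for psi, whose second covariant derivatives are
    nabla alpha /\ e_k because the metric is parallel; the terms with the
    connection cancel by torsion-freeness. *)
Lemma star_killing_curvature u : U u ->
  forall x y z w, let A := nabla_alpha u in let ip := bil (G u) in let P := raise (G u) (Psi u) in
   bil A x z * ip y w - bil A x w * ip y z - bil A y z * ip x w + bil A y w * ip x z
     = bil (Riemann u x y) (z *m P) w + bil (Riemann u x y) z (w *m P).
Proof.
move=> Uu x y z w /=; have [gT _] := pG Uu; have ug := posdef_unit (pG Uu).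
symmetry; set P := raise _ _; set A := nabla_alpha u.
have PE : Psi u = P *m G u by rewrite /P /raise mulmxKV.
have key l k : wedge (e_ l *m A) (e_ k *m G u) - wedge (e_ k *m A) (e_ l *m G u)
    + curv l k u *m Psi u + Psi u *m (curv l k u)^T = 0.
  have H := ricci_identity oU sG pG l k Uu sPsi.
  rewrite !covd2_psi // (conn_sym oU pG l k Uu) in H.
  have eA j : e_ j *m A = covd_form j u by rewrite -rowE rowK.
  have AL (a b c a' b' : 'M[R]_4) : a + c - (b + c) + a' + b' = 0 -> a - b + a' + b' = 0.
    by rewrite opprD addrACA subrr addr0.
  rewrite !eA; exact: AL H.
have lin l k : bil (riem u l k) (z *m P) w + bil (riem u l k) z (w *m P) =
   bil A (e_ l) z * bil (G u) (e_ k) w - bil A (e_ l) w * bil (G u) (e_ k) z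
   - bil A (e_ k) z * bil (G u) (e_ l) w + bil A (e_ k) w * bil (G u) (e_ l) z.
  have := congr1 (fun X => bil X z w) (key l k).
  have L4 (a b c d : 'M[R]_4) :
     bil (a - b + c + d) z w = bil a z w - bil b z w + bil c z w + bil d z w.
    by rewrite !bilD bilN.
  rewrite /= L4 !bil_wedge2.
  have -> : bil (curv l k u *m Psi u) z w = - bil (riem u l k) z (w *m P).
    have -> : Psi u = - (G u *m P^T).
      by rewrite -[LHS]opprK -aPsi // PE trmx_mul gT.
    by rewrite mulmxN bilN mulmxA bil_mulr.
  have -> : bil (Psi u *m (curv l k u)^T) z w = - bil (riem u l k) (z *m P) w.
    rewrite PE -mulmxA; have /eqP := curv_metric l k Uu.
    rewrite addrC addr_eq0 => /eqP ->.
    by rewrite mulmxN bilN bil_mull.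
  have -> : bil (0 : 'M[R]_4) z w = 0 by rewrite /bil mulmx0 mul0mx mxE.
  by move=> h; lra.
transitivity (bil (lift2 (fun l k => P *m riem u l k + riem u l k *m P^T) x y) z w).
  rewrite /Riemann; symmetry.
  apply: (lift2_bilinear_ext (F := fun x y => bil (lift2 (riem u) x y) (z *m P) w + bil (lift2 (riem u) x y) z (w *m P))).
  - by move=> c a b d; rewrite !lift2_linl !bilD !bilZ; ring.
  - by move=> c a b d; rewrite !lift2_linr !bilD !bilZ; ring.
  by move=> l k; rewrite !lift2_delta bilD bil_mull bil_mulr.
apply: (lift2_bilinear_ext (F := fun x y => bil A x z * bil (G u) y w - bil A x w * bil (G u) y z
   - bil A y z * bil (G u) x w + bil A y w * bil (G u) x z)).
- by move=> c a b d; rewrite !bilDl !bilZl; ring.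
- by move=> c a b d; rewrite !bilDl !bilZl; ring.
by move=> l k; rewrite bilD bil_mull bil_mulr lin.
Qed.
End SK.
End Curvature.

Arguments riem {R} G u l k.
Arguments Riemann {R} G u x y.
Arguments covd_form {R} G Al k u.
Arguments nabla_alpha {R} G Al u.

(** * The two halves of a star-Killing form *)

Lemma tr_bracket (R : comNzRingType) (X B ga : 'M[R]_4) :
  \tr ((X + ga *m B - B *m ga) *m B) = \tr (X *m B).
Proof.
have E : \tr (B *m ga *m B) = \tr (ga *m B *m B) by rewrite -mulmxA mxtrace_mulC.
by rewrite mulmxBl mulmxDl [LHS]linearB /= [X in X - _]linearD /= E addrK.
Qed.

Lemma tr_part_J (R : realType) (X J : 'M[R]_4) c : J *m J = - 1%:M ->
  \tr ((2^-1 *: (X + J *m X *m J - c *: J)) *m J) = 2 * c.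
Proof.
move=> JJ.
have E : \tr (J *m X *m J *m J) = - \tr (X *m J).
  by rewrite -mulmxA JJ mulmxN mulmx1 [LHS]linearN /= [in LHS]mxtrace_mulC.
rewrite -scalemxAl [LHS]linearZ /= mulmxBl mulmxDl linearB /= linearD /= E subrr sub0r.
by rewrite -scalemxAl JJ linearZ /= linearN /= mxtrace_scalar -[_ *+ 4]mulr_natr; field.
Qed.

Section Local.
Context {R : realType} {U : set 'rV[R]_4} (oU : open U).
Context {G : 'rV[R]_4 -> 'M[R]_4} (sG : smooth_mx U G) (pG : forall u, U u -> posdef (G u)).
Context {Psi : 'rV[R]_4 -> 'M[R]_4} {Al : 'rV[R]_4 -> 'rV[R]_4}.
Hypotheses (sPsi : smooth_mx U Psi) (sAl : smooth_mx U Al).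
Hypothesis aPsi : forall u, U u -> (Psi u)^T = - Psi u.
Implicit Types (u : 'rV[R]_4) (k l a : 'I_4).
Local Notation e_ k := (delta_mx 0 k : 'rV[R]_4).
Local Notation Gam := (conn G).
Local Notation nabla := (covd G).
Hypothesis SK : forall k u, U u -> nabla k Psi u = wedge (Al u) (e_ k *m G u).

(** The endomorphisms Psi_+ and Psi_-, for sg = 1 and sg = -1. *)
Definition endo_part (sg : R) u := raise (G u) (dual_part (G u) sg (Psi u)).
Definition norm_part (sg : R) u := Num.sqrt (- 2^-1 * \tr (endo_part sg u *m endo_part sg u)) / Num.sqrt 2.
Definition J_part (sg : R) u := (norm_part sg u)^-1 *: endo_part sg u.

Let sI := smooth_inv_metric oU sG pG.

Section sign.
Variable sg : R.
Hypothesis s1 : sg * sg = 1.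
Hypothesis U0 : forall u, U u -> 0 < norm_part sg u.
Local Notation Ph := (fun u => dual_part (G u) sg (Psi u)).
Local Notation F := (norm_part sg).
Local Notation B := (endo_part sg).
Local Notation J := (J_part sg).

Lemma smooth_part : smooth_mx U Ph.
Proof.
apply: smooth_mxZ => //; first exact: smooth_cst.
apply: smooth_mxD => //; apply: smooth_mxZ => //; first exact: smooth_cst.
exact: (smooth_star oU sG pG).
Qed.

Lemma part_tr u : U u -> (Ph u)^T = - Ph u.
Proof. by move=> Uu; apply: dual_part_antisym; exact: aPsi. Qed.

(** Taking halves commutes with the covariant derivative by [covd_star]. *)
Lemma covd_part k u : U u -> nabla k Ph u = dual_part (G u) sg (wedge (Al u) (e_ k *m G u)).
Proof.
move=> Uu; have sS := smooth_star oU sG pG sPsi.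
have nD (x y : 'rV[R]_4 -> 'M[R]_4) : smooth_mx U x -> smooth_mx U y ->
    nabla k (fun w => x w + y w) u = nabla k x u + nabla k y u.
  move=> sx sy; rewrite /covd (dmxD (Uu := Uu)) // mulmxDr mulmxDl.
  move: (dmx k x u) (dmx k y u) (Gam k u *m x u) (Gam k u *m y u) (x u *m _) (y u *m _) => x1 x2 x3 x4 x5 x6.
  by apply/matrixP => i j; rewrite !mxE; ring.
have nZ c (x : 'rV[R]_4 -> 'M[R]_4) : smooth_mx U x ->
    nabla k (fun w => c *: x w) u = c *: nabla k x u.
  move=> sx; rewrite /covd (dmxZ (Uu := Uu)) //; last exact: smooth_cst.
  by rewrite partial_cst scale0r add0r -scalemxAr -scalemxAl !scalerBr.
rewrite /dual_part nZ; last by apply: smooth_mxD => //; apply: smooth_mxZ => //; exact: smooth_cst.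
rewrite nD //; last by apply: smooth_mxZ => //; exact: smooth_cst.
by rewrite (nZ sg _ sS) (covd_star oU sG pG k Uu sPsi aPsi) (SK k Uu).
Qed.

Lemma smooth_endo_part : smooth_mx U B.
Proof. by apply: (smooth_mxM oU) => //; exact: smooth_part. Qed.

Lemma dmx_endo_part k u : U u ->
  dmx k B u = raise (G u) (dual_part (G u) sg (wedge (Al u) (e_ k *m G u))) + Gam k u *m B u - B u *m Gam k u.
Proof.
move=> Uu; rewrite /endo_part /raise (dmxM oU (Uu := Uu)) //; last exact: smooth_part.
rewrite (dmx_inv_metric oU sG pG) // (dmx_covd (G := G)) covd_part //.
move: (dual_part _ _ _) (dual_part _ _ _) (invmx _) (Gam k u) => a b gi ga.
rewrite !(mulmxDl, mulmxDr, mulmxN, mulmxA).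
move: (a *m gi) (ga *m b *m gi) (b *m ga^T *m gi) (b *m gi *m ga) => x1 x2 x3 x4.
by apply/matrixP => i j; rewrite !mxE; ring.
Qed.

Lemma norm_part_sqr u : U u -> F u ^+ 2 = - 4^-1 * \tr (B u *m B u).
Proof.
move=> Uu; have := U0 Uu; rewrite /norm_part.
have s2 : 0 < Num.sqrt 2 :> R by rewrite sqrtr_gt0.
rewrite pmulr_lgt0 ?invr_gt0 // sqrtr_gt0 => h.
by rewrite expr_div_n (sqr_sqrtr (ltW h)) sqr_sqrtr ?ler0n //; field.
Qed.

Lemma endo_part_sqr u : U u -> B u *m B u = - (F u ^+ 2)%:M.
Proof.
move=> Uu; have aP := part_tr Uu; have sP := star_dual_part (pG Uu) s1 (aPsi Uu).
rewrite norm_part_sqr // /endo_part (raise_sqr (pG Uu) s1 aP sP).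
rewrite mxtrace_scalar -[_ *+ 4]mulr_natr -[in RHS]scaleN1r scale_scalar_mx.
by move: (sg * _ / _) => c; congr (_%:M); field.
Qed.

Lemma J_part_sqr u : U u -> J u *m J u = - 1%:M.
Proof.
move=> Uu; rewrite /J_part -scalemxAl -scalemxAr endo_part_sqr // scalerA scalerN scale_scalar_mx; congr (- _%:M).
by field; rewrite gt_eqF // U0.
Qed.

Lemma J_part_skew u : U u -> (J u *m G u)^T = - (J u *m G u).
Proof.
move=> Uu; have ug := posdef_unit (pG Uu).
rewrite /J_part /endo_part /raise -scalemxAl mulmxKV //.
by rewrite linearZ /= part_tr // scalerN.
Qed.

Lemma smooth_norm_part : smooth U F.
Proof.
apply: smoothM => //; last exact: smooth_cst.
apply: smooth_sqrt => //; last first.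
  apply: smoothM => //; first exact: smooth_cst.
  by apply: smooth_trace => //; apply: (smooth_mxM oU); exact: smooth_endo_part.
move=> u Uu; have := U0 Uu; rewrite /norm_part pmulr_lgt0 ?invr_gt0 ?sqrtr_gt0 //.
Qed.

Lemma smooth_norm_part_inv : smooth U (fun u => (F u)^-1).
Proof. by apply: smoothV => //; [move=> u /U0 /gt_eqF ->| exact: smooth_norm_part]. Qed.

Lemma smooth_J_part : smooth_mx U J.
Proof. by apply: smooth_mxZ => //; [exact: smooth_norm_part_inv | exact: smooth_endo_part]. Qed.

(** [raise_dual_part] for the form alpha /\ x. *)
Lemma raise_dual_part_wedge (x : 'rV[R]_4) u : U u ->
  raise (G u) (dual_part (G u) sg (wedge (Al u) (x *m G u))) =
  2^-1 *: (wedge_up (G u) (Al u) x + J u *m wedge_up (G u) (Al u) x *m J u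
           - (bil (G u) (Al u *m invmx (G u)) (x *m J u)) *: J u).
Proof.
move=> Uu; have aP := part_tr Uu; have sP := star_dual_part (pG Uu) s1 (aPsi Uu).
have F0 : F u != 0 by rewrite gt_eqF // U0.
rewrite (raise_dual_part (pG Uu) s1 aP sP (wedge_tr _ _) F0 (erefl _) (J_part_sqr Uu)).
rewrite -/(wedge_up (G u) (Al u) x) (tr_wedge_up (pG Uu) (Al u) (J_part_skew Uu)).
by rewrite mulKf // pnatr_eq0.
Qed.

(** Differentiate f^2 = - 1/4 tr (Psi^2); the commutator with the connection
    has no trace, and the J-component of the half of alpha /\ x gives the value. *)
Lemma partial_norm_part k u : U u ->
  partial k F u = - 2^-1 * bil (G u) (Al u *m invmx (G u)) (e_ k *m J u).
Proof.
move=> Uu; have F0 := U0 Uu; have sF := smooth_norm_part; have sB := smooth_endo_part.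
have E : partial k (fun w => F w * F w) u = partial k (fun w => - 4^-1 * \tr (B w *m B w)) u.
  by apply: partial_ext oU Uu _ => w Uw; rewrite -expr2 norm_part_sqr.
have sBB : smooth_mx U (fun w => B w *m B w) by exact: smooth_mxM.
rewrite (partialM Uu) // (partialZ Uu) in E; last exact: smooth_trace.
rewrite (partial_trace oU (Uu := Uu)) // (dmxM oU (Uu := Uu)) // in E.
rewrite linearD /= [\tr (B u *m _)]mxtrace_mulC dmx_endo_part // in E.
set X := raise (G u) _ in E.
have BE : B u = F u *: J u by rewrite /J_part scalerA mulfV ?scale1r // gt_eqF.
have TX : \tr (X *m J u) = 2 * bil (G u) (Al u *m invmx (G u)) (e_ k *m J u).
  by rewrite /X raise_dual_part_wedge // tr_part_J // J_part_sqr.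
have BX : \tr (X *m B u) = F u * (2 * bil (G u) (Al u *m invmx (G u)) (e_ k *m J u)).
  by rewrite BE -scalemxAr linearZ /= TX.
rewrite tr_bracket BX in E.
have F0' : F u != 0 by rewrite gt_eqF.
by apply: (mulfI F0'); lra.
Qed.

(** The J-component of the derivative of Psi = f J is df, so it disappears
    from the derivative of J.  The commutator with the connection is the
    difference between covariant and partial derivative. *)
Lemma dmx_J_part k u : U u -> dmx k J u =
  nabla_J (G u) (Al u) (J u) (F u) (e_ k) + Gam k u *m J u - J u *m Gam k u.
Proof.
move=> Uu; have F0 : F u != 0 by rewrite gt_eqF // U0.
rewrite /J_part (dmxZ (Uu := Uu)); [|exact: smooth_norm_part_inv|exact: smooth_endo_part].
rewrite (partialV Uu) //; last exact: smooth_norm_part.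
rewrite partial_norm_part // dmx_endo_part // raise_dual_part_wedge // -/(J u) /nabla_J.
have BE : B u = F u *: J u by rewrite /J_part scalerA mulfV ?scale1r.
rewrite BE -!scalemxAl -!scalemxAr.
move: (wedge_up _ _ _) (_ *m wedge_up _ _ _ *m _) => x1 x2.
move: (Gam k u *m J u) (J u *m Gam k u) (bil _ _ _) => x3 x4 c.
move: F0; move: (F u) (J u) => f j f0.
by apply/matrixP => a b; rewrite !mxE; field.
Qed.
End sign.
End Local.

Arguments endo_part {R} G Psi sg u.
Arguments norm_part {R} G Psi sg u.
Arguments J_part {R} G Psi sg u.

(** * Covariant derivatives of the two vector fields *)

Section VectorFields.
Context {R : realType} {U : set 'rV[R]_4} (oU : open U).
Context {G : 'rV[R]_4 -> 'M[R]_4} (sG : smooth_mx U G) (pG : forall u, U u -> posdef (G u)).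
Implicit Types (u : 'rV[R]_4) (k l a b : 'I_4) (X Y : 'rV[R]_4 -> 'rV[R]_4).
Local Notation e_ k := (delta_mx 0 k : 'rV[R]_4).
Local Notation Gam := (conn G).

(** The covariant derivative of a vector field in direction k. *)
Definition ncov k X u := dmx k X u + X u *m Gam k u.

(** Torsion-freeness: the connection terms in the bracket cancel. *)
Lemma bracket_ncov X Y u : U u ->
  \sum_l (X u 0 l *: dmx l Y u - Y u 0 l *: dmx l X u) =
  \sum_l (X u 0 l *: ncov l Y u - Y u 0 l *: ncov l X u).
Proof.
move=> Uu; rewrite !sumrB.
have D (Z : 'rV[R]_4 -> 'rV[R]_4) (x z : 'rV[R]_4) : z = Z u ->
   \sum_l x 0 l *: ncov l Z u = \sum_l x 0 l *: dmx l Z u + \sum_l \sum_m (x 0 l * z 0 m) *: (e_ m *m Gam l u).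
  move=> ->; rewrite -big_split; apply: eq_bigr => l _ /=.
  rewrite /ncov scalerDr; congr (_ + _).
  rewrite [in LHS](row_sum_delta (Z u)) mulmx_suml scaler_sumr; apply: eq_bigr => m _.
  by rewrite -scalemxAl scalerA.
rewrite (D Y (X u) (Y u)) // (D X (Y u) (X u)) //.
have -> : \sum_l \sum_m (Y u 0 l * X u 0 m) *: (e_ m *m Gam l u)
   = \sum_l \sum_m (X u 0 l * Y u 0 m) *: (e_ m *m Gam l u).
  rewrite exchange_big; apply: eq_bigr => l _; apply: eq_bigr => m _.
  by rewrite mulrC (conn_sym oU pG).
by rewrite opprD addrACA subrr addr0.
Qed.

(** The Lie derivative of the metric is the symmetrized covariant derivative
    of X, the connection being metric and torsion-free. *)
Lemma lie_metric X u a b : U u ->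
  \sum_l (X u 0 l * partial l (fun w => G w a b) u
          + partial a (fun w => X w 0 l) u * G u l b
          + partial b (fun w => X w 0 l) u * G u a l)
  = bil (G u) (ncov a X u) (e_ b) + bil (G u) (ncov b X u) (e_ a).
Proof.
move=> Uu; have [gT _] := pG Uu.
have E c d : bil (G u) (ncov c X u) (e_ d) =
   \sum_l partial c (fun w => X w 0 l) u * G u l d + \sum_l X u 0 l * (Gam l u *m G u) c d.
  rewrite /ncov bilDl; congr (_ + _).
    by rewrite /bil trmx_delta -colE !mxE; apply: eq_bigr => l _; rewrite !mxE.
  rewrite -bil_mull [in LHS](row_sum_delta (X u)) /bil !mulmx_suml summxE; apply: eq_bigr => l _.
  rewrite -!scalemxAl mxE; congr (_ * _).
  by rewrite !mulmxA (conn_sym oU pG) // -[_ *m Gam l u *m G u]mulmxA -/(bil _ _ _) bil_delta.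
rewrite !E !big_split /= -!addrA.
have M l : partial l (fun w => G w a b) u = (Gam l u *m G u) a b + (Gam l u *m G u) b a.
  have := congr1 (fun M : 'M[R]_4 => M a b) (conn_metric oU pG l Uu).
  by rewrite /= mxE => ->; rewrite -{2}gT -trmx_mul [LHS]mxE [X in _ + X]mxE.
under eq_bigr do rewrite M mulrDr.
rewrite big_split /=.
have -> : \sum_l partial b (fun w => X w 0 l) u * G u a l = \sum_l partial b (fun w => X w 0 l) u * G u l a.
  by apply: eq_bigr => l _; rewrite -{1}gT mxE.
move: (\sum_l X u 0 l * _) (\sum_l X u 0 l * _) (\sum_l _ * G u l b) (\sum_l _ * G u l a) => x1 x2 x3 x4.
ring.
Qed.
End VectorFields.

Arguments ncov {R} G k X u.

Lemma partial_sum_sqr (R : realType) (U : set 'rV[R]_4) (f h : 'rV[R]_4 -> R) c k u : open U -> U u ->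
  smooth U f -> smooth U h ->
  partial k (fun w => c * (f w ^+ 2 + h w ^+ 2)) u =
  c * (2 * f u * partial k f u + 2 * h u * partial k h u).
Proof.
move=> oU Uu sf sh; have sff := smoothM oU sf sf; have shh := smoothM oU sh sh.
rewrite (partialZ Uu k _ (smoothD oU sff shh)) (partialD Uu k sff shh).
by rewrite (partialM Uu k sf sf) (partialM Uu k sh sh); ring.
Qed.

Lemma partial_mulZ (R : realType) (U : set 'rV[R]_4) (f h : 'rV[R]_4 -> R) c k u : open U -> U u ->
  smooth U f -> smooth U h ->
  partial k (fun w => c * (f w * h w)) u = c * (partial k f u * h u + f u * partial k h u).
Proof.
by move=> oU Uu sf sh; rewrite (partialZ Uu k _ (smoothM oU sf sh)) (partialM Uu k sf sh).
Qed.

Section KillingFields.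
Context {R : realType} {U : set 'rV[R]_4} (oU : open U).
Context {G : 'rV[R]_4 -> 'M[R]_4} (sG : smooth_mx U G) (pG : forall u, U u -> posdef (G u)).
Context {Psi : 'rV[R]_4 -> 'M[R]_4} {Al : 'rV[R]_4 -> 'rV[R]_4}.
Hypotheses (sPsi : smooth_mx U Psi) (sAl : smooth_mx U Al).
Hypothesis aPsi : forall u, U u -> (Psi u)^T = - Psi u.
Implicit Types (u : 'rV[R]_4) (k l a : 'I_4).
Local Notation e_ k := (delta_mx 0 k : 'rV[R]_4).
Local Notation Gam := (conn G).
Local Notation nabla := (covd G).
Hypothesis SK : forall k u, U u -> nabla k Psi u = wedge (Al u) (e_ k *m G u).
Local Notation fp := (norm_part G Psi 1).
Local Notation fm := (norm_part G Psi (-1)).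
Local Notation Jp := (J_part G Psi 1).
Local Notation Jm := (J_part G Psi (-1)).
Hypothesis fp0 : forall u, U u -> 0 < fp u.
Hypothesis fm0 : forall u, U u -> 0 < fm u.
Hypothesis fpm : forall u, U u -> fp u <> fm u.
Local Notation v := (fun u => Al u *m invmx (G u)).
Local Notation A := (nabla_alpha G Al).

Let sI := smooth_inv_metric oU sG pG.
Let s1 : 1 * 1 = 1 :> R. Proof. exact: mulr1. Qed.
Let sN1 : -1 * -1 = 1 :> R. Proof. by ring. Qed.

(** Psi_+ and Psi_- come from a self-dual and an anti-self-dual form. *)
Lemma J_part_commute u : U u -> Jp u *m Jm u = Jm u *m Jp u /\ \tr (Jp u *m Jm u) = 0.
Proof.
move=> Uu; rewrite /J_part -!scalemxAl -!scalemxAr.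
have aP := part_tr (G := G) aPsi 1 Uu.
have aM := part_tr (G := G) aPsi (-1) Uu.
have sP := star_dual_part (pG Uu) s1 (aPsi Uu); rewrite scale1r in sP.
have sM := star_dual_part (pG Uu) sN1 (aPsi Uu); rewrite scaleN1r in sM.
have [c t] := raise_comm (pG Uu) aP sP aM sM.
rewrite /endo_part c; split; first by rewrite !scalerA mulrC.
by rewrite -c !linearZ /= t !mulr0.
Qed.

Lemma psi_J_decomposition u : U u -> raise (G u) (Psi u) = fp u *: Jp u + fm u *: Jm u.
Proof.
move=> Uu; have hp := lt0r_neq0 (fp0 Uu); have hm := lt0r_neq0 (fm0 Uu).
have E (c : R) (B : 'M[R]_4) : c != 0 -> c *: (c^-1 *: B) = B.
  by move=> c0; rewrite scalerA mulfV // scale1r.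
apply: (etrans _ (congr2 +%R (esym (E _ _ hp)) (esym (E _ _ hm)))).
have D (x y : 'M[R]_4) : x = 2^-1 *: (x + 1 *: y) + 2^-1 *: (x + -1 *: y).
  by apply/matrixP => i j; rewrite !mxE; field.
by rewrite /endo_part /raise -mulmxDl /dual_part -D.
Qed.

(** [star_killing_algebra] applied to the curvature. *)
Lemma nabla_alpha_symmetries u : U u ->
  [/\ (A u)^T = - A u,
      forall x y, bil (A u) (x *m Jp u) y = - bil (A u) x (y *m Jp u) &
      forall x y, bil (A u) (x *m Jm u) y = - bil (A u) x (y *m Jm u)].
Proof.
move=> Uu; have [c t] := J_part_commute Uu.
apply: (@star_killing_algebra _ _ (pG Uu) _ _ (J_part_sqr pG aPsi s1 fp0 Uu)
  (J_part_skew pG aPsi 1 Uu) (J_part_sqr pG aPsi sN1 fm0 Uu)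
  (J_part_skew pG aPsi (-1) Uu) c t (fp u) (fm u) (A u) (Riemann G u)).
- exact: fp0.
- exact: fm0.
- exact: fpm.
- by apply: lift2_12 => *; exact: riem_antisym12.
- by apply: lift2_34 => *; exact: (riem_antisym34 oU sG pG).
- by apply: lift2_pair => *; exact: (riem_pair_sym oU sG pG).
by rewrite -psi_J_decomposition //; exact: (star_killing_curvature oU sG pG sPsi sAl aPsi SK Uu).
Qed.

#[local] Opaque norm_part J_part endo_part.

Lemma ncov_v k u : U u -> ncov G k v u = e_ k *m (A u *m invmx (G u)).
Proof.
move=> Uu; rewrite /ncov (dmxM oU (Uu := Uu)) // (dmx_inv_metric oU sG pG) //.
rewrite mulmxA -rowE rowK /covd_form mulmxBl mulmxN mulmxDr !mulmxA.
by rewrite opprD addrA addrAC subrK.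
Qed.

Lemma smooth_v : smooth_mx U v.
Proof. exact: (smooth_mxM oU). Qed.

Lemma ncovZ k f (X : 'rV[R]_4 -> 'rV[R]_4) u : U u -> smooth U f -> smooth_mx U X ->
  ncov G k (fun w => f w *: X w) u = partial k f u *: X u + f u *: ncov G k X u.
Proof.
by move=> Uu sf sX; rewrite /ncov (dmxZ (Uu := Uu)) // -scalemxAl -addrA -scalerDr.
Qed.

Lemma ncovB k (X Y : 'rV[R]_4 -> 'rV[R]_4) u : U u -> smooth_mx U X -> smooth_mx U Y ->
  ncov G k (fun w => X w - Y w) u = ncov G k X u - ncov G k Y u.
Proof.
by move=> Uu sX sY; rewrite /ncov (dmxB oU (Uu := Uu)) // mulmxBl opprD addrACA.
Qed.

Lemma ncov_mul k (X : 'rV[R]_4 -> 'rV[R]_4) (J : 'rV[R]_4 -> 'M[R]_4) D u :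
  U u -> smooth_mx U X -> smooth_mx U J ->
  dmx k J u = D + Gam k u *m J u - J u *m Gam k u ->
  ncov G k (fun w => X w *m J w) u = ncov G k X u *m J u + X u *m D.
Proof.
move=> Uu sX sJ E; rewrite /ncov (dmxM oU (Uu := Uu)) // E mulmxBr !mulmxDr mulmxDl !mulmxA.
move: (dmx k X u *m J u) (X u *m D) (X u *m _ *m J u) (X u *m J u *m _) => a b c d.
by apply/matrixP => i j; rewrite !mxE; ring.
Qed.

Definition K1f u := K1v (G u) (Al u).
Definition K2f u := K2v (G u) (Al u) (Jp u) (Jm u) (fp u) (fm u).

Let sfp : smooth U fp := smooth_norm_part oU sG pG sPsi fp0.
Let sfm : smooth U fm := smooth_norm_part oU sG pG sPsi fm0.
Let sJp : smooth_mx U Jp := smooth_J_part oU sG pG sPsi fp0.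
Let sJm : smooth_mx U Jm := smooth_J_part oU sG pG sPsi fm0.

Lemma ncov_K1 k u : U u -> ncov G k K1f u = nabla_K1 (G u) (A u) (e_ k).
Proof.
move=> Uu; rewrite /K1f /K1v (ncovZ k Uu (smooth_cst U (- 2^-1)) smooth_v).
by rewrite partial_cst scale0r add0r ncov_v.
Qed.

Let sq : smooth U (fun w => fp w ^+ 2 + fm w ^+ 2).
Proof. by apply: smoothD => //; exact: smoothM. Qed.

Lemma ncov_K2 k u : U u -> ncov G k K2f u =
  nabla_K2 (G u) (Al u) (Jp u) (Jm u) (fp u) (fm u) (A u) (e_ k).
Proof.
move=> Uu; have sv := smooth_v.
pose c1 w := - 8^-1 * (fp w ^+ 2 + fm w ^+ 2); pose c2 w := 4^-1 * (fp w * fm w).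
have sc1 : smooth U c1 by apply: smoothM => //; exact: smooth_cst.
have spm : smooth U (fun w => fp w * fm w) by exact: smoothM.
have sc2 : smooth U c2 by apply: smoothM => //; exact: smooth_cst.
have svm : smooth_mx U (fun w => v w *m Jm w) by exact: (smooth_mxM oU).
have svmp : smooth_mx U (fun w => v w *m Jm w *m Jp w) by exact: (smooth_mxM oU).
have -> : ncov G k K2f u = ncov G k (fun w => c1 w *: v w - c2 w *: (v w *m Jm w *m Jp w)) u by [].
rewrite (ncovB k Uu (smooth_mxZ oU sc1 sv) (smooth_mxZ oU sc2 svmp)).
rewrite (ncovZ k Uu sc1 sv) (ncovZ k Uu sc2 svmp) (ncov_v k Uu).
have dp := dmx_J_part oU sG pG sPsi aPsi SK s1 fp0 k Uu.
have dm := dmx_J_part oU sG pG sPsi aPsi SK sN1 fm0 k Uu.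
rewrite (ncov_mul Uu svm sJp dp) (ncov_mul Uu sv sJm dm) (ncov_v k Uu).
have pp : partial k fp u = dnorm (G u) (Al u) (Jp u) (e_ k).
  exact: (partial_norm_part oU sG pG sPsi aPsi SK s1 fp0).
have pm : partial k fm u = dnorm (G u) (Al u) (Jm u) (e_ k).
  exact: (partial_norm_part oU sG pG sPsi aPsi SK sN1 fm0).
have -> : partial k c1 u = - 8^-1 * (2 * fp u * partial k fp u + 2 * fm u * partial k fm u).
  exact: partial_sum_sqr oU Uu sfp sfm.
have -> : partial k c2 u = 4^-1 * (partial k fp u * fm u + fp u * partial k fm u).
  exact: partial_mulZ oU Uu sfp sfm.
by rewrite pp pm /nabla_K2 /c1 /c2 mulmxDl.
Qed.

Lemma smooth_K1 : smooth_mx U K1f.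
Proof. apply: (smooth_mxZ oU); [exact: smooth_cst | exact: smooth_v]. Qed.

Lemma smooth_K2 : smooth_mx U K2f.
Proof.
apply: (smooth_mxB oU); apply: (smooth_mxZ oU).
- by apply: smoothM => //; exact: smooth_cst.
- exact: smooth_v.
- by apply: smoothM => //; [exact: smooth_cst | exact: smoothM].
- by apply: (smooth_mxM oU) => //; apply: (smooth_mxM oU) => //; exact: smooth_v.
Qed.
End KillingFields.

Arguments K1f {R} G Al u.
Arguments K2f {R} G Psi Al u.

(** * Integrability, closedness and conformal change *)

(** Turns formulas for coordinate directions into formulas for arbitrary tangent
    vectors. *)
Lemma linear_sum_delta (R : realType) (V : lmodType R) (L : 'rV[R]_4 -> V) :
  (forall c x y, L (c *: x + y) = c *: L x + L y) ->
  forall x : 'rV[R]_4, \sum_l x 0 l *: L (delta_mx 0 l) = L x.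
Proof.
move=> lL x; rewrite [in RHS](row_sum_delta x).
have L0 : L 0 = 0.
  have := lL 1 0 0; rewrite scaler0 addr0 scale1r => h.
  by apply: (addIr (L 0)); rewrite add0r -h.
elim: (index_enum _) => [|i s IH]; first by rewrite !big_nil L0.
by rewrite !big_cons lL IH.
Qed.

Lemma mul_scalemx (R : comNzRingType) m n p (c : R) (a : 'M[R]_(m, n)) (b : 'M[R]_(n, p)) :
  (c *: a) *m b = c *: (a *m b).
Proof. by rewrite scalemxAl. Qed.

Lemma mulmx_scale (R : comNzRingType) m n p (c : R) (a : 'M[R]_(m, n)) (b : 'M[R]_(n, p)) :
  a *m (c *: b) = c *: (a *m b).
Proof. by rewrite scalemxAr. Qed.

Definition mxlin := (mulmxDl, mulmxDr, mulNmx, mulmxN, @mul_scalemx, @mulmx_scale).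

Lemma wedge_up_lin (R : realType) (g : 'M[R]_4) al c x y :
  wedge_up g al (c *: x + y) = c *: wedge_up g al x + wedge_up g al y.
Proof.
rewrite /wedge_up /raise /wedge; set gi := invmx g.
have tL (a b : 'rV[R]_4) : (c *: a + b)^T = c *: a^T + b^T by rewrite linearD linearZ.
rewrite (mulmxDl (c *: x) y g) mul_scalemx tL !mxlin.
move: (al^T *m _ *m _) (al^T *m _ *m _) (_ *m al *m _) (_ *m al *m _) => a b d e.
by apply/matrixP => i j; rewrite !mxE; ring.
Qed.

Lemma nabla_J_lin (R : realType) (g J : 'M[R]_4) al f c x y :
  nabla_J g al J f (c *: x + y) = c *: nabla_J g al J f x + nabla_J g al J f y.
Proof.
rewrite /nabla_J wedge_up_lin; move: (wedge_up g al x) (wedge_up g al y) => a b; rewrite !mxlin.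
move: (_ *m a *m _) (_ *m b *m _) => d e.
by apply/matrixP => i j; rewrite !mxE; ring.
Qed.

Lemma dnorm_lin (R : realType) (g J : 'M[R]_4) al c x y :
  dnorm g al J (c *: x + y) = c * dnorm g al J x + dnorm g al J y.
Proof. by rewrite /dnorm mulmxDl -scalemxAl bilDr bilZr; ring. Qed.

Lemma nabla_K1_lin (R : realType) (g A : 'M[R]_4) c x y :
  nabla_K1 g A (c *: x + y) = c *: nabla_K1 g A x + nabla_K1 g A y.
Proof.
rewrite /nabla_K1 mulmxDl -scalemxAl.
by move: (x *m _) (y *m _) => a b; apply/matrixP => i j; rewrite !mxE; ring.
Qed.

Lemma nabla_K2_lin (R : realType) (g p m A : 'M[R]_4) al fp fm c x y :
  nabla_K2 g al p m fp fm A (c *: x + y) =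
  c *: nabla_K2 g al p m fp fm A x + nabla_K2 g al p m fp fm A y.
Proof.
rewrite /nabla_K2 !dnorm_lin !nabla_J_lin.
move: (dnorm g al p x) (dnorm g al p y) (dnorm g al m x) (dnorm g al m y) => d1 d2 d3 d4.
move: (nabla_J g al p fp x) (nabla_J g al p fp y) (nabla_J g al m fm x) (nabla_J g al m fm y) => D1 D2 D3 D4.
move: (al *m invmx g) (A *m invmx g) => v B.
rewrite !mxlin.
move: (v *m m *m D1) (v *m m *m D2) (v *m D3 *m p) (v *m D4 *m p) => e1 e2 e3 e4.
move: (x *m B *m m *m p) (y *m B *m m *m p) (x *m B) (y *m B) (v *m m *m p) => e5 e6 e7 e8 e9.
by apply/matrixP => i j; rewrite !mxE; ring.
Qed.

Section KahlerLocal.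
Context {R : realType} {U : set 'rV[R]_4} (oU : open U).
Context {G : 'rV[R]_4 -> 'M[R]_4} (sG : smooth_mx U G) (pG : forall u, U u -> posdef (G u)).
Context {Psi : 'rV[R]_4 -> 'M[R]_4} {Al : 'rV[R]_4 -> 'rV[R]_4}.
Hypotheses (sPsi : smooth_mx U Psi).
Hypothesis aPsi : forall u, U u -> (Psi u)^T = - Psi u.
Implicit Types (u : 'rV[R]_4) (k l a b c : 'I_4).
Local Notation e_ k := (delta_mx 0 k : 'rV[R]_4).
Local Notation Gam := (conn G).
Local Notation nabla := (covd G).
Hypothesis SK : forall k u, U u -> nabla k Psi u = wedge (Al u) (e_ k *m G u).
Variable sg : R.
Hypothesis s1 : sg * sg = 1.
Local Notation F := (norm_part G Psi sg).
Local Notation J := (J_part G Psi sg).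
Hypothesis U0 : forall u, U u -> 0 < F u.

#[local] Opaque norm_part J_part.
Let sJ : smooth_mx U J := smooth_J_part oU sG pG sPsi U0.
Let sF : smooth U F := smooth_norm_part oU sG pG sPsi U0.

Definition lie (X Y : 'rV[R]_4 -> 'rV[R]_4) u :=
  \sum_l (X u 0 l *: dmx l Y u - Y u 0 l *: dmx l X u).

Lemma lie_ncov X Y u : U u ->
  lie X Y u = \sum_l X u 0 l *: ncov G l Y u - \sum_l Y u 0 l *: ncov G l X u.
Proof. by move=> Uu; rewrite /lie (bracket_ncov oU pG) // sumrB. Qed.

(** Brackets are differences of covariant derivatives; those of the constant
    fields cancel because J squares to -1, and what remains is
    [nabla_J_nijenhuis]. *)
Lemma nijenhuis_local a b u : U u ->
  lie (fun w => e_ a *m J w) (fun w => e_ b *m J w) u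
  - lie (fun w => e_ a *m J w) (fun=> e_ b) u *m J u
  - lie (fun=> e_ a) (fun w => e_ b *m J w) u *m J u
  - lie (fun=> e_ a) (fun=> e_ b) u = 0.
Proof.
move=> Uu; pose n (x : 'rV[R]_4) c := \sum_l x 0 l *: ncov G l (fun=> e_ c) u.
have nJ (x : 'rV[R]_4) c : \sum_l x 0 l *: ncov G l (fun w => e_ c *m J w) u =
    n x c *m J u + e_ c *m nabla_J (G u) (Al u) (J u) (F u) x.
  rewrite /n mulmx_suml -(linear_sum_delta (@nabla_J_lin _ _ _ _ _)) mulmx_sumr -big_split /=.
  apply: eq_bigr => l _.
  rewrite (ncov_mul oU Uu (smooth_mx_cst _) sJ (dmx_J_part oU sG pG sPsi aPsi SK s1 U0 l Uu)).
  rewrite scalerDr [in RHS]mul_scalemx; congr (_ + _); symmetry; exact: mulmx_scale.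
pose D x := nabla_J (G u) (Al u) (J u) (F u) x.
have L1 : lie (fun w => e_ a *m J w) (fun w => e_ b *m J w) u =
    (n (e_ a *m J u) b *m J u + e_ b *m D (e_ a *m J u))
    - (n (e_ b *m J u) a *m J u + e_ a *m D (e_ b *m J u)).
  exact: etrans (lie_ncov _ _ Uu) (congr2 (fun x y => x - y) (nJ _ b) (nJ _ a)).
have L2 : lie (fun w => e_ a *m J w) (fun=> e_ b) u =
    n (e_ a *m J u) b - (n (e_ b) a *m J u + e_ a *m D (e_ b)).
  exact: etrans (lie_ncov _ _ Uu) (congr1 (fun y => n (e_ a *m J u) b - y) (nJ _ a)).
have L3 : lie (fun=> e_ a) (fun w => e_ b *m J w) u =
    (n (e_ a) b *m J u + e_ b *m D (e_ a)) - n (e_ b *m J u) a.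
  exact: etrans (lie_ncov _ _ Uu) (congr1 (fun y => y - n (e_ b *m J u) a) (nJ _ b)).
have L4 : lie (fun=> e_ a) (fun=> e_ b) u = n (e_ a) b - n (e_ b) a.
  exact: (lie_ncov _ _ Uu).
rewrite L1 L2 L3 L4.
have JJ := J_part_sqr pG aPsi s1 U0 Uu; have sk := J_part_skew pG aPsi sg Uu.
have N := nabla_J_nijenhuis (pG Uu) (Al u) JJ sk (U0 Uu) (e_ a) (e_ b).
have H x : x *m J u *m J u = - x := mulJJ JJ x.
move: N; rewrite -!/(D _).
clear L1 L2 L3 L4 nJ; clearbody D n.
move: (D (e_ a *m J u)) (D (e_ b *m J u)) (D (e_ a)) (D (e_ b)) => D1 D2 D3 D4.
rewrite !mulmxBl !mulmxDl !H.
move: (e_ b *m D1) (e_ a *m D2) (e_ a *m D4 *m J u) (e_ b *m D3 *m J u) => x1 x2 x3 x4.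
move: (n (e_ a *m J u) b *m J u) (n (e_ b *m J u) a *m J u) (n (e_ a) b) (n (e_ b) a) => n1 n2 n3 n4 N.
by rewrite -[RHS]N; apply/matrixP => i j; rewrite !mxE; ring.
Qed.

Definition kahler_form u : 'M[R]_4 := J u *m (F u ^- 2 *: G u).

Lemma kahler_form_antisym u : U u -> (kahler_form u)^T = - kahler_form u.
Proof.
move=> Uu; rewrite /kahler_form -scalemxAr [LHS]linearZ /= (J_part_skew pG aPsi sg Uu).
by rewrite scalerN.
Qed.

Lemma smooth_norm_part_inv2 : smooth U (fun w => F w ^- 2).
Proof.
apply: smoothV => //; last exact: smoothM.
by move=> w /U0 h; rewrite expf_neq0 // gt_eqF.
Qed.

Lemma smooth_kahler_form : smooth_mx U kahler_form.
Proof. by apply: (smooth_mxM oU) => //; apply: (smooth_mxZ oU) => //; exact: smooth_norm_part_inv2. Qed.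

Lemma partial_norm_part_inv2 k u : U u ->
  partial k (fun w => F w ^- 2) u = - 2 * F u ^- 3 * dnorm (G u) (Al u) (J u) (e_ k).
Proof.
move=> Uu; have F0 : F u != 0 by rewrite gt_eqF // U0.
have sFF := smoothM oU sF sF.
rewrite (partialV Uu _ (expf_neq0 2 F0) sFF) (partialM Uu _ sF sF).
rewrite (partial_norm_part oU sG pG sPsi aPsi SK s1 U0 k Uu) /dnorm.
by move: F0; move: (F u) (bil _ _ _) => f d f0; field.
Qed.

Lemma dmx_kahler_form a u : U u -> dmx a kahler_form u =
  F u ^- 2 *: (nabla_J (G u) (Al u) (J u) (F u) (e_ a) *m G u)
  - (2 * F u ^- 3 * dnorm (G u) (Al u) (J u) (e_ a)) *: (J u *m G u)
  + Gam a u *m kahler_form u + kahler_form u *m (Gam a u)^T.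
Proof.
move=> Uu.
have E w : kahler_form w = F w ^- 2 *: (J w *m G w) by rewrite /kahler_form scalemxAr.
have -> : dmx a kahler_form u = dmx a (fun w => F w ^- 2 *: (J w *m G w)) u.
  exact: (congr1 (fun f => dmx a f u) (funext E)).
rewrite E (dmxZ (Uu := Uu) a smooth_norm_part_inv2 (smooth_mxM oU sJ sG)) (partial_norm_part_inv2 a Uu).
rewrite (dmxM oU (Uu := Uu) a sJ sG) (conn_metric oU pG a Uu).
rewrite (dmx_J_part oU sG pG sPsi aPsi SK s1 U0 a Uu).
move: (F u ^- 3) (F u ^- 2) (G u) (J u) (Gam a u) (nabla_J _ _ _ _ _) (dnorm _ _ _ _) => c3 c2 g j ga D d.
rewrite !mxlin !mulmxA.
move: (D *m g) (ga *m j *m g) (j *m ga *m g) (j *m g *m ga^T) (j *m g) => x1 x2 x3 x4 x5.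
by apply/matrixP => i k; rewrite !mxE; ring.
Qed.

(** Write the partial derivatives of omega through its covariant derivative;
    the connection terms cancel in the cyclic sum by torsion-freeness, which
    leaves [nabla_J_closed]. *)
Lemma kahler_form_closed a b c u : U u ->
  partial a (fun w => kahler_form w b c) u + partial b (fun w => kahler_form w c a) u
  + partial c (fun w => kahler_form w a b) u = 0.
Proof.
move=> Uu.
have JJ := J_part_sqr pG aPsi s1 U0 Uu; have sk := J_part_skew pG aPsi sg Uu.
pose T x y z := bil (G u) (y *m nabla_J (G u) (Al u) (J u) (F u) x) z
   - 2 * (F u)^-1 * dnorm (G u) (Al u) (J u) x * bil (G u) (y *m J u) z.
have N : T (e_ a) (e_ b) (e_ c) + T (e_ b) (e_ c) (e_ a) + T (e_ c) (e_ a) (e_ b) = 0.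
  exact: (nabla_J_closed (pG Uu) (Al u) sk (U0 Uu) (e_ a) (e_ b) (e_ c)).
have F0 : F u != 0 by rewrite gt_eqF // U0.
pose S x y z := bil (kahler_form u) (e_ y *m Gam x u) (e_ z).
have SS x y z : S x y z = S y x z by rewrite /S (conn_sym oU pG).
have E x y z : partial x (fun w => kahler_form w y z) u = F u ^- 2 * T (e_ x) (e_ y) (e_ z) + S x y z - S x z y.
  transitivity (dmx x kahler_form u y z); first by rewrite mxE.
  rewrite dmx_kahler_form // -bil_delta !bilD bilN !bilZ (bil_mulr (Gam x u)) (bil_mull (nabla_J _ _ _ _ _) (G u)) (bil_mull (J u) (G u)) (bil_mull (Gam x u)).
  rewrite -[X in _ + X](bil_tr (kahler_form u)) kahler_form_antisym // bilN -/(S x z y) -/(S x y z) /T.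
  move: (bil (G u) _ _) (bil (G u) _ _) (dnorm _ _ _ _) (S x y z) (S x z y) => t1 t2 d q1 q2.
  by move: F0; move: (F u) => f f0; field.
clearbody T S; rewrite !E (SS b a c) (SS c b a) (SS c a b).
transitivity (F u ^- 2 * (T (e_ a) (e_ b) (e_ c) + T (e_ b) (e_ c) (e_ a) + T (e_ c) (e_ a) (e_ b))).
  move: (T (e_ a) (e_ b) (e_ c)) (T (e_ b) (e_ c) (e_ a)) (T (e_ c) (e_ a) (e_ b)) (S a b c) (S a c b) (S b c a) => t1 t2 t3 q1 q2 q3; ring.
by rewrite N mulr0.
Qed.

(** If f is constant along X, the Lie derivative of f^-2 g is f^-2 times that
    of g. *)
Lemma lie_conformal (X : 'rV[R]_4 -> 'rV[R]_4) a b u : U u ->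
  dnorm (G u) (Al u) (J u) (X u) = 0 ->
  \sum_l (X u 0 l * partial l (fun w => G w a b) u
          + partial a (fun w => X w 0 l) u * G u l b
          + partial b (fun w => X w 0 l) u * G u a l) = 0 ->
  \sum_l (X u 0 l * partial l (fun w => (F w ^- 2 *: G w) a b) u
          + partial a (fun w => X w 0 l) u * (F u ^- 2 *: G u) l b
          + partial b (fun w => X w 0 l) u * (F u ^- 2 *: G u) a l) = 0.
Proof.
move=> Uu d0 L.
have P l : partial l (fun w => (F w ^- 2 *: G w) a b) u =
    - 2 * F u ^- 3 * dnorm (G u) (Al u) (J u) (e_ l) * G u a b + F u ^- 2 * partial l (fun w => G w a b) u.
  transitivity (dmx l (fun w => F w ^- 2 *: G w) u a b); first by rewrite mxE.
  by rewrite (dmxZ (Uu := Uu) l smooth_norm_part_inv2 sG) (partial_norm_part_inv2 l Uu) !mxE.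
have D0 : \sum_l X u 0 l * dnorm (G u) (Al u) (J u) (e_ l) = 0.
  by rewrite -[RHS]d0; exact: (linear_sum_delta (V := R^o) (@dnorm_lin _ _ _ _)).
transitivity (- 2 * F u ^- 3 * G u a b * (\sum_l X u 0 l * dnorm (G u) (Al u) (J u) (e_ l))
   + F u ^- 2 * \sum_l (X u 0 l * partial l (fun w => G w a b) u
          + partial a (fun w => X w 0 l) u * G u l b
          + partial b (fun w => X w 0 l) u * G u a l)).
  rewrite !mulr_sumr -big_split; apply: eq_bigr => l _ /=.
  rewrite P [(_ *: G u) l b]mxE [(_ *: G u) a l]mxE.
  move: (dnorm _ _ _ _) (partial _ _ _) (partial _ _ _) (partial _ _ _) => t1 t2 t3 t4; ring.
by rewrite D0 L !mulr0 addr0.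
Qed.
End KahlerLocal.

Arguments kahler_form {R} G Psi sg u.
Arguments lie {R} X Y u.

(** * Killing equations and brackets in a chart *)

Section Main.
Context {R : realType} {U : set 'rV[R]_4} (oU : open U).
Context {G : 'rV[R]_4 -> 'M[R]_4} (sG : smooth_mx U G) (pG : forall u, U u -> posdef (G u)).
Context {Psi : 'rV[R]_4 -> 'M[R]_4} {Al : 'rV[R]_4 -> 'rV[R]_4}.
Hypotheses (sPsi : smooth_mx U Psi) (sAl : smooth_mx U Al).
Hypothesis aPsi : forall u, U u -> (Psi u)^T = - Psi u.
Implicit Types (u : 'rV[R]_4) (k l a b : 'I_4).
Local Notation e_ k := (delta_mx 0 k : 'rV[R]_4).
Local Notation nabla := (covd G).
Hypothesis SK : forall k u, U u -> nabla k Psi u = wedge (Al u) (e_ k *m G u).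
Local Notation fp := (norm_part G Psi 1).
Local Notation fm := (norm_part G Psi (-1)).
Local Notation Jp := (J_part G Psi 1).
Local Notation Jm := (J_part G Psi (-1)).
Hypothesis fp0 : forall u, U u -> 0 < fp u.
Hypothesis fm0 : forall u, U u -> 0 < fm u.
Hypothesis fpm : forall u, U u -> fp u <> fm u.
Local Notation A := (nabla_alpha G Al).
Local Notation K1 := (K1f G Al).
Local Notation K2 := (K2f G Psi Al).
#[local] Opaque norm_part J_part endo_part.

Let s1 : 1 * 1 = 1 :> R. Proof. exact: mulr1. Qed.
Let sN1 : -1 * -1 = 1 :> R. Proof. by ring. Qed.

Lemma dnorm_K u : U u -> [/\ dnorm (G u) (Al u) (Jp u) (K1 u) = 0, dnorm (G u) (Al u) (Jm u) (K1 u) = 0,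
   dnorm (G u) (Al u) (Jp u) (K2 u) = 0 & dnorm (G u) (Al u) (Jm u) (K2 u) = 0].
Proof.
move=> Uu; have [c _] := J_part_commute pG aPsi Uu.
have JJp := J_part_sqr pG aPsi s1 fp0 Uu; have skp := J_part_skew pG aPsi 1 Uu.
have JJm := J_part_sqr pG aPsi sN1 fm0 Uu; have skm := J_part_skew pG aPsi (-1) Uu.
have [h1 h2] := dnorm_K1 (pG Uu) (Al u) skp skm.
have [h3 h4] := dnorm_K2 (pG Uu) (Al u) JJp skp JJm skm c (fp := fp u) (fm := fm u).
by split.
Qed.

Lemma K_poisson u : U u -> bil (G u) (K1 u *m Jp u) (K2 u) = 0 /\ bil (G u) (K1 u *m Jm u) (K2 u) = 0.
Proof.
move=> Uu; have [c _] := J_part_commute pG aPsi Uu.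
have JJp := J_part_sqr pG aPsi s1 fp0 Uu; have skp := J_part_skew pG aPsi 1 Uu.
have JJm := J_part_sqr pG aPsi sN1 fm0 Uu; have skm := J_part_skew pG aPsi (-1) Uu.
exact: (poisson_K1_K2 (pG Uu) (Al u) JJp skp JJm skm c).
Qed.

Lemma K1_killing a b u : U u ->
  \sum_l (K1 u 0 l * partial l (fun w => G w a b) u
          + partial a (fun w => K1 w 0 l) u * G u l b
          + partial b (fun w => K1 w 0 l) u * G u a l) = 0.
Proof.
move=> Uu; rewrite (lie_metric oU pG) // !(ncov_K1 oU sG pG sAl) //.
have [aA _ _] := nabla_alpha_symmetries oU sG pG sPsi sAl aPsi SK fp0 fm0 fpm Uu.
exact: (nabla_K1_killing (pG Uu) aA).
Qed.

Lemma K2_killing a b u : U u ->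
  \sum_l (K2 u 0 l * partial l (fun w => G w a b) u
          + partial a (fun w => K2 w 0 l) u * G u l b
          + partial b (fun w => K2 w 0 l) u * G u a l) = 0.
Proof.
move=> Uu; rewrite (lie_metric oU pG) //.
have N k := ncov_K2 oU sG pG sPsi sAl aPsi SK fp0 fm0 k Uu.
rewrite !N.
have [c _] := J_part_commute pG aPsi Uu.
have JJp := J_part_sqr pG aPsi s1 fp0 Uu; have skp := J_part_skew pG aPsi 1 Uu.
have JJm := J_part_sqr pG aPsi sN1 fm0 Uu; have skm := J_part_skew pG aPsi (-1) Uu.
have [aA Ap Am] := nabla_alpha_symmetries oU sG pG sPsi sAl aPsi SK fp0 fm0 fpm Uu.
exact: (nabla_K2_killing (pG Uu) (Al u) skp skm c (fp0 Uu) (fm0 Uu) aA Ap Am).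
Qed.

Lemma K_bracket u : U u -> lie K1 K2 u = 0.
Proof.
move=> Uu; rewrite (lie_ncov oU pG) //.
have [c _] := J_part_commute pG aPsi Uu.
have JJp := J_part_sqr pG aPsi s1 fp0 Uu; have skp := J_part_skew pG aPsi 1 Uu.
have JJm := J_part_sqr pG aPsi sN1 fm0 Uu; have skm := J_part_skew pG aPsi (-1) Uu.
have [aA Ap Am] := nabla_alpha_symmetries oU sG pG sPsi sAl aPsi SK fp0 fm0 fpm Uu.
have E1 : \sum_l K1 u 0 l *: ncov G l K2 u =
    nabla_K2 (G u) (Al u) (Jp u) (Jm u) (fp u) (fm u) (A u) (K1 u).
  rewrite -(linear_sum_delta (@nabla_K2_lin _ _ _ _ _ _ _ _)); apply: eq_bigr => l _.
  by rewrite (ncov_K2 oU sG pG sPsi sAl aPsi SK fp0 fm0).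
have E2 : \sum_l K2 u 0 l *: ncov G l K1 u = nabla_K1 (G u) (A u) (K2 u).
  rewrite -(linear_sum_delta (@nabla_K1_lin _ _ _)); apply: eq_bigr => l _.
  by rewrite (ncov_K1 oU sG pG sAl).
have := nabla_K1_K2 (pG Uu) (Al u) skp skm c (fp0 Uu) (fm0 Uu) Ap Am.
by rewrite E1 E2 => ->; rewrite subrr.
Qed.

(** Raises the index in [partial_norm_part]; J is skew-symmetric, whence the
    change of sign. *)
Lemma grad_norm_part sg u : sg * sg = 1 -> (forall u, U u -> 0 < norm_part G Psi sg u) -> U u ->
  (\row_k partial k (norm_part G Psi sg) u) *m invmx (G u) =
  2^-1 *: (Al u *m invmx (G u) *m J_part G Psi sg u).
Proof.
move=> ss f0 Uu; apply: (ip_inj (pG Uu)) => z; have ug := posdef_unit (pG Uu).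
have sk := J_part_skew pG aPsi sg Uu.
have L x : bil (G u) ((\row_k partial k (norm_part G Psi sg) u) *m invmx (G u)) x
    = dnorm (G u) (Al u) (J_part G Psi sg u) x.
  rewrite -(linear_sum_delta (V := R^o) (@dnorm_lin _ _ _ _)).
  rewrite /bil mulmxKV // mxE; apply: eq_bigr => k _.
  by rewrite !mxE mulrC; congr (_ * _); exact: (partial_norm_part oU sG pG sPsi aPsi SK ss f0).
by rewrite L /dnorm bilZl (ipJ (pG Uu) sk); ring.
Qed.
End Main.

(** * Change of charts *)

Section Congruence.
Context {R : realType} {g g' P : 'M[R]_4} (pg : posdef g) (pg' : posdef g').
Hypotheses (gE : g' = P *m g *m P^T) (P0 : 0 < \det P).

Let uP : P \in unitmx. Proof. by rewrite unitmxE unitfE gt_eqF. Qed.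

(** The square root of det g' is |det P| times that of det g, whereas the dual
    changes by det P; the two factors cancel since det P is positive. *)
Lemma star_congr phi : phi^T = - phi ->
  star g' (P *m phi *m P^T) = P *m star g phi *m P^T.
Proof.
move=> aphi; rewrite (star_inv pg') ?congr_antisym // (star_inv pg) //.
have -> : Num.sqrt (\det g') = \det P * Num.sqrt (\det g).
  rewrite gE !det_mulmx det_tr mulrAC -expr2 sqrtrM ?sqr_ge0 //.
  by rewrite sqrtr_sqr gtr0_norm.
have E : g' *m dual (P *m phi *m P^T) *m g' = \det P *: (P *m (g *m dual phi *m g) *m P^T).
  have := congr1 (fun X => P *m g *m X *m g *m P^T) (dual_congr P aphi).
  rewrite /= -scalemxAr -!scalemxAl {1 2}gE !mulmxA => ->.
  by [].
rewrite E -scalemxAr -scalemxAl scalerA invfM; congr (_ *: _).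
by rewrite mulrAC mulVf ?mul1r // gt_eqF.
Qed.

Lemma dual_part_congr sg phi : phi^T = - phi ->
  dual_part g' sg (P *m phi *m P^T) = P *m dual_part g sg phi *m P^T.
Proof.
by move=> aphi; rewrite /dual_part star_congr //; move: (star g phi) => S; rewrite !mxlin.
Qed.

Lemma inv_congr : P^T *m invmx g' *m P = invmx g.
Proof.
have ug := posdef_unit pg; have ug' := posdef_unit pg'.
have E : g' *m (invmx P^T *m invmx g *m invmx P) = 1%:M.
  by rewrite gE !mulmxA mulmxK ?unitmx_tr // mulmxK // mulmxV.
have -> : invmx g' = invmx P^T *m invmx g *m invmx P.
  by rewrite -[LHS]mulmx1 -E mulKmx.
by rewrite !mulmxA mulmxV ?unitmx_tr // mul1mx mulmxKV.
Qed.

Lemma raise_congr phi : raise g' (P *m phi *m P^T) *m P = P *m raise g phi.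
Proof. by rewrite /raise -!mulmxA (mulmxA P^T) inv_congr. Qed.

Lemma tr_congr (B B' : 'M[R]_4) : B' *m P = P *m B -> \tr (B' *m B') = \tr (B *m B).
Proof.
move=> E; have -> : B' = P *m B *m invmx P by rewrite -E mulmxK.
by rewrite -!mulmxA mulKmx // mxtrace_mulC -!mulmxA mulVmx // mulmx1.
Qed.
End Congruence.

Section Charts.
Context {R : realType} {M : topologicalType} {A : oriented_atlas R M}.
Implicit Types (i j : chart A) (p q : M) (Om : set M) (u w : 'rV[R]_4).

Definition img i Om : set 'rV[R]_4 := coord i @` (dom i `&` Om).

Lemma img_coord i Om p : dom i p -> Om p -> img i Om (coord i p).
Proof. by move=> ip Op; exists p. Qed.

Lemma imgP i Om u : img i Om u -> [/\ dom i (param i u), Om (param i u) & coord i (param i u) = u].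
Proof. by move=> [p [ip Op] <-]; rewrite coordK. Qed.

Lemma img_sub i Om Om' : Om `<=` Om' -> img i Om `<=` img i Om'.
Proof. by move=> S u [p [ip Op] <-]; exists p => //; split=> //; exact: S. Qed.

(** The inverse of a chart is continuous on the open image of the chart. *)
Lemma open_img i Om : open Om -> open (img i Om).
Proof.
move=> oO; have oI : open (coord i @` dom i) by exact: img_open.
rewrite openE => u iu; have [d o c] := imgP iu.
have Iu : (coord i @` dom i) u by exists (param i u).
have n1 : nbhs u (coord i @` dom i) by exact: open_nbhs_nbhs.
have n2 : nbhs u (param i @^-1` Om).
  by apply: (param_continuous Iu); exact: open_nbhs_nbhs.
apply: filterS (filterI n1 n2) => w [[q iq qw] /=].
by rewrite -qw coordK // => Oq; exists q.
Qed.

(** A tensor field read in a chart, as a function on R^4. *)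
Definition loc (V : Type) (T : field A V) i : 'rV[R]_4 -> V := fun u => T i (param i u).

Lemma locE V (T : field A V) i p : dom i p -> loc T i (coord i p) = T i p.
Proof. by move=> ip; rewrite /loc coordK. Qed.

Lemma smooth_loc m n (T : field A 'M[R]_(m, n)) i Om : open Om ->
  smooth_field [set: M] T -> smooth_mx (img i Om) (loc T i).
Proof.
move=> oO sT a b; apply: smooth_sub (sT i a b).
by apply: img_sub.
Qed.

Lemma hodgeE (g psi : field A 'M[R]_4) i p : hodge g psi i p = star (g i p) (psi i p).
Proof.
apply/matrixP => a b; rewrite /hodge /star /dual -lock !mxE.
by rewrite mulrA [Num.sqrt _ * _]mulrC.
Qed.

(** psi_+ for sg = 1 and psi_- for sg = -1, so that both halves are treated at
    once. *)
Definition phi_part (g psi : field A 'M[R]_4) (sg : R) : field A 'M[R]_4 :=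
  fun i p => dual_part (g i p) sg (psi i p).

Lemma sd_partE (g psi : field A 'M[R]_4) : sd_part g psi = phi_part g psi 1.
Proof.
apply/funext => i; apply/funext => p.
by rewrite /sd_part /phi_part /dual_part hodgeE scale1r.
Qed.

Lemma asd_partE (g psi : field A 'M[R]_4) : asd_part g psi = phi_part g psi (-1).
Proof.
apply/funext => i; apply/funext => p.
by rewrite /asd_part /phi_part /dual_part hodgeE scaleN1r.
Qed.

Lemma jac_det i j p : dom i p -> dom j p -> 0 < \det (jac i j p).
Proof. by move=> ip jp; have := transition_oriented ip jp; congr (0 < \det _); apply/matrixP => a b; rewrite !mxE. Qed.

Lemma cov_deriv_covd (g B : field A 'M[R]_4) i p k : dom i p ->
  cov_deriv g B i p (delta_mx 0 k) = covd (loc g i) k (loc B i) (coord i p).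
Proof.
move=> ip; rewrite /cov_deriv (bigD1 k) //= big1 ?addr0; last first.
  by move=> l lk; rewrite mxE (negbTE lk) andbF scale0r.
rewrite mxE !eqxx scale1r; apply/matrixP => a b.
rewrite /covd !mxE; congr (_ - _ - _).
  by apply: eq_bigr => l _; rewrite !mxE /christoffel !locE.
by apply: eq_bigr => l _; rewrite !mxE /christoffel !locE // mulrC.
Qed.
End Charts.

(** * Norms, complex structures and gradients on the manifold *)

Section Global.
Context {R : realType} {M : topologicalType} {A : oriented_atlas R M}.
Context {g : field A 'M[R]_4} (g_metric : riemannian_metric [set: M] g).
Context {psi : field A 'M[R]_4} (psi_form : two_form [set: M] psi).
Context {alpha : field A 'rV[R]_4} (alpha_form : one_form [set: M] alpha).
Hypothesis sk : star_killing g psi alpha.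
Implicit Types (i j : chart A) (p q : M) (Om : set M) (u w : 'rV[R]_4).

Local Notation phi := (phi_part g psi).
Local Notation F sg := (ff g (phi sg)).
Local Notation J sg := (ak_J g (phi sg)).

Lemma g_posdef i p : dom i p -> posdef (g i p).
Proof. by move=> ip; case: g_metric => _ gT gP; split; [exact: gT | exact: gP]. Qed.

Lemma psi_antisym i p : dom i p -> (psi i p)^T = - psi i p.
Proof. by move=> ip; case: psi_form => _; exact. Qed.

Lemma g_law i j p : dom i p -> dom j p -> g i p = jac i j p *m g j p *m (jac i j p)^T.
Proof. by case: g_metric => [[_ L] _ _]; exact: L. Qed.

Lemma psi_law i j p : dom i p -> dom j p -> psi i p = jac i j p *m psi j p *m (jac i j p)^T.
Proof. by case: psi_form => [[_ L] _]; exact: L. Qed.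

Lemma alpha_law i j p : dom i p -> dom j p -> alpha i p = alpha j p *m (jac i j p)^T.
Proof. by case: alpha_form => [_ L]; exact: L. Qed.

Lemma phi_law sg i j p : dom i p -> dom j p ->
  phi sg i p = jac i j p *m phi sg j p *m (jac i j p)^T.
Proof.
move=> ip jp; rewrite /phi_part (psi_law ip jp).
rewrite (dual_part_congr (g_posdef jp) (g_posdef ip) (g_law ip jp)) ?jac_det //.
exact: psi_antisym.
Qed.

Lemma endo_law sg i j p : dom i p -> dom j p ->
  jac i j p *m endo_of g (phi sg) j p = endo_of g (phi sg) i p *m jac i j p.
Proof.
move=> ip jp; rewrite /endo_of (phi_law sg ip jp) -!/(raise _ _).
by rewrite (raise_congr (g_posdef jp) (g_posdef ip) (g_law ip jp)) ?jac_det.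
Qed.

(** The norm is defined through a preferred chart around each point; any chart
    may be used because conjugate endomorphisms have squares of equal trace. *)
Lemma ff_dom sg i p : dom i p ->
  F sg p = Num.sqrt (- 2^-1 * \tr (endo_of g (phi sg) i p *m endo_of g (phi sg) i p)) / Num.sqrt 2.
Proof.
move=> ip; rewrite /ff /endo_norm; congr (Num.sqrt (_ * _) / _).
have cp := dom_chart_at A p.
exact: (tr_congr (jac_det cp ip) (esym (endo_law sg cp ip))).
Qed.

Lemma ff_loc sg i u : dom i (param i u) -> F sg (param i u) = norm_part (loc g i) (loc psi i) sg u.
Proof. by move=> iu; rewrite (ff_dom sg iu). Qed.

Lemma J_loc sg i u : dom i (param i u) -> J sg i (param i u) = J_part (loc g i) (loc psi i) sg u.
Proof. by move=> iu; rewrite /ak_J /scale_field (ff_loc sg iu). Qed.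

Section local_facts.
Variables (i : chart A) (Om : set M).
Hypothesis oO : open Om.
Local Notation U := (img i Om).

Lemma smooth_loc_g : smooth_mx U (loc g i).
Proof. by apply: smooth_loc => //; case: g_metric => [[]]. Qed.
Lemma smooth_loc_psi : smooth_mx U (loc psi i).
Proof. by apply: smooth_loc => //; case: psi_form => [[]]. Qed.
Lemma smooth_loc_alpha : smooth_mx U (loc alpha i).
Proof. by apply: smooth_loc => //; case: alpha_form. Qed.
Lemma loc_g_posdef u : U u -> posdef (loc g i u).
Proof. by move=> /imgP[iu _ _]; exact: g_posdef. Qed.
Lemma loc_psi_antisym u : U u -> (loc psi i u)^T = - loc psi i u.
Proof. by move=> /imgP[iu _ _]; exact: psi_antisym. Qed.
Lemma loc_star_killing k u : U u ->
  covd (loc g i) k (loc psi i) u = wedge (loc alpha i u) (delta_mx 0 k *m loc g i u).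
Proof.
move=> /imgP[iu _ cu]; rewrite -{1}cu -cov_deriv_covd //; exact: sk.
Qed.
End local_facts.

(** Needed on the whole manifold, where the norms may vanish and need not be
    smooth, to know that the regular set is open. *)
Lemma ff_continuous sg : continuous (F sg).
Proof.
move=> p; set i := chart_at A p; have ip : dom i p by exact: dom_chart_at.
have oT : open [set: M] by exact: openT.
(* T is smooth although its square root need not be. *)
pose T w := \tr (endo_part (loc g i) (loc psi i) sg w *m endo_part (loc g i) (loc psi i) sg w).
have sB := smooth_endo_part (open_img (i := i) oT) (smooth_loc_g i oT) (@loc_g_posdef i setT) (smooth_loc_psi i oT) sg.
have sT : smooth (img i setT) T.
  by apply: smooth_trace; [exact: (open_img (i := i) oT) | apply: smooth_mxM => //; exact: (open_img (i := i) oT)].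
have cT : {for coord i p, continuous T} by apply: smooth_continuous sT _; exact: img_coord.
have cN : {for coord i p, continuous (norm_part (loc g i) (loc psi i) sg)}.
  apply: continuousM; last exact: cst_continuous.
  apply: continuous_comp; last exact: sqrt_continuous.
  by apply: continuousM => //; exact: cst_continuous.
have cC : {for p, continuous (norm_part (loc g i) (loc psi i) sg \o coord i)}.
  exact: continuous_comp (Defs.coord_continuous ip) cN.
have E q : dom i q -> (norm_part (loc g i) (loc psi i) sg \o coord i) q = F sg q.
  by move=> iq /=; rewrite -(ff_loc sg) coordK.
change (F sg @ p --> F sg p); rewrite -(E _ ip).
apply: cvg_trans cC; apply: near_eq_cvg.
have : nbhs p (dom i) by apply: open_nbhs_nbhs; split=> //; exact: dom_open.
by apply: filterS => q /E.
Qed.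

(** The open set M_1 on which the two fields are studied. *)
Definition regular_set : set M := [set p | 0 < F 1 p /\ 0 < F (-1) p] `&` [set p | F 1 p <> F (-1) p].

Lemma open_regular_set : open regular_set.
Proof.
have C sg := ff_continuous sg.
have P sg : open [set p | 0 < F sg p].
  by apply: (@open_comp _ _ (F sg) [set x | 0 < x]) => [x _|]; [exact: C | exact: open_gt].
apply: openI; first by apply: openI; exact: P.
have -> : [set p | F 1 p <> F (-1) p] = (fun p => F 1 p - F (-1) p) @^-1` [set x | x != 0].
  apply/seteqP; split => p /=; first by move=> h; rewrite subr_eq0; apply/eqP.
  by rewrite subr_eq0 => /eqP.
apply: open_comp => [x _|]; last exact: open_neq.
by apply: continuousB; exact: C.
Qed.

Section Functions.
Variable Om : set M.
Hypothesis oO : open Om.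
Implicit Types (f h : M -> R).

Lemma smooth_fun_cst (c : R) : smooth_fun (A := A) Om (fun=> c).
Proof. move=> i; exact: smooth_cst. Qed.

Lemma smooth_funD f h : smooth_fun (A := A) Om f -> smooth_fun (A := A) Om h ->
  smooth_fun (A := A) Om (fun p => f p + h p).
Proof. by move=> sf sh i; apply: (smoothD (open_img (i := i) oO) (sf i) (sh i)). Qed.

Lemma smooth_funM f h : smooth_fun (A := A) Om f -> smooth_fun (A := A) Om h ->
  smooth_fun (A := A) Om (fun p => f p * h p).
Proof. by move=> sf sh i; apply: (smoothM (open_img (i := i) oO) (sf i) (sh i)). Qed.

Lemma smooth_funV f : (forall p, Om p -> f p != 0) -> smooth_fun (A := A) Om f ->
  smooth_fun (A := A) Om (fun p => (f p)^-1).
Proof.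
move=> nz sf i; apply: (smoothV (open_img (i := i) oO) _ (sf i)) => u /imgP[_ Ou _]; exact: nz.
Qed.

Section at_p.
Context {i : chart A} {p : M} (ip : dom i p) (Op : Om p).
Let Up := img_coord ip Op.

Lemma differentialD f h : smooth_fun (A := A) Om f -> smooth_fun (A := A) Om h ->
  differential (fun p => f p + h p) i p = differential f i p + differential h i p.
Proof.
by move=> sf sh; apply/rowP => k; rewrite !mxE; exact: (partialD Up k (sf i) (sh i)).
Qed.

Lemma differentialM f h : smooth_fun (A := A) Om f -> smooth_fun (A := A) Om h ->
  differential (fun p => f p * h p) i p = h p *: differential f i p + f p *: differential h i p.
Proof.
move=> sf sh; apply/rowP => k; rewrite !mxE.
have := partialM Up k (sf i) (sh i); rewrite /= coordK // => E.
by rewrite [LHS]E mulrC.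
Qed.

Lemma differentialZ c f : smooth_fun (A := A) Om f ->
  differential (fun p => c * f p) i p = c *: differential f i p.
Proof.
by move=> sf; apply/rowP => k; rewrite !mxE; exact: (partialZ Up k c (sf i)).
Qed.

Lemma differentialV f : f p != 0 -> smooth_fun (A := A) Om f ->
  differential (fun p => (f p)^-1) i p = - f p ^- 2 *: differential f i p.
Proof.
move=> nz sf; apply/rowP => k; rewrite !mxE.
have := partialV Up k _ (sf i); rewrite /= coordK // => E; exact: E.
Qed.
End at_p.
End Functions.

Section Domain.
Variable Om : set M.
Hypotheses (oO : open Om) (sO : Om `<=` regular_set).

Lemma F_gt0 sg p : sg * sg = 1 -> Om p -> 0 < F sg p.
Proof.
move=> ss /sO[[h1 h2] _].
have /eqP : (sg - 1) * (sg + 1) = 0.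
  have -> : (sg - 1) * (sg + 1) = sg * sg - 1 by ring.
  by rewrite ss subrr.
by rewrite mulf_eq0 subr_eq0 addr_eq0 => /orP[/eqP -> //|/eqP ->].
Qed.

Lemma F_neq p : Om p -> F 1 p <> F (-1) p.
Proof. by move=> /sO[_]. Qed.

Lemma norm_part_gt0 i sg : sg * sg = 1 -> forall u, img i Om u -> 0 < norm_part (loc g i) (loc psi i) sg u.
Proof. by move=> ss u /imgP[iu Ou _]; rewrite -(ff_loc sg iu) F_gt0. Qed.

Lemma norm_part_neq i u : img i Om u ->
  norm_part (loc g i) (loc psi i) 1 u <> norm_part (loc g i) (loc psi i) (-1) u.
Proof. by move=> /imgP[iu Ou _]; rewrite -!(ff_loc _ iu); exact: F_neq. Qed.

Lemma smooth_ff sg : sg * sg = 1 -> smooth_fun (A := A) Om (F sg).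
Proof.
move=> ss i; have S := smooth_norm_part (open_img (i := i) oO) (smooth_loc_g i oO) (@loc_g_posdef i Om) (smooth_loc_psi i oO) (norm_part_gt0 ss).
apply: (smooth_ext (open_img (i := i) oO) _ S) => u /imgP[iu _ _].
exact: esym (ff_loc sg iu).
Qed.

Lemma smooth_ak_J sg : sg * sg = 1 -> smooth_field Om (J sg).
Proof.
move=> ss i a b.
have S := smooth_J_part (open_img (i := i) oO) (smooth_loc_g i oO) (@loc_g_posdef i Om) (smooth_loc_psi i oO) (norm_part_gt0 ss).
apply: (smooth_ext (open_img (i := i) oO) _ (S a b)) => u /imgP[iu _ _].
by rewrite -(J_loc sg iu).
Qed.

Section at_point.
Context {i : chart A} {p : M} (ip : dom i p) (Op : Om p).
Let Up : img i Om (coord i p) := img_coord ip Op.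

Lemma J_locp sg : J_part (loc g i) (loc psi i) sg (coord i p) = J sg i p.
Proof. by rewrite -(J_loc sg) coordK. Qed.

Lemma J_sqr_p sg : sg * sg = 1 -> J sg i p *m J sg i p = - 1%:M.
Proof.
move=> ss; have := J_part_sqr (@loc_g_posdef i Om) (@loc_psi_antisym i Om) ss (norm_part_gt0 ss) Up.
by rewrite J_locp.
Qed.

Lemma J_skew_p sg : (J sg i p *m g i p)^T = - (J sg i p *m g i p).
Proof.
by have := J_part_skew (@loc_g_posdef i Om) (@loc_psi_antisym i Om) sg Up; rewrite J_locp locE.
Qed.

Lemma J_comm_p : J 1 i p *m J (-1) i p = J (-1) i p *m J 1 i p.
Proof. by have [] := J_part_commute (@loc_g_posdef i Om) (@loc_psi_antisym i Om) Up; rewrite !J_locp. Qed.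

Local Notation v := (alpha i p *m invmx (g i p)).

(** [grad_norm_part] at a point of the manifold. *)
Lemma grad_ff sg : sg * sg = 1 -> grad g (F sg) i p = 2^-1 *: (v *m J sg i p).
Proof.
move=> ss; have E := grad_norm_part (open_img oO) (smooth_loc_g i oO) (@loc_g_posdef i Om) (smooth_loc_psi i oO) (@loc_psi_antisym i Om)
  (fun k => @loc_star_killing i Om k) ss (norm_part_gt0 ss) Up.
have D : differential (F sg) i p = \row_k partial k (norm_part (loc g i) (loc psi i) sg) (coord i p).
  apply/rowP => k; rewrite [LHS]mxE [RHS]mxE; apply: partial_ext (open_img oO) Up _ => w /imgP[iw _ _].
  exact: ff_loc.
rewrite J_locp (locE g ip) (locE alpha ip) in E.
by rewrite -E /grad /sharp D.
Qed.
End at_point.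

Definition K1_field : field A 'rV[R]_4 := fun i p => K1v (g i p) (alpha i p).
Definition K2_field : field A 'rV[R]_4 := fun i p =>
  K2v (g i p) (alpha i p) (J 1 i p) (J (-1) i p) (F 1 p) (F (-1) p).

Lemma K1_loc i u : loc K1_field i u = K1f (loc g i) (loc alpha i) u.
Proof. by []. Qed.

Lemma K2_loc i u : img i Om u -> loc K2_field i u = K2f (loc g i) (loc psi i) (loc alpha i) u.
Proof. by move=> /imgP[iu _ _]; rewrite /loc /K2_field /K2f !(ff_loc _ iu) !(J_loc _ iu). Qed.
End Domain.
End Global.

(** * Orientation of complex frames *)

Section Orientation.
Context {R : realType} {g : 'M[R]_4} (pg : posdef g).
Context {J : 'M[R]_4}.
Hypothesis JJ : J *m J = - 1%:M.
Hypothesis sJ : (J *m g)^T = - (J *m g).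
Local Notation ip := (bil g).
Implicit Types (X Y : 'rV[R]_4).

Lemma complex_frame_rows X Y : let C := complex_frame J X Y in
  [/\ row o0 C = X, row o1 C = X *m J, row o2 C = Y & row o3 C = Y *m J].
Proof.
move=> C.
have e0 : o0 = @lshift (1 + 1) (1 + 1) (@lshift 1 1 0) by exact: val_inj.
have e1 : o1 = @lshift (1 + 1) (1 + 1) (@rshift 1 1 0) by exact: val_inj.
have e2 : o2 = @rshift (1 + 1) (1 + 1) (@lshift 1 1 0) by exact: val_inj.
have e3 : o3 = @rshift (1 + 1) (1 + 1) (@rshift 1 1 0) by exact: val_inj.
split; apply/rowP => j; rewrite mxE /C /complex_frame.
- rewrite e0; exact: etrans (@col_mxEu R 2 2 4 _ _ _ _) (@col_mxEu R 1 1 4 _ _ _ _).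
- rewrite e1; exact: etrans (@col_mxEu R 2 2 4 _ _ _ _) (@col_mxEd R 1 1 4 _ _ _ _).
- rewrite e2; exact: etrans (@col_mxEd R 2 2 4 _ _ _ _) (@col_mxEu R 1 1 4 _ _ _ _).
- rewrite e3; exact: etrans (@col_mxEd R 2 2 4 _ _ _ _) (@col_mxEd R 1 1 4 _ _ _ _).
Qed.

(** Bessel's inequality: X and X J are orthogonal and have equal norms, and the
    projection of Y on the plane they span is not longer than Y. *)
Lemma bessel X Y : 0 <= ip X X * ip Y Y - ip (X *m J) Y ^+ 2 - ip X Y ^+ 2.
Proof.
have [->|X0] := eqVneq X 0; first by rewrite mul0mx !bil0l expr0n /= mul0r !subr0.
have n0 := ip_gt0 pg X0; set n := ip X X in n0 *.
set q := ip (X *m J) Y; set r := ip X Y.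
pose Z := Y - (r / n) *: X - (q / n) *: (X *m J).
have ZZ : 0 <= ip Z Z.
  have [->|/(ip_gt0 pg)/ltW //] := eqVneq Z 0; by rewrite bil0l.
have E : ip Z Z = ip Y Y - (r ^+ 2 + q ^+ 2) / n.
  rewrite /Z !bilE (ipC pg Y X) (ipC pg Y (X *m J)) (ipJJ pg JJ sJ) -/n -/q -/r.
  have -> : ip (X *m J) X = 0 by rewrite (ipC pg) (ipxJ pg sJ).
  rewrite (ipxJ pg sJ); field; by rewrite gt_eqF.
rewrite E in ZZ; have := mulr_ge0 (ltW n0) ZZ.
have -> : n * (ip Y Y - (r ^+ 2 + q ^+ 2) / n) = n * ip Y Y - (r ^+ 2 + q ^+ 2).
  by field; rewrite gt_eqF.
by move=> h; lra.
Qed.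

(** With w = J g and C the frame (X, JX, Y, JY), the Pfaffian of C w C^T is
    det C times that of w.  The latter has the sign of sg since w is an
    eigenvector of the star, and the former is nonnegative by [bessel]. *)
Lemma complex_frame_det sg X Y : sg * sg = 1 -> star g (J *m g) = sg *: (J *m g) ->
  \det (complex_frame J X Y) != 0 -> 0 < sg * \det (complex_frame J X Y).
Proof.
move=> s1 sw d0; set C := complex_frame J X Y in d0 *.
have [r0 r1 r2 r3] := complex_frame_rows X Y; rewrite -/C in r0 r1 r2 r3.
set w := J *m g in sw *; have sW : w^T = - w := sJ; have ug := posdef_unit pg.
set s := Num.sqrt (\det g); have sp : 0 < s by rewrite sqrtr_gt0 posdef_det.
have Dw : dual w = (sg * s) *: (invmx g *m w *m invmx g).
  have := star_inv pg sW; rewrite sw -/s => H.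
  have E1 : g *m dual w *m g = (sg * s) *: w.
    by rewrite mulrC -scalerA H scalerA divff ?scale1r // gt_eqF.
  have <- : invmx g *m (g *m dual w *m g) *m invmx g = dual w.
    by rewrite !mulmxA mulVmx // mul1mx mulmxK.
  by rewrite E1 -scalemxAr -scalemxAl.
have pw : wedge_coef w w = 2 * (sg * s).
  have := mul_dual sW sW.
  have -> : w *m dual w = (- (sg * s))%:M.
    have wg : w *m invmx g = J by rewrite /w mulmxK.
    have A4 (a b : 'M[R]_4) : a *m (b *m a *m b) = (a *m b) *m (a *m b) by rewrite !mulmxA.
    rewrite Dw -scalemxAr A4 wg JJ.
    by rewrite scalerN -scaleNr scale_scalar_mx mulr1.
  move/matrixP/(_ 0 0); rewrite !mxE eqxx !mulr1n => h; lra.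
pose N := C *m w *m C^T.
have aN : N^T = - N by exact: congr_antisym.
have pN : wedge_coef N N = \det C * wedge_coef w w.
  have uC : C \in unitmx by rewrite unitmxE unitfE.
  have E : N *m dual N *m C = \det C *: (C *m (w *m dual w)).
    have gen (a b D D' : 'M[R]_4) c : a^T *m D *m a = c *: D' ->
        a *m b *m a^T *m D *m a = c *: (a *m (b *m D')).
      by move=> H; rewrite -!mulmxA (mulmxA a^T) H -!scalemxAr.
    exact: gen (dual_congr C sW).
  have half (A : 'M[R]_4) : A^T = - A -> A *m dual A = (- (2^-1 * wedge_coef A A))%:M.
    move=> aA; have := mul_dual aA aA; rewrite -mulr2n -scaler_nat => /(congr1 (fun M => 2^-1 *: M)).
    by rewrite scalerA mulVf ?pnatr_eq0 // scale1r scale_scalar_mx mulrN.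
  move: E; rewrite !half // mul_scalar_mx mul_mx_scalar scalerA => E.
  have := congr1 (fun M => (M *m invmx C) 0 0) E.
  rewrite /= -!scalemxAl mulmxV // !mxE eqxx !mulr1 => h; lra.
have NE a b : N a b = ip (row a C *m J) (row b C).
  by rewrite -bil_mull -/w -bil_delta /N (bil_mulr C) bil_mull -!rowE.
have pfN : wedge_coef N N = 2 * (ip X X * ip Y Y - ip (X *m J) Y ^+ 2 - ip X Y ^+ 2).
  rewrite /wedge_coef !NE r0 r1 r2 r3 !(ipJJ pg JJ sJ) !(mulJJ JJ) !bilNl.
  by rewrite (ipJ pg sJ X Y); ring.
have := bessel X Y; move: pN; rewrite pfN pw.
set B := _ - _ - _ => E B0.
have E' : s * (sg * \det C) = B by lra.
have : 0 <= sg * \det C by rewrite -(pmulr_rge0 _ sp) E'.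
rewrite le_eqVlt => /orP[|//]; rewrite eq_sym mulf_eq0 (negbTE d0) orbF => /eqP sg0.
by move: s1; rewrite sg0 mul0r => /eqP; rewrite eq_sym oner_eq0.
Qed.
End Orientation.

(** * Local expressions and momenta *)

Section Transfer.
Context {R : realType} {M : topologicalType} {A : oriented_atlas R M}.
Implicit Types (i j : chart A) (p q : M) (Om : set M) (u w : 'rV[R]_4).

Lemma bracket_lie (X Y : field A 'rV[R]_4) i p : dom i p ->
  bracket X Y i p = lie (loc X i) (loc Y i) (coord i p).
Proof.
move=> ip; apply/rowP => c; rewrite [LHS]mxE /lie summxE; apply: eq_bigr => l _.
by rewrite (locE X ip) (locE Y ip) !mxE.
Qed.

Lemma lie_ext (U : set 'rV[R]_4) (X X' Y Y' : 'rV[R]_4 -> 'rV[R]_4) u : open U -> U u ->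
  (forall w, U w -> X w = X' w) -> (forall w, U w -> Y w = Y' w) -> lie X Y u = lie X' Y' u.
Proof.
move=> oU Uu EX EY; rewrite /lie; apply: eq_bigr => l _.
by rewrite (dmx_ext oU (Uu := Uu) l EX) (dmx_ext oU (Uu := Uu) l EY) EX // EY.
Qed.

(** The Killing equation on the manifold is the one for local expressions of
    the metric and the field. *)
Lemma killing_transfer Om (h : field A 'M[R]_4) (K : field A 'rV[R]_4) i p
   (H : 'rV[R]_4 -> 'M[R]_4) (Kf : 'rV[R]_4 -> 'rV[R]_4) a b :
  open Om -> dom i p -> Om p ->
  (forall u, img i Om u -> loc h i u = H u) -> (forall u, img i Om u -> loc K i u = Kf u) ->
  \sum_l (Kf (coord i p) 0 l * partial l (fun w => H w a b) (coord i p)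
          + partial a (fun w => Kf w 0 l) (coord i p) * H (coord i p) l b
          + partial b (fun w => Kf w 0 l) (coord i p) * H (coord i p) a l) = 0 ->
  \sum_l (K i p 0 l * pd i l (fun q => h i q a b) p
          + pd i a (fun q => K i q 0 l) p * h i p l b
          + pd i b (fun q => K i q 0 l) p * h i p a l) = 0.
Proof.
move=> oO ip Op EH EK E; rewrite -[RHS]E; have Up := img_coord ip Op.
have oU := open_img (i := i) oO.
have PH l : pd i l (fun q => h i q a b) p = partial l (fun w => H w a b) (coord i p).
  by apply: partial_ext oU Up _ => w Uw; rewrite -EH.
have PK c l : pd i c (fun q => K i q 0 l) p = partial c (fun w => Kf w 0 l) (coord i p).
  by apply: partial_ext oU Up _ => w Uw; rewrite -EK.
apply: eq_bigr => l _; rewrite PH !PK -EH // -EK //.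
by rewrite (locE h ip) (locE K ip).
Qed.

Lemma eq_field_sym V Om (T T' : field A V) : eq_field Om T T' -> eq_field Om T' T.
Proof. by move=> E i p Op ip; rewrite E. Qed.

Lemma eq_field_trans V Om (T T' T'' : field A V) :
  eq_field Om T T' -> eq_field Om T' T'' -> eq_field Om T T''.
Proof. by move=> E E' i p Op ip; rewrite E // E'. Qed.

Lemma smooth_field_loc m n Om (T : field A 'M[R]_(m, n)) :
  (forall i, smooth_mx (img i Om) (loc T i)) -> smooth_field Om T.
Proof. by move=> H i a b; exact: (H i a b). Qed.

Lemma vector_field_ext Om (K K' : field A 'rV[R]_4) : open Om -> eq_field Om K K' ->
  vector_field Om K -> vector_field Om K'.
Proof.
move=> oO E [S L]; split.
  move=> i a b; apply: smooth_ext (S i a b); first exact: open_img.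
  by move=> w /imgP[iw Ow _] /=; rewrite E.
by move=> i j p Op ip jp; rewrite -!E //; exact: L.
Qed.

Lemma killing_ext Om (h : field A 'M[R]_4) (K K' : field A 'rV[R]_4) : open Om -> eq_field Om K K' ->
  killing Om h K -> killing Om h K'.
Proof.
move=> oO E [V H]; split; first exact: vector_field_ext V.
move=> i p Op ip a b; rewrite -[RHS](H i p Op ip a b); symmetry.
have PK c l : pd i c (fun q => K i q 0 l) p = pd i c (fun q => K' i q 0 l) p.
  apply: partial_ext (open_img (i := i) oO) (img_coord ip Op) _ => w /imgP[iw Ow _] /=.
  by rewrite E.
by apply: eq_bigr => l _; rewrite !PK E.
Qed.

Lemma bracket_ext Om (X X' Y Y' : field A 'rV[R]_4) i p : open Om -> Om p -> dom i p ->
  eq_field Om X X' -> eq_field Om Y Y' -> bracket X Y i p = bracket X' Y' i p.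
Proof.
move=> oO Op ip EX EY; apply: etrans (bracket_lie X Y ip) (etrans _ (esym (bracket_lie X' Y' ip))).
apply: (lie_ext (open_img (i := i) oO) (img_coord ip Op)) => w /imgP[iw Ow _];
  [exact: EX|exact: EY].
Qed.
End Transfer.

Lemma frame_algebra (R : realType) (d1 d2 v : 'rV[R]_4) (gi p m : 'M[R]_4) a b :
  p *m p = - 1%:M -> m *m m = - 1%:M -> p *m m = m *m p ->
  d1 *m gi = 2^-1 *: (v *m p) -> d2 *m gi = 2^-1 *: (v *m m) ->
  (a *: d1 + b *: d2) *m gi *m p = - (2^-1 * a) *: v + (2^-1 * b) *: (v *m m *m p) /\
  (a *: d1 + b *: d2) *m gi *m m = (2^-1 * a) *: (v *m m *m p) - (2^-1 * b) *: v.
Proof.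
move=> pp mm pm G1 G2; rewrite !mulmxDl !mul_scalemx G1 G2 !mul_scalemx.
have -> : v *m p *m p = - v by rewrite -mulmxA pp mulmxN mulmx1.
have -> : v *m m *m m = - v by rewrite -mulmxA mm mulmxN mulmx1.
have -> : v *m p *m m = v *m m *m p by rewrite -!mulmxA pm.
by move: (v *m m *m p) => z; split; apply/rowP => k; rewrite !mxE; ring.
Qed.

Section Result.
Context {R : realType} {M : topologicalType} {A : oriented_atlas R M}.
Context {g : field A 'M[R]_4} (g_metric : riemannian_metric [set: M] g).
Context {psi : field A 'M[R]_4} (psi_form : two_form [set: M] psi).
Context {alpha : field A 'rV[R]_4} (alpha_form : one_form [set: M] alpha).
Hypothesis sk : star_killing g psi alpha.
Variable Om : set M.
Hypotheses (oO : open Om) (sO : Om `<=` regular_set (g := g) (psi := psi)).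
Implicit Types (i j : chart A) (p q : M) (u w : 'rV[R]_4).

Local Notation phi := (phi_part g psi).
Local Notation F sg := (ff g (phi sg)).
Local Notation J sg := (ak_J g (phi sg)).
Local Notation gs sg := (ak_g g (phi sg)).
Local Notation K1 := (K1_field (g := g) (alpha := alpha)).
Local Notation K2 := (K2_field (g := g) (psi := psi) (alpha := alpha)).

Let s1 : 1 * 1 = 1 :> R. Proof. exact: mulr1. Qed.
Let sN1 : -1 * -1 = 1 :> R. Proof. by ring. Qed.
Let F0 sg p (ss : sg * sg = 1) (Op : Om p) : 0 < F sg p := F_gt0 sO ss Op.
Let Fn0 sg p (ss : sg * sg = 1) (Op : Om p) : F sg p != 0 := lt0r_neq0 (F0 ss Op).
Let sF sg (ss : sg * sg = 1) : smooth_fun (A := A) Om (F sg) := smooth_ff g_metric psi_form oO sO ss.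

Lemma J_law sg i j p : dom i p -> dom j p -> jac i j p *m J sg j p = J sg i p *m jac i j p.
Proof.
move=> ip jp; rewrite /ak_J /scale_field -scalemxAr -scalemxAl; congr (_ *: _).
exact: (endo_law g_metric psi_form).
Qed.

Lemma v_law i j p : dom i p -> dom j p ->
  alpha i p *m invmx (g i p) *m jac i j p = alpha j p *m invmx (g j p).
Proof.
move=> ip jp; rewrite (alpha_law alpha_form ip jp) -!mulmxA; congr (_ *m _).
rewrite mulmxA (inv_congr (g_posdef g_metric jp) (g_posdef g_metric ip) (g_law g_metric ip jp)) //.
exact: jac_det.
Qed.

Section frame.
Context {i : chart A} {p : M} (ip : dom i p) (Op : Om p).
Local Notation v := (alpha i p *m invmx (g i p)).
Local Notation w := (v *m J (-1) i p *m J 1 i p).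
Local Notation d sg := (differential (F sg) i p).
Local Notation gi := (invmx (g i p)).

(** Every function used below depends only on f_+ and f_-.  If dh = a df_+ + b
    df_-, then both rotated gradients of h are combinations of v and J_- J_+ v. *)
Lemma grad_frame (h : M -> R) a b : differential h i p = a *: d 1 + b *: d (-1) ->
  differential h i p *m gi *m J 1 i p = - (2^-1 * a) *: v + (2^-1 * b) *: w /\
  differential h i p *m gi *m J (-1) i p = (2^-1 * a) *: w - (2^-1 * b) *: v.
Proof.
move=> ->; have G1 := grad_ff g_metric psi_form sk oO sO ip Op s1.
have G2 := grad_ff g_metric psi_form sk oO sO ip Op sN1.
exact: (frame_algebra a b (J_sqr_p g_metric psi_form sO ip Op s1)
  (J_sqr_p g_metric psi_form sO ip Op sN1) (J_comm_p g_metric psi_form ip Op) G1 G2).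
Qed.
End frame.

Local Notation v i p := (alpha i p *m invmx (g i p)).
Local Notation w i p := (v i p *m J (-1) i p *m J 1 i p).
Local Notation d sg i p := (differential (F sg) i p).

Lemma act_grad (h : field A 'M[R]_4) C f i p :
  act C (grad h f) i p = differential f i p *m invmx (h i p) *m C i p.
Proof. by []. Qed.

Lemma inv_gs sg i p : dom i p -> Om p -> sg * sg = 1 ->
  invmx (gs sg i p) = F sg p ^+ 2 *: invmx (g i p).
Proof.
move=> ip Op ss; rewrite /ak_g /scale_field invmxZ ?invrK //.
have ug := posdef_unit (g_posdef g_metric ip).
by rewrite unitmxZ // unitfE invr_eq0 expf_neq0 // Fn0.
Qed.

Lemma act_grad_gs sg C f i p : dom i p -> Om p -> sg * sg = 1 ->
  act C (grad (gs sg) f) i p =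
  F sg p ^+ 2 *: (differential f i p *m invmx (g i p) *m C i p).
Proof. by move=> ip Op ss; rewrite act_grad inv_gs // mulmx_scale mul_scalemx. Qed.

Definition xcoord p := (F 1 p + F (-1) p) / 2.
Definition ycoord p := (F 1 p - F (-1) p) / 2.
Local Notation x := xcoord.
Local Notation y := ycoord.

(** The momentum of K1 with respect to omega_+ or omega_-, written in f_+ and f_-
    so that both signs are treated at once. *)
Definition mu1 (sg : R) p := -1 * (F sg p)^-1.

(** The momentum of K2, likewise: x y = (f_+^2 - f_-^2) / 4 by the definition of x
    and y. *)
Definition mu2 (sg : R) p := 4^-1 * (F sg p - F (- sg) p * F (- sg) p * (F sg p)^-1).

Let sFz sg c (ss : sg * sg = 1) : smooth_fun (A := A) Om (fun p => c * F sg p).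
Proof. apply: smooth_funM => //; [exact: smooth_fun_cst | exact: sF]. Qed.

Let sNN (sg : R) : sg * sg = 1 -> (- sg) * (- sg) = 1. Proof. by rewrite mulrNN. Qed.

Lemma smooth_mu1 sg : sg * sg = 1 -> smooth_fun (A := A) Om (mu1 sg).
Proof.
move=> ss; apply: (smooth_funM oO); first exact: smooth_fun_cst.
by apply: (smooth_funV oO); [move=> p Op; exact: Fn0 | exact: sF].
Qed.

Lemma smooth_mu2 sg : sg * sg = 1 -> smooth_fun (A := A) Om (mu2 sg).
Proof.
move=> ss; have ss' := sNN ss.
apply: (smooth_funM oO); first exact: smooth_fun_cst.
have SFF := smooth_funM oO (sF ss') (sF ss').
have SV := smooth_funV oO (fun p Op => Fn0 ss Op) (sF ss).
have SP := smooth_funM oO SFF SV.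
have SN := smooth_funM oO (smooth_fun_cst (A := A) Om (-1)) SP.
have E : (fun p => F sg p - F (- sg) p * F (- sg) p * (F sg p)^-1) =
  (fun p => F sg p + (-1) * (F (- sg) p * F (- sg) p * (F sg p)^-1)).
  by apply/funext => p; rewrite mulN1r.
by rewrite E; apply: (smooth_funD oO) => //; exact: sF.
Qed.

Section diffs.
Context {i : chart A} {p : M} (ip : dom i p) (Op : Om p).

Lemma diff_lin a b (f : M -> R) : f = (fun q => a * F 1 q + b * F (-1) q) ->
  differential f i p = a *: d 1 i p + b *: d (-1) i p.
Proof.
move=> ->; rewrite (differentialD ip Op (sFz a s1) (sFz b sN1)).
by rewrite (differentialZ ip Op a (sF s1)) (differentialZ ip Op b (sF sN1)).
Qed.

Lemma diff_mu1 sg : sg * sg = 1 -> differential (mu1 sg) i p = (F sg p ^- 2) *: d sg i p.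
Proof.
move=> ss; have SV := smooth_funV oO (fun p Op => Fn0 ss Op) (sF ss).
rewrite (differentialZ ip Op (-1) SV) (differentialV ip Op (Fn0 ss Op) (sF ss)).
by rewrite scalerA mulrNN mul1r.
Qed.

Lemma diff_mu2 sg : sg * sg = 1 -> differential (mu2 sg) i p =
  (4^-1 * (1 + F (- sg) p ^+ 2 / F sg p ^+ 2)) *: d sg i p
  - (2^-1 * F (- sg) p / F sg p) *: d (- sg) i p.
Proof.
move=> ss; have ss' := sNN ss.
have SFF := smooth_funM oO (sF ss') (sF ss').
have SV := smooth_funV oO (fun p Op => Fn0 ss Op) (sF ss).
have SP := smooth_funM oO SFF SV.
have SN := smooth_funM oO (smooth_fun_cst (A := A) Om (-1)) SP.
have E : mu2 sg =
  (fun p => 4^-1 * (F sg p + (-1) * (F (- sg) p * F (- sg) p * (F sg p)^-1))).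
  by apply/funext => q; rewrite /mu2 mulN1r.
rewrite E (differentialZ ip Op _ (smooth_funD oO (sF ss) SN)).
rewrite (differentialD ip Op (sF ss) SN) (differentialZ ip Op (-1) SP).
rewrite (differentialM ip Op SFF SV) (differentialM ip Op (sF ss') (sF ss')).
rewrite (differentialV ip Op (Fn0 ss Op) (sF ss)).
move: (Fn0 ss Op); move: (d sg i p) (d (- sg) i p) (F sg p) (F (- sg) p) => d1 d2 f h f0.
by apply/rowP => k; rewrite !mxE; field.
Qed.
End diffs.

Let NN1 : - (-1) = 1 :> R. Proof. exact: opprK. Qed.

Lemma x_add_y : (fun p => x p + y p) = F 1.
Proof. by apply/funext => p; rewrite /x /y; field. Qed.

Lemma x_sub_y : (fun p => x p - y p) = F (-1).
Proof. by apply/funext => p; rewrite /x /y; field. Qed.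

Lemma mu1pE : (fun p => -1 / (x p + y p)) = mu1 1.
Proof. by apply/funext => p; rewrite -[x p + y p]/((fun p => x p + y p) p) x_add_y. Qed.

Lemma mu1mE : (fun p => -1 / (x p - y p)) = mu1 (-1).
Proof. by apply/funext => p; rewrite -[x p - y p]/((fun p => x p - y p) p) x_sub_y. Qed.

(** An identity of functions, also where a denominator vanishes, the inverse
    of 0 being 0. *)
Lemma mu2pE : (fun p => x p * y p / (x p + y p)) = mu2 1.
Proof.
apply/funext => p; rewrite -[x p + y p]/((fun p => x p + y p) p) x_add_y /x /y /mu2.
move: (F 1 p) (F (-1) p) => f h; have [->|f0] := eqVneq f 0; last by field.
by rewrite invr0; ring.
Qed.

Lemma mu2mE : (fun p => - (x p * y p) / (x p - y p)) = mu2 (-1).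
Proof.
apply/funext => p; rewrite -[x p - y p]/((fun p => x p - y p) p) x_sub_y /x /y /mu2 NN1.
move: (F 1 p) (F (-1) p) => h f; have [->|f0] := eqVneq f 0; last by field.
by rewrite invr0; ring.
Qed.

Section equations.
Context {i : chart A} {p : M} (ip : dom i p) (Op : Om p).

Let Dx : differential x i p = 2^-1 *: d 1 i p + 2^-1 *: d (-1) i p.
Proof. by apply: (diff_lin ip Op); apply/funext => q; rewrite /x; field. Qed.

Let Dy : differential y i p = 2^-1 *: d 1 i p + (- 2^-1) *: d (-1) i p.
Proof. by apply: (diff_lin ip Op); apply/funext => q; rewrite /y; field. Qed.

Let Dp : differential (F 1) i p = 1 *: d 1 i p + 0 *: d (-1) i p.
Proof. by rewrite scale1r scale0r addr0. Qed.

Let Dm : differential (F (-1)) i p = 0 *: d 1 i p + 1 *: d (-1) i p.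
Proof. by rewrite scale1r scale0r add0r. Qed.

Let D1p : differential (mu1 1) i p = (F 1 p ^- 2) *: d 1 i p + 0 *: d (-1) i p.
Proof. by rewrite diff_mu1 // scale0r addr0. Qed.

Let D1m : differential (mu1 (-1)) i p = 0 *: d 1 i p + (F (-1) p ^- 2) *: d (-1) i p.
Proof. by rewrite diff_mu1 // scale0r add0r. Qed.

Let D2p : differential (mu2 1) i p = (4^-1 * (1 + F (-1) p ^+ 2 / F 1 p ^+ 2)) *: d 1 i p
  + (- (2^-1 * F (-1) p / F 1 p)) *: d (-1) i p.
Proof. by rewrite diff_mu2 // scaleNr. Qed.

Let D2m : differential (mu2 (-1)) i p = (- (2^-1 * F 1 p / F (-1) p)) *: d 1 i p
  + (4^-1 * (1 + F 1 p ^+ 2 / F (-1) p ^+ 2)) *: d (-1) i p.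
Proof. by rewrite diff_mu2 // NN1 scaleNr addrC. Qed.

Let fp0 := Fn0 s1 Op.
Let fm0 := Fn0 sN1 Op.

Lemma K1_grad_fp : K1 i p = act (J 1) (grad g (F 1)) i p.
Proof.
rewrite act_grad (grad_frame ip Op Dp).1 /K1_field /K1v.
by move: (w i p) (v i p) => a b; apply/rowP => k; rewrite !mxE; field.
Qed.

Lemma K1_grad_fm : K1 i p = act (J (-1)) (grad g (F (-1))) i p.
Proof.
rewrite act_grad (grad_frame ip Op Dm).2 /K1_field /K1v.
by move: (w i p) (v i p) => a b; apply/rowP => k; rewrite !mxE; field.
Qed.

Lemma K1_grad_mup : K1 i p = act (J 1) (grad (gs 1) (mu1 1)) i p.
Proof.
rewrite act_grad_gs // (grad_frame ip Op D1p).1 /K1_field /K1v.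
move: fp0; move: (F 1 p) (w i p) (v i p) => f a b f0.
by apply/rowP => k; rewrite !mxE; field.
Qed.

Lemma K1_grad_mum : K1 i p = act (J (-1)) (grad (gs (-1)) (mu1 (-1))) i p.
Proof.
rewrite act_grad_gs // (grad_frame ip Op D1m).2 /K1_field /K1v.
move: fm0; move: (F (-1) p) (w i p) (v i p) => f a b f0.
by apply/rowP => k; rewrite !mxE; field.
Qed.

Lemma K2_grad_Jp : K2 i p =
  add_field (scale_field (fun p => y p ^+ 2) (act (J 1) (grad g x)))
            (scale_field (fun p => x p ^+ 2) (act (J 1) (grad g y))) i p.
Proof.
rewrite /add_field /scale_field !act_grad (grad_frame ip Op Dx).1 (grad_frame ip Op Dy).1.
rewrite /K2_field /K2v /x /y.
move: (F 1 p) (F (-1) p) (w i p) (v i p) => f h a b.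
by apply/rowP => k; rewrite !mxE; field.
Qed.

Lemma K2_grad_Jm : K2 i p =
  add_field (scale_field (fun p => y p ^+ 2) (act (J (-1)) (grad g x)))
            (scale_field (fun p => - (x p ^+ 2)) (act (J (-1)) (grad g y))) i p.
Proof.
rewrite /add_field /scale_field !act_grad (grad_frame ip Op Dx).2 (grad_frame ip Op Dy).2.
rewrite /K2_field /K2v /x /y.
move: (F 1 p) (F (-1) p) (w i p) (v i p) => f h a b.
by apply/rowP => k; rewrite !mxE; field.
Qed.

Lemma K2_grad_mup : K2 i p = act (J 1) (grad (gs 1) (mu2 1)) i p.
Proof.
rewrite act_grad_gs // (grad_frame ip Op D2p).1 /K2_field /K2v.
move: fp0; move: (F 1 p) (F (-1) p) (w i p) (v i p) => f h a b f0.
by apply/rowP => k; rewrite !mxE; field.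
Qed.

Lemma K2_grad_mum : K2 i p = act (J (-1)) (grad (gs (-1)) (mu2 (-1))) i p.
Proof.
rewrite act_grad_gs // (grad_frame ip Op D2m).2 /K2_field /K2v.
move: fm0; move: (F (-1) p) (F 1 p) (w i p) (v i p) => f h a b f0.
by apply/rowP => k; rewrite !mxE; field.
Qed.

Lemma K1_sharp : K1 i p = scale_field (fun=> - 2^-1) (sharp g alpha) i p.
Proof. by []. Qed.
End equations.

Lemma K1_vector_field : vector_field Om K1.
Proof.
split.
  apply: smooth_field_loc => i.
  exact: (smooth_K1 (open_img (i := i) oO) (smooth_loc_g g_metric i oO) (@loc_g_posdef _ _ _ _ g_metric i Om) (smooth_loc_alpha alpha_form i oO)).
move=> i j p _ ip jp; rewrite /K1_field /K1v mul_scalemx; congr (_ *: _).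
by rewrite v_law.
Qed.

Lemma K2_vector_field : vector_field Om K2.
Proof.
split.
  apply: smooth_field_loc => i; have oUi := open_img (i := i) oO.
  have S := smooth_K2 oUi (smooth_loc_g g_metric i oO) (@loc_g_posdef _ _ _ _ g_metric i Om) (smooth_loc_psi psi_form i oO)
    (smooth_loc_alpha alpha_form i oO) (norm_part_gt0 g_metric psi_form sO s1) (norm_part_gt0 g_metric psi_form sO sN1).
  apply: (smooth_mx_ext oUi) S => u Uu; exact: esym (K2_loc g_metric psi_form Uu).
move=> i j p _ ip jp; rewrite /K2_field /K2v mulmxBl !mul_scalemx v_law //.
congr (_ - _ *: _); rewrite -!mulmxA -J_law // [J (-1) i p *m (_ *m _)]mulmxA -J_law //.
by rewrite !mulmxA v_law.
Qed.

End Result.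

(** * Killing equations and brackets on the manifold *)

Section Structure.
Context {R : realType} {M : topologicalType} {A : oriented_atlas R M}.
Context {g : field A 'M[R]_4} (g_metric : riemannian_metric [set: M] g).
Context {psi : field A 'M[R]_4} (psi_form : two_form [set: M] psi).
Context {alpha : field A 'rV[R]_4} (alpha_form : one_form [set: M] alpha).
Hypothesis sk : star_killing g psi alpha.
Variable Om : set M.
Hypotheses (oO : open Om) (sO : Om `<=` regular_set (g := g) (psi := psi)).
Implicit Types (i j : chart A) (p q : M) (u w : 'rV[R]_4).

Local Notation phi := (phi_part g psi).
Local Notation F sg := (ff g (phi sg)).
Local Notation J sg := (ak_J g (phi sg)).
Local Notation gs sg := (ak_g g (phi sg)).
Local Notation om sg := (ak_omega g (phi sg)).
Local Notation K1 := (K1_field (g := g) (alpha := alpha)).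
Local Notation K2 := (K2_field (g := g) (psi := psi) (alpha := alpha)).

Let s1 : 1 * 1 = 1 :> R. Proof. exact: mulr1. Qed.
Let sN1 : -1 * -1 = 1 :> R. Proof. by ring. Qed.
Let F0 sg p (ss : sg * sg = 1) (Op : Om p) : 0 < F sg p := F_gt0 sO ss Op.
Let oUi i : open (img i Om) := open_img (i := i) oO.
Let sGi i := smooth_loc_g g_metric i oO.
Let sPi i := smooth_loc_psi psi_form i oO.
Let sAi i := smooth_loc_alpha alpha_form i oO.
Let pGi i u (Uu : img i Om u) := loc_g_posdef g_metric Uu.
Let aPi i u (Uu : img i Om u) := loc_psi_antisym psi_form Uu.
Let SKi i k u (Uu : img i Om u) := loc_star_killing sk k Uu.
Let npos i sg (ss : sg * sg = 1) u (Uu : img i Om u) := norm_part_gt0 g_metric psi_form sO ss Uu.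
Let nneq i u (Uu : img i Om u) := norm_part_neq g_metric psi_form sO Uu.

Lemma gs_loc sg i u : img i Om u ->
  loc (gs sg) i u = norm_part (loc g i) (loc psi i) sg u ^- 2 *: loc g i u.
Proof. by move=> /imgP[iu _ _]; rewrite /loc /ak_g /scale_field (ff_loc g_metric psi_form sg iu). Qed.

Lemma K1_killing_g : killing Om g K1.
Proof.
split; first exact: (K1_vector_field g_metric alpha_form oO).
move=> i p Op ip a b; have Up := img_coord ip Op.
apply: (killing_transfer oO ip Op (H := loc g i) (Kf := K1f (loc g i) (loc alpha i))) => //.
exact: (K1_killing (@oUi i) (@sGi i) (@pGi i) (@sPi i) (@sAi i) (@aPi i) (@SKi i) (@npos i 1 s1)
  (@npos i (-1) sN1) (@nneq i) a b Up).
Qed.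

Lemma K2_killing_g : killing Om g K2.
Proof.
split; first exact: (K2_vector_field g_metric psi_form alpha_form oO sO).
move=> i p Op ip a b; have Up := img_coord ip Op.
apply: (killing_transfer oO ip Op (H := loc g i) (Kf := K2f (loc g i) (loc psi i) (loc alpha i))).
- by [].
- by move=> u Uu; exact: (K2_loc g_metric psi_form (alpha := alpha) Uu).
exact: (K2_killing (@oUi i) (@sGi i) (@pGi i) (@sPi i) (@sAi i) (@aPi i) (@SKi i) (@npos i 1 s1)
  (@npos i (-1) sN1) (@nneq i) a b Up).
Qed.

Lemma sign_cases (sg : R) : sg * sg = 1 -> sg = 1 \/ sg = -1.
Proof.
move=> ss; have /eqP : (sg - 1) * (sg + 1) = 0.
  have -> : (sg - 1) * (sg + 1) = sg * sg - 1 by ring.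
  by rewrite ss subrr.
by rewrite mulf_eq0 subr_eq0 addr_eq0 => /orP[/eqP|/eqP]; [left|right].
Qed.

(** f_+ and f_- are constant along K1, so [lie_conformal] applies. *)
Lemma K1_killing_gs sg : sg * sg = 1 -> killing Om (gs sg) K1.
Proof.
move=> ss; split; first exact: (K1_vector_field g_metric alpha_form oO).
move=> i p Op ip a b; have Up := img_coord ip Op.
apply: (killing_transfer oO ip Op
  (H := fun w => norm_part (loc g i) (loc psi i) sg w ^- 2 *: loc g i w) (Kf := K1f (loc g i) (loc alpha i))).
- by move=> u Uu; exact: gs_loc.
- by [].
have K := K1_killing (@oUi i) (@sGi i) (@pGi i) (@sPi i) (@sAi i) (@aPi i) (@SKi i) (@npos i 1 s1)
  (@npos i (-1) sN1) (@nneq i) a b Up.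
have [d1 d2 _ _] := dnorm_K (Al := loc alpha i) (@pGi i) (@aPi i) (@npos i 1 s1) (@npos i (-1) sN1) Up.
apply: (lie_conformal (@oUi i) (@sGi i) (@pGi i) (@sPi i) (@aPi i) (@SKi i) ss (@npos i sg ss) Up _ K).
by case: (sign_cases ss) => ->.
Qed.

Lemma K2_killing_gs sg : sg * sg = 1 -> killing Om (gs sg) K2.
Proof.
move=> ss; split; first exact: (K2_vector_field g_metric psi_form alpha_form oO sO).
move=> i p Op ip a b; have Up := img_coord ip Op.
apply: (killing_transfer oO ip Op
  (H := fun w => norm_part (loc g i) (loc psi i) sg w ^- 2 *: loc g i w)
  (Kf := K2f (loc g i) (loc psi i) (loc alpha i))).
- by move=> u Uu; exact: gs_loc.
- by move=> u Uu; exact: (K2_loc g_metric psi_form (alpha := alpha) Uu).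
have K := K2_killing (@oUi i) (@sGi i) (@pGi i) (@sPi i) (@sAi i) (@aPi i) (@SKi i) (@npos i 1 s1)
  (@npos i (-1) sN1) (@nneq i) a b Up.
have [_ _ d1 d2] := dnorm_K (Al := loc alpha i) (@pGi i) (@aPi i) (@npos i 1 s1) (@npos i (-1) sN1) Up.
apply: (lie_conformal (@oUi i) (@sGi i) (@pGi i) (@sPi i) (@aPi i) (@SKi i) ss (@npos i sg ss) Up _ K).
by case: (sign_cases ss) => ->.
Qed.

Lemma K_bracket_global : eq_field Om (bracket K1 K2) (fun _ _ => 0).
Proof.
move=> i p Op ip; have Up := img_coord ip Op.
have E1 u : img i Om u -> loc K1 i u = K1f (loc g i) (loc alpha i) u by [].
have E2 u (Uu : img i Om u) : loc K2 i u = K2f (loc g i) (loc psi i) (loc alpha i) u.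
  exact: (K2_loc g_metric psi_form (alpha := alpha) Uu).
apply: etrans (bracket_lie _ _ ip) (etrans (lie_ext (@oUi i) Up E1 E2) _).
exact: (K_bracket (@oUi i) (@sGi i) (@pGi i) (@sPi i) (@sAi i) (@aPi i) (@SKi i) (@npos i 1 s1)
  (@npos i (-1) sN1) (@nneq i) Up).
Qed.

Lemma omega_bil sg i p x y : ((x : 'rV[R]_4) *m om sg i p *m (y : 'rV[R]_4)^T) 0 0 =
  F sg p ^- 2 * bil (g i p) (x *m J sg i p) y.
Proof.
by rewrite -/(bil _ _ _) /ak_omega bil_mull /ak_g /scale_field bilZ.
Qed.

Lemma K_poisson_global sg : sg * sg = 1 -> poisson_commute Om (om sg) K1 K2.
Proof.
move=> ss i p Op ip; have Up := img_coord ip Op; rewrite omega_bil.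
have [h1 h2] := K_poisson (Al := loc alpha i) (@pGi i) (@aPi i) (@npos i 1 s1) (@npos i (-1) sN1) Up.
rewrite -(K2_loc g_metric psi_form Up) !(J_locp g_metric psi_form ip) -(K1_loc) in h1 h2.
rewrite (locE K2 ip) (locE K1 ip) (locE g ip) in h1 h2.
by case: (sign_cases ss) => ->; rewrite ?h1 ?h2 mulr0.
Qed.
End Structure.

(** * The Kahler structures *)

Section Kahler.
Context {R : realType} {M : topologicalType} {A : oriented_atlas R M}.
Context {g : field A 'M[R]_4} (g_metric : riemannian_metric [set: M] g).
Context {psi : field A 'M[R]_4} (psi_form : two_form [set: M] psi).
Context {alpha : field A 'rV[R]_4}.
Hypothesis sk : star_killing g psi alpha.
Variable Om : set M.
Hypotheses (oO : open Om) (sO : Om `<=` regular_set (g := g) (psi := psi)).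
Implicit Types (i j : chart A) (p q : M) (u w : 'rV[R]_4).

Local Notation phi := (phi_part g psi).
Local Notation F sg := (ff g (phi sg)).
Local Notation J sg := (ak_J g (phi sg)).
Local Notation gs sg := (ak_g g (phi sg)).
Local Notation om sg := (ak_omega g (phi sg)).
Variable sg : R.
Hypothesis ss : sg * sg = 1.

Let F0 p (Op : Om p) : 0 < F sg p := F_gt0 sO ss Op.
Let oUi i : open (img i Om) := open_img (i := i) oO.
Let sGi i := smooth_loc_g g_metric i oO.
Let sPi i := smooth_loc_psi psi_form i oO.
Let pGi i u (Uu : img i Om u) := loc_g_posdef g_metric Uu.
Let aPi i u (Uu : img i Om u) := loc_psi_antisym psi_form Uu.
Let SKi i k u (Uu : img i Om u) := loc_star_killing sk k Uu.
Let npos i u (Uu : img i Om u) := norm_part_gt0 g_metric psi_form sO ss Uu.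

Let c0 p (Op : Om p) : 0 < F sg p ^- 2. Proof. by rewrite invr_gt0 exprn_gt0 // F0. Qed.

Lemma gs_metric : riemannian_metric Om (gs sg).
Proof.
split.
- split.
    move=> i a b; have sF2 := smooth_norm_part_inv2 (@oUi i) (@sGi i) (@pGi i) (@sPi i) (@npos i).
    apply: (smooth_ext (@oUi i) _ (smooth_mxZ (@oUi i) sF2 (@sGi i) a b)) => u Uu.
    by rewrite -(gs_loc g_metric psi_form sg Uu).
  move=> i j p Op ip jp; rewrite /ak_g /scale_field (g_law g_metric ip jp).
  by rewrite mulmx_scale mul_scalemx.
- move=> i p Op ip; rewrite /ak_g /scale_field linearZ /=; congr (_ *: _).
  by have [] := g_posdef g_metric ip.
- move=> i p Op ip v v0; rewrite /ak_g /scale_field mulmx_scale mul_scalemx mxE.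
  by apply: mulr_gt0; [exact: c0 | have [_] := g_posdef g_metric ip; exact].
Qed.

Lemma J_endo : endo_field Om (J sg).
Proof.
split; first exact: (smooth_ak_J g_metric psi_form oO sO ss).
by move=> i j p Op ip jp; exact: (J_law g_metric psi_form).
Qed.

Lemma J_orthogonal i p : Om p -> dom i p ->
  J sg i p *m J sg i p = - 1%:M /\ J sg i p *m gs sg i p *m (J sg i p)^T = gs sg i p.
Proof.
move=> Op ip; have JJ := J_sqr_p g_metric psi_form sO ip Op ss; split=> //.
rewrite /ak_g /scale_field mulmx_scale mul_scalemx; congr (_ *: _).
exact: (JgJ (g_posdef g_metric ip) JJ (J_skew_p g_metric psi_form ip Op sg)).
Qed.

Lemma J_integrable i p : Om p -> dom i p -> forall a b,
  nijenhuis (J sg) (coord_field a) (coord_field b) i p = 0.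
Proof.
move=> Op ip a b; have Up := img_coord ip Op.
have N := nijenhuis_local (@oUi i) (@sGi i) (@pGi i) (@sPi i) (@aPi i) (@SKi i) ss (@npos i) a b Up.
have EJ c u : img i Om u -> loc (act (J sg) (coord_field c)) i u =
    delta_mx 0 c *m J_part (loc g i) (loc psi i) sg u.
  by move=> /imgP[iu _ _]; rewrite -(J_loc g_metric psi_form sg iu).
have Ee c u : img i Om u -> loc (coord_field c : field A _) i u = delta_mx 0 c by [].
have E := lie_ext (@oUi i) Up.
rewrite -[RHS]N /nijenhuis; congr (_ - _ - _ - _).
- exact: etrans (bracket_lie _ _ ip) (E _ _ _ _ (EJ a) (EJ b)).
- rewrite (J_locp g_metric psi_form ip); congr (_ *m _).
  exact: etrans (bracket_lie _ _ ip) (E _ _ _ _ (EJ a) (Ee b)).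
- rewrite (J_locp g_metric psi_form ip); congr (_ *m _).
  exact: etrans (bracket_lie _ _ ip) (E _ _ _ _ (Ee a) (EJ b)).
- exact: etrans (bracket_lie _ _ ip) (E _ _ _ _ (Ee a) (Ee b)).
Qed.

Lemma omega_loc i u : img i Om u ->
  loc (om sg) i u = kahler_form (loc g i) (loc psi i) sg u.
Proof.
move=> Uu; have /imgP[iu _ _] := Uu; rewrite /kahler_form -(J_loc g_metric psi_form sg iu).
by rewrite -(gs_loc g_metric psi_form sg Uu).
Qed.

Lemma omega_closed : closed_two_form Om (om sg).
Proof.
have S i := smooth_kahler_form (@oUi i) (@sGi i) (@pGi i) (@sPi i) (@npos i).
split.
  split.
    split.
      move=> i a b; apply: (smooth_ext (@oUi i) _ (S i a b)) => u Uu.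
      by rewrite -(omega_loc Uu).
    move=> i j p Op ip jp; rewrite /ak_omega !mulmxA (J_law g_metric psi_form sg ip jp).
    rewrite -[RHS]mulmxA; have [[_ L] _ _] := gs_metric.
    by rewrite (L i j p Op ip jp) !mulmxA.
  move=> i p Op ip; have Up := img_coord ip Op.
  have := kahler_form_antisym (@pGi i) (@aPi i) sg Up.
  by rewrite -(omega_loc Up) (locE _ ip).
move=> i p Op ip a b c; have Up := img_coord ip Op.
have C := kahler_form_closed (@oUi i) (@sGi i) (@pGi i) (@sPi i) (@aPi i) (@SKi i) ss (@npos i) a b c Up.
have PE d (k l : 'I_4) : pd i d (fun q => om sg i q k l) p =
    partial d (fun w => kahler_form (loc g i) (loc psi i) sg w k l) (coord i p).
  by apply: partial_ext (@oUi i) Up _ => w Uw; rewrite -(omega_loc Uw).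
by rewrite !PE.
Qed.

Lemma ambikahler_kahler : kahler Om (gs sg) (J sg) (om sg).
Proof.
split.
- exact: gs_metric.
- exact: J_endo.
- exact: J_orthogonal.
- exact: J_integrable.
- split; [by [] | exact: omega_closed].
Qed.

(** The form J g is a multiple of psi_+ or psi_-, hence an eigenvector of the
    star. *)
Lemma J_orientation i p X Y : Om p -> dom i p ->
  \det (complex_frame (J sg i p) X Y) != 0 -> 0 < sg * \det (complex_frame (J sg i p) X Y).
Proof.
move=> Op ip.
have JJ := J_sqr_p g_metric psi_form sO ip Op ss.
have Jg := J_skew_p g_metric psi_form ip Op sg.
apply: (complex_frame_det (g_posdef g_metric ip) JJ Jg ss).
have -> : J sg i p *m g i p = (F sg p)^-1 *: phi sg i p.
  rewrite /ak_J /scale_field mul_scalemx /endo_of mulmxKV //.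
  exact: posdef_unit (g_posdef g_metric ip).
rewrite starZ /phi_part (star_dual_part (g_posdef g_metric ip) ss (psi_antisym psi_form ip)).
by rewrite !scalerA [_ * sg]mulrC.
Qed.
End Kahler.

(** * The ambitoric structure *)

Section Span.
Context {R : realType} {M : topologicalType} {A : oriented_atlas R M}.
Variable Om : set M.
Hypothesis oO : open Om.
Implicit Types (X Y : field A 'rV[R]_4) (h B C : field A 'M[R]_4) (c d : R * R).

Lemma lin_comb_vector_field X Y c :
  vector_field Om X -> vector_field Om Y -> vector_field Om (lin_comb X Y c).
Proof.
move=> [sX lX] [sY lY]; split.
  apply: smooth_field_loc => i; apply: smooth_mxD; first exact: open_img.
    by apply: smooth_mxZ; [exact: open_img | exact: smooth_cst | exact: sX].
  by apply: smooth_mxZ; [exact: open_img | exact: smooth_cst | exact: sY].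
move=> i j p Op ip jp; rewrite /lin_comb (lX i j p Op ip jp) (lY i j p Op ip jp).
by rewrite mulmxDl !mul_scalemx.
Qed.

Lemma lin_comb_killing h X Y c :
  killing Om h X -> killing Om h Y -> killing Om h (lin_comb X Y c).
Proof.
move=> [vX kX] [vY kY]; split; first exact: lin_comb_vector_field.
move=> i p Op ip a b; have Up := img_coord ip Op; have oU := open_img (i := i) oO.
have D k l : pd i k (fun q => lin_comb X Y c i q 0 l) p =
    c.1 * pd i k (fun q => X i q 0 l) p + c.2 * pd i k (fun q => Y i q 0 l) p.
  have sX := vX.1 i 0 l; have sY := vY.1 i 0 l.
  have sc e : smooth (img i Om) (fun=> e : R) by exact: smooth_cst.
  rewrite -(partialZ Up k c.1 sX) -(partialZ Up k c.2 sY).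
  rewrite -(partialD Up k (smoothM oU (sc c.1) sX) (smoothM oU (sc c.2) sY)).
  by apply: partial_ext oU Up _ => w Uw; rewrite /= !mxE.
transitivity (c.1 * 0 + c.2 * 0 : R); last by rewrite !mulr0 addr0.
rewrite -[X in c.1 * X](kX i p Op ip a b) -[X in c.2 * X](kY i p Op ip a b) !mulr_sumr -big_split.
by apply: eq_bigr => l _ /=; rewrite !D !mxE; ring.
Qed.

Lemma lin_comb_momentum h C X Y mu nu c :
  momentum Om h C X mu -> momentum Om h C Y nu ->
  momentum Om h C (lin_comb X Y c) (fun p => c.1 * mu p + c.2 * nu p).
Proof.
move=> [smu EX] [snu EY].
have sZ e f : smooth_fun (A := A) Om f -> smooth_fun (A := A) Om (fun p => e * f p).
  by move=> sf; apply: (smooth_funM oO) => //; exact: smooth_fun_cst.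
split; first by apply: (smooth_funD oO); exact: sZ.
move=> i p Op ip; rewrite /lin_comb (EX i p Op ip) (EY i p Op ip) !act_grad.
rewrite (differentialD ip Op (sZ c.1 _ smu) (sZ c.2 _ snu)).
rewrite (differentialZ ip Op c.1 smu) (differentialZ ip Op c.2 snu).
by rewrite !mulmxDl !mul_scalemx.
Qed.

(** By antisymmetry only the mixed values of the form remain. *)
Lemma lin_comb_poisson B X Y c d : two_form Om B ->
  poisson_commute Om B X Y -> poisson_commute Om B (lin_comb X Y c) (lin_comb X Y d).
Proof.
move=> [_ aB] P i p Op ip; rewrite -/(bil _ _ _).
have XY : bil (B i p) (X i p) (Y i p) = 0 by exact: P.
have S x y : bil (B i p) x y = - bil (B i p) y x by rewrite -bil_tr aB // bilN.
have Z x : bil (B i p) x x = 0 by have := S x x; lra.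
by rewrite /lin_comb !bilDl !bilDr !bilZl !bilZr !Z (S (Y i p)) XY; ring.
Qed.

(** All conditions on the space of fields spanned by X and Y are linear
    or bilinear, so that they may be checked on X and Y. *)
Lemma ambitoric_of_momenta gp Jp omp gm Jm omm X Y mup nup mum num :
  ambikahler Om gp Jp omp gm Jm omm -> indep_on_dense_open Om X Y ->
  killing Om gp X -> killing Om gm X -> killing Om gp Y -> killing Om gm Y ->
  momentum Om gp Jp X mup -> momentum Om gp Jp Y nup ->
  momentum Om gm Jm X mum -> momentum Om gm Jm Y num ->
  poisson_commute Om omp X Y -> poisson_commute Om omm X Y ->
  ambitoric Om gp Jp omp gm Jm omm X Y.
Proof.
move=> ak ind kpX kmX kpY kmY hpX hpY hmX hmY pp pm; split=> //.
- by move=> c; split; exact: lin_comb_killing.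
- move=> c; split.
    exact: ex_intro (lin_comb_momentum c hpX hpY).
  exact: ex_intro (lin_comb_momentum c hmX hmY).
- have [[_ _ _ _ [_ [fp _]]] [_ _ _ _ [_ [fm _]]] _ _ _] := ak.
  by move=> c d; split; exact: lin_comb_poisson.
Qed.
End Span.

Section Ambitoric.
Context {R : realType} {M : topologicalType} {A : oriented_atlas R M}.
Context {g : field A 'M[R]_4} (g_metric : riemannian_metric [set: M] g).
Context {psi : field A 'M[R]_4} (psi_form : two_form [set: M] psi).
Context {alpha : field A 'rV[R]_4} (alpha_form : one_form [set: M] alpha).
Hypothesis sk : star_killing g psi alpha.
Variable Om : set M.
Hypotheses (oO : open Om) (sO : Om `<=` regular_set (g := g) (psi := psi)).

Local Notation phi := (phi_part g psi).
Local Notation F sg := (ff g (phi sg)).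
Local Notation J sg := (ak_J g (phi sg)).
Local Notation gs sg := (ak_g g (phi sg)).
Local Notation om sg := (ak_omega g (phi sg)).
Local Notation x := (xcoord (g := g) (psi := psi)).
Local Notation y := (ycoord (g := g) (psi := psi)).
Local Notation S1 := (act (J 1) (grad g (fun p => x p + y p))).
Local Notation S2 :=
  (add_field (scale_field (fun p => y p ^+ 2) (act (J 1) (grad g x)))
             (scale_field (fun p => x p ^+ 2) (act (J 1) (grad g y)))).

Let s1 : 1 * 1 = 1 :> R. Proof. exact: mulr1. Qed.
Let sN1 : -1 * -1 = 1 :> R. Proof. by ring. Qed.

Let E1 : eq_field Om (K1_field (g := g) (alpha := alpha)) S1.
Proof. by move=> i p Op ip; rewrite x_add_y; exact: (K1_grad_fp g_metric psi_form sk oO sO ip Op). Qed.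

Let E2 : eq_field Om (K2_field (g := g) (psi := psi) (alpha := alpha)) S2.
Proof. by move=> i p Op ip; exact: (K2_grad_Jp g_metric psi_form sk oO sO ip Op). Qed.

Lemma K1_expressions :
  [/\ eq_field Om S1 (act (J (-1)) (grad g (fun p => x p - y p))),
      eq_field Om S1 (act (J 1) (grad (gs 1) (fun p => -1 / (x p + y p)))),
      eq_field Om S1 (act (J (-1)) (grad (gs (-1)) (fun p => -1 / (x p - y p)))) &
      eq_field Om S1 (scale_field (fun=> - 2^-1) (sharp g alpha))].
Proof.
split; apply: eq_field_trans (eq_field_sym E1) _ => i p Op ip.
- by rewrite x_sub_y; exact: (K1_grad_fm g_metric psi_form sk oO sO ip Op).
- by rewrite mu1pE; exact: (K1_grad_mup g_metric psi_form sk oO sO ip Op).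
- by rewrite mu1mE; exact: (K1_grad_mum g_metric psi_form sk oO sO ip Op).
- exact: K1_sharp.
Qed.

Lemma K2_expressions :
  [/\ eq_field Om S2
        (add_field (scale_field (fun p => y p ^+ 2) (act (J (-1)) (grad g x)))
                   (scale_field (fun p => - (x p ^+ 2)) (act (J (-1)) (grad g y)))),
      eq_field Om S2 (act (J 1) (grad (gs 1) (fun p => x p * y p / (x p + y p)))) &
      eq_field Om S2 (act (J (-1)) (grad (gs (-1)) (fun p => - (x p * y p) / (x p - y p))))].
Proof.
split; apply: eq_field_trans (eq_field_sym E2) _ => i p Op ip.
- exact: (K2_grad_Jm g_metric psi_form sk oO sO ip Op).
- by rewrite mu2pE; exact: (K2_grad_mup g_metric psi_form sk oO sO ip Op).
- by rewrite mu2mE; exact: (K2_grad_mum g_metric psi_form sk oO sO ip Op).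
Qed.

Lemma K1_killing_all : [/\ killing Om g S1, killing Om (gs 1) S1 & killing Om (gs (-1)) S1].
Proof.
split; apply: (killing_ext oO E1).
- exact: (K1_killing_g g_metric psi_form alpha_form sk oO sO).
- exact: (K1_killing_gs g_metric psi_form alpha_form sk oO sO s1).
- exact: (K1_killing_gs g_metric psi_form alpha_form sk oO sO sN1).
Qed.

Lemma K2_killing_all : [/\ killing Om g S2, killing Om (gs 1) S2 & killing Om (gs (-1)) S2].
Proof.
split; apply: (killing_ext oO E2).
- exact: (K2_killing_g g_metric psi_form alpha_form sk oO sO).
- exact: (K2_killing_gs g_metric psi_form alpha_form sk oO sO s1).
- exact: (K2_killing_gs g_metric psi_form alpha_form sk oO sO sN1).
Qed.

Lemma K_momenta :
  [/\ momentum Om (gs 1) (J 1) S1 (fun p => -1 / (x p + y p)),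
      momentum Om (gs 1) (J 1) S2 (fun p => x p * y p / (x p + y p)),
      momentum Om (gs (-1)) (J (-1)) S1 (fun p => -1 / (x p - y p)) &
      momentum Om (gs (-1)) (J (-1)) S2 (fun p => - (x p * y p) / (x p - y p))].
Proof.
have [_ e1p e1m _] := K1_expressions; have [_ e2p e2m] := K2_expressions.
split; split=> //.
- by rewrite mu1pE; exact: (smooth_mu1 g_metric psi_form oO sO s1).
- by rewrite mu2pE; exact: (smooth_mu2 g_metric psi_form oO sO s1).
- by rewrite mu1mE; exact: (smooth_mu1 g_metric psi_form oO sO sN1).
- by rewrite mu2mE; exact: (smooth_mu2 g_metric psi_form oO sO sN1).
Qed.

Lemma K_poisson_bracket :
  [/\ poisson_commute Om (om 1) S1 S2, poisson_commute Om (om (-1)) S1 S2 &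
      eq_field Om (bracket S1 S2) (fun _ _ => 0)].
Proof.
split.
- move=> i p Op ip; rewrite -(E1 Op ip) -(E2 Op ip).
  exact: (K_poisson_global g_metric psi_form sO s1 Op ip).
- move=> i p Op ip; rewrite -(E1 Op ip) -(E2 Op ip).
  exact: (K_poisson_global g_metric psi_form sO sN1 Op ip).
- move=> i p Op ip; rewrite -(bracket_ext oO Op ip E1 E2).
  exact: (K_bracket_global g_metric psi_form alpha_form sk oO sO Op ip).
Qed.

Lemma ambikahler_on_open :
  ambikahler Om (gs 1) (J 1) (om 1) (gs (-1)) (J (-1)) (om (-1)).
Proof.
have F0 sg p ss Op := F_gt0 sO (sg := sg) (p := p) ss Op.
have sF sg ss := smooth_ff g_metric psi_form oO sO (sg := sg) ss.
split.
- exact: (ambikahler_kahler g_metric psi_form sk oO sO s1).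
- exact: (ambikahler_kahler g_metric psi_form sk oO sO sN1).
- exists (fun p => (F 1 p * F 1 p) * (F (-1) p * F (-1) p)^-1); split.
  + apply: (smooth_funM oO); first exact: (smooth_funM oO (sF 1 s1) (sF 1 s1)).
    apply: (smooth_funV oO); last exact: (smooth_funM oO (sF (-1) sN1) (sF (-1) sN1)).
    by move=> p Op; have h := F0 (-1) p sN1 Op; rewrite mulf_neq0 // gt_eqF.
  + move=> p Op; have h1 := F0 1 p s1 Op; have h2 := F0 (-1) p sN1 Op.
    by rewrite mulr_gt0 ?invr_gt0 // mulr_gt0.
  + move=> i p Op ip; have h1 := F0 1 p s1 Op; have h2 := F0 (-1) p sN1 Op.
    rewrite /ak_g /scale_field scalerA; congr (_ *: _).
    by field; rewrite !gt_eqF.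
- move=> i p Op ip X Y d0.
  have := J_orientation g_metric psi_form sO s1 Op ip d0; by rewrite mul1r.
- move=> i p Op ip X Y d0.
  have := J_orientation g_metric psi_form sO sN1 Op ip d0; by rewrite mulN1r oppr_gt0.
Qed.

Lemma ambitoric_on_open : indep_on_dense_open Om S1 S2 ->
  ambitoric Om (gs 1) (J 1) (om 1) (gs (-1)) (J (-1)) (om (-1)) S1 S2.
Proof.
move=> ind; have [_ k1p k1m] := K1_killing_all; have [_ k2p k2m] := K2_killing_all.
have [h1p h2p h1m h2m] := K_momenta; have [pp pm _] := K_poisson_bracket.
exact: (ambitoric_of_momenta oO ambikahler_on_open ind k1p k1m k2p k2m h1p h2p h1m h2m pp pm).
Qed.
End Ambitoric.

Theorem proposition3p2 (R : realType) (M : topologicalType)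
    (A : oriented_atlas R M)
    (M_hausdorff : hausdorff_space M)
    (M_second_countable : @second_countable M)
    (M_connected : connected [set: M])
    (g : field A 'M[R]_4) (g_metric : riemannian_metric [set: M] g)
    (psi : field A 'M[R]_4) (psi_form : two_form [set: M] psi)
    (alpha : field A 'rV[R]_4) (alpha_form : one_form [set: M] alpha)
    (psi_star_killing : star_killing g psi alpha)
    (psi_non_parallel : ~ parallel g psi) :
  let psip := sd_part g psi in
  let psim := asd_part g psi in
  let fp := ff g psip in
  let fm := ff g psim in
  let gp := ak_g g psip in
  let gm := ak_g g psim in
  let Jp := ak_J g psip in
  let Jm := ak_J g psim in
  let omp := ak_omega g psip in
  let omm := ak_omega g psim in
  let M0 := [set p | 0 < fp p /\ 0 < fm p] in
  let MS := [set p | fp p <> fm p] in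
  let M1 := M0 `&` MS in
  let x := fun p => (fp p + fm p) / 2 in
  let y := fun p => (fp p - fm p) / 2 in
  let mu1p := fun p => -1 / (x p + y p) in
  let mu2p := fun p => x p * y p / (x p + y p) in
  let mu1m := fun p => -1 / (x p - y p) in
  let mu2m := fun p => - (x p * y p) / (x p - y p) in
  let x2 := fun p => x p ^+ 2 in
  let y2 := fun p => y p ^+ 2 in
  let K1 := act Jp (grad g (fun p => x p + y p)) in
  let K2 := add_field (scale_field y2 (act Jp (grad g x)))
                      (scale_field x2 (act Jp (grad g y))) in
  open M1 /\
  [/\ eq_field M1 K1 (act Jm (grad g (fun p => x p - y p))),
      eq_field M1 K1 (act Jp (grad gp mu1p)),
      eq_field M1 K1 (act Jm (grad gm mu1m)) &
      eq_field M1 K1 (scale_field (fun=> - 2^-1) (sharp g alpha))] /\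
  [/\ eq_field M1 K2
        (add_field (scale_field y2 (act Jm (grad g x)))
                   (scale_field (fun p => - x2 p) (act Jm (grad g y)))),
      eq_field M1 K2 (act Jp (grad gp mu2p)) &
      eq_field M1 K2 (act Jm (grad gm mu2m))] /\
  [/\ killing M1 g K1, killing M1 gp K1 & killing M1 gm K1] /\
  [/\ killing M1 g K2, killing M1 gp K2 & killing M1 gm K2] /\
  [/\ momentum M1 gp Jp K1 mu1p, momentum M1 gp Jp K2 mu2p,
      momentum M1 gm Jm K1 mu1m & momentum M1 gm Jm K2 mu2m] /\
  [/\ poisson_commute M1 omp K1 K2, poisson_commute M1 omm K1 K2 &
      eq_field M1 (bracket K1 K2) (fun _ _ => 0)] /\
  ambikahler M1 gp Jp omp gm Jm omm /\
  (forall U : set M, open U -> U `<=` M1 -> indep_on_dense_open U K1 K2 ->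
     ambitoric U gp Jp omp gm Jm omm K1 K2).

Proof.
rewrite (sd_partE g psi) (asd_partE g psi); cbv zeta.
pose D := regular_set (g := g) (psi := psi); have oD : open D by exact: open_regular_set.
have sD : D `<=` regular_set (g := g) (psi := psi) by [].
split; first exact: oD.
split; first exact: (K1_expressions g_metric psi_form psi_star_killing oD sD).
split; first exact: (K2_expressions g_metric psi_form psi_star_killing oD sD).
split; first exact: (K1_killing_all g_metric psi_form alpha_form psi_star_killing oD sD).
split; first exact: (K2_killing_all g_metric psi_form alpha_form psi_star_killing oD sD).
split; first exact: (K_momenta g_metric psi_form psi_star_killing oD sD).
split; first exact: (K_poisson_bracket g_metric psi_form alpha_form psi_star_killing oD sD).
split; first exact: (ambikahler_on_open g_metric psi_form psi_star_killing oD sD).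
move=> U oU sU ind.
exact: (ambitoric_on_open g_metric psi_form alpha_form psi_star_killing oU sU ind).
Qed.
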